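(* Let $N$ be a semi-invariant submanifold of a nondegenerate $(g,F,\mu)$-manifold $M$ with parallel tensor field $F$. Let $D$ and $D^{\perp}$ be the $F$-invariant and $F$-anti-invariant distributions of $N$, and let $\widetilde D$ be the orthogonal complement of $F(D^{\perp})$ in the normal bundle $T^{\perp}N$. Then $D$ is integrable and the foliation $\mathcal F$ of $N$ defined by $D$ is totally geodesic if and only if the second fundamental form $h$ of $N$ satisfies $h(X,Y)\in\Gamma(\widetilde D)$ for all $X,Y\in\Gamma(D)$.
   Context: All objects are smooth; $\Gamma(V)$ denotes the smooth sections of a vector bundle $V$. Fix $\mu\in\{-1,+1\}$. A $(g,F,\mu)$-manifold is a manifold $M$ with a Riemannian metric $g$ and a $(1,1)$-tensor field $F$ such that $g(FX,Y)+\mu g(X,FY)=0$ for all vector fields $X,Y$ on $M$. It is nondegenerate if $F_x:T_xM\to T_xM$ is nondegenerate (invertible) at every $x\in M$. $F$ is parallel if $\widetilde\nabla F=0$, where $\widetilde\nabla$ is the Levi-Civita connection of $(M,g)$. A submanifold $N$ of $M$ (with induced metric, also denoted $g$, and normal bundle $T^{\perp}N$) is semi-invariant if there is a distribution $D$ on $N$ such that: (i) $F(D_x)\subset D_x$ for all $x\in N$; (ii) the orthogonal complement $D^{\perp}$ of $D$ in $TN$ satisfies $F(D^{\perp}_x)\subset T^{\perp}_xN$ for all $x\in N$; (iii) $F^2(D^{\perp})$ is a distribution on $N$ (a subbundle of $TN$). The second fundamental form $h$ of $N$ is given by $\widetilde\nabla_XY=\nabla_XY+h(X,Y)$ for $X,Y\in\Gamma(TN)$,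 where $\nabla$ is the Levi-Civita connection of $N$ and $h(X,Y)\in\Gamma(T^\perp N)$. A foliation of $N$ is totally geodesic if each of its leaves is totally geodesically immersed in $N$; ''$D$ is integrable and its foliation is totally geodesic'' is equivalent to $\nabla_XU\in\Gamma(D)$ for all $X,U\in\Gamma(D)$. *)

(* Defs.v *)
From mathcomp Require Import all_boot all_order all_algebra.
From mathcomp Require Import all_classical all_reals all_analysis.
Import Order.TTheory GRing.Theory Num.Theory.
Import numFieldNormedType.Exports.

Set Implicit Arguments.
Unset Strict Implicit.
Unset Printing Implicit Defensive.

Local Open Scope classical_set_scope.
Local Open Scope ring_scope.

(* Calculus on open subsets U of R^n, whose points are row vectors. *)

Fixpoint Ck (R : realType) (n : nat) (V : normedModType R) (k : nat)
    (U : set 'rV[R]_n) (f : 'rV[R]_n -> V) : Prop :=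
  if k is k'.+1 then
    (forall x, U x -> differentiable f x) /\
    (forall v, Ck k' U (fun x => 'D_v f x))
  else forall x, U x -> {for x, continuous f}.

Definition smooth_on (R : realType) (n : nat) (V : normedModType R)
    (U : set 'rV[R]_n) (f : 'rV[R]_n -> V) : Prop :=
  forall k, Ck k U f.

(* Manifolds *)

(* Only the values of chart_fun on chart_dom, and of chart_inv on chart_cod,
   are meaningful. *)
Record chart (R : realType) (M : topologicalType) (n : nat) := Chart {
  chart_dom : set M;
  chart_cod : set 'rV[R]_n;
  chart_fun :> M -> 'rV[R]_n;
  chart_inv : 'rV[R]_n -> M;
  chart_dom_open : open chart_dom;
  chart_cod_open : open chart_cod;
  chart_funS : forall p, chart_dom p -> chart_cod (chart_fun p);
  chart_invS : forall x, chart_cod x -> chart_dom (chart_inv x);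
  chart_funK : forall p, chart_dom p -> chart_inv (chart_fun p) = p;
  chart_invK : forall x, chart_cod x -> chart_fun (chart_inv x) = x;
  chart_fun_cts : forall p, chart_dom p -> {for p, continuous chart_fun};
  chart_inv_cts : forall x, chart_cod x -> {for x, continuous chart_inv} }.

(* A smooth n-manifold without boundary.  The chart chart_at p chosen at each
   point p identifies the tangent space T_pM with R^n: throughout, a tangent
   vector at p is the row vector of its components in chart_at p, and a vector
   field is a function M -> 'rV[R]_n, X p standing for an element of T_pM.  As
   chart_at p varies with p in an arbitrary way, smoothness of a vector field
   is not that of this function; see tangent_coord and smooth_along. *)
Record manifold (R : realType) (n : nat) := Manifold {
  manifold_space :> topologicalType;
  manifold_hausdorff : hausdorff_space manifold_space;
  manifold_countable : @second_countable manifold_space;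
  atlas : set (chart R manifold_space n);
  chart_at : manifold_space -> chart R manifold_space n;
  chart_at_atlas : forall p, atlas (chart_at p);
  chart_at_dom : forall p, chart_dom (chart_at p) p;
  atlas_compatible : forall c c', atlas c -> atlas c' ->
    smooth_on (chart_cod c `&` chart_inv c @^-1` chart_dom c')
      (c' \o chart_inv c) }.

(* c is a chart; the set of coordinates of the points of U in the domain of c *)
Definition chart_image (R : realType) (n : nat) (M : manifold R n)
    (c : chart R M n) (U : set M) : set 'rV[R]_n :=
  chart_cod c `&` chart_inv c @^-1` U.

Definition smooth_fun (R : realType) (n : nat) (M : manifold R n)
    (U : set M) (phi : M -> R) : Prop :=
  forall c, atlas c ->
    @smooth_on R n R^o (chart_image c U) (phi \o chart_inv c).

Definition smooth_map (R : realType) (n m : nat) (N : manifold R n)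
    (M : manifold R m) (f : N -> M) : Prop :=
  continuous f /\
  forall c c', atlas c -> atlas c' ->
    smooth_on (chart_image c (f @^-1` chart_dom c')) (c' \o f \o chart_inv c).

(* v(phi), the derivative of a vector-valued function phi in the direction of
   the tangent vector v at p *)
Definition tderive (R : realType) (n : nat) (M : manifold R n)
    (V : normedModType R) (phi : M -> V) (p : M) (v : 'rV[R]_n) : V :=
  'D_v (phi \o chart_inv (chart_at p)) (chart_at p p).

(* components, in the chart c, of the tangent vector v at p *)
Definition tangent_coord (R : realType) (n : nat) (M : manifold R n)
    (c : chart R M n) (p : M) (v : 'rV[R]_n) : 'rV[R]_n :=
  tderive c p v.

(* tangent map T_pN -> T_(f p)M *)
Definition tmap (R : realType) (n m : nat) (N : manifold R n)
    (M : manifold R m) (f : N -> M) (p : N) (v : 'rV[R]_n) : 'rV[R]_m :=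
  tderive (chart_at (f p) \o f) p v.

(* V, with V p in T_(f p)M, is smooth on the open set U as a section of the
   pull-back bundle f^*TM.  For f = idfun, V is a vector field on M. *)
Definition smooth_along (R : realType) (n m : nat) (N : manifold R n)
    (M : manifold R m) (f : N -> M) (U : set N) (V : N -> 'rV[R]_m) : Prop :=
  forall c c', atlas c -> atlas c' ->
    smooth_on (chart_image c (U `&` f @^-1` chart_dom c'))
      ((fun p => tangent_coord c' (f p) (V p)) \o chart_inv c).

Definition smooth_field (R : realType) (n : nat) (M : manifold R n)
    (U : set M) (X : M -> 'rV[R]_n) : Prop :=
  @smooth_along R n n M M idfun U X.

(* [X, Y]^a = X^b d_b Y^a - Y^b d_b X^a, computed at p in chart_at p *)
Definition lie_bracket (R : realType) (n : nat) (M : manifold R n)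
    (X Y : M -> 'rV[R]_n) (p : M) : 'rV[R]_n :=
  tderive (fun q => tangent_coord (chart_at p) q (Y q)) p (X p) -
  tderive (fun q => tangent_coord (chart_at p) q (X q)) p (Y p).

(* Connections *)

(* A connection on f^*TM: nabla p v V is the derivative of the section V in the
   direction v in T_pN.  It is defined for sections that are smooth near p and
   depends only on their germ at p; its values on other functions V are
   irrelevant. *)
Record connection_along (R : realType) (n m : nat) (N : manifold R n)
    (M : manifold R m) (f : N -> M)
    (nabla : N -> 'rV[R]_n -> (N -> 'rV[R]_m) -> 'rV[R]_m) : Prop := {
  connection_linear : forall (U : set N) V p a (u v : 'rV[R]_n),
    open U -> U p -> smooth_along f U V ->
    nabla p (a *: u + v) V = a *: nabla p u V + nabla p v V;
  connection_add : forall (U : set N) V W p v,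
    open U -> U p -> smooth_along f U V -> smooth_along f U W ->
    nabla p v (fun q => V q + W q) = nabla p v V + nabla p v W;
  connection_leibniz : forall (U : set N) (phi : N -> R) V p v,
    open U -> U p -> smooth_fun U phi -> smooth_along f U V ->
    nabla p v (fun q => phi q *: V q) =
      (@tderive R n N R^o phi p v : R) *: V p + phi p *: nabla p v V;
  connection_local : forall (U : set N) V W p v,
    open U -> U p -> smooth_along f U V -> smooth_along f U W ->
    (forall q, U q -> V q = W q) -> nabla p v V = nabla p v W;
  connection_smooth : forall (U : set N) X V,
    open U -> smooth_field U X -> smooth_along f U V ->
    smooth_along f U (fun q => nabla q (X q) V) }.

Definition affine_connection (R : realType) (n : nat) (M : manifold R n)
    (nabla : M -> 'rV[R]_n -> (M -> 'rV[R]_n) -> 'rV[R]_n) : Prop :=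
  @connection_along R n n M M idfun nabla.

(* the connection on f^*TM induced by the affine connection nabla of M; it
   exists and is unique *)
Definition pullback_connection (R : realType) (n m : nat) (N : manifold R n)
    (M : manifold R m) (f : N -> M)
    (nabla : M -> 'rV[R]_m -> (M -> 'rV[R]_m) -> 'rV[R]_m)
    (nablaf : N -> 'rV[R]_n -> (N -> 'rV[R]_m) -> 'rV[R]_m) : Prop :=
  connection_along f nablaf /\
  forall (U : set M) (Y : M -> 'rV[R]_m) p v,
    open U -> U (f p) -> smooth_field U Y ->
    nablaf p v (Y \o f) = nabla (f p) (tmap f p v) Y.

(* Metrics *)

Record riemannian_metric (R : realType) (n : nat) (M : manifold R n)
    (g : M -> 'rV[R]_n -> 'rV[R]_n -> R) : Prop := {
  metric_linear : forall p a u v w,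
    g p (a *: u + v) w = a * g p u w + g p v w;
  metric_sym : forall p u v, g p u v = g p v u;
  metric_pos : forall p u, u != 0 -> 0 < g p u u;
  metric_smooth : forall (U : set M) X Y,
    open U -> smooth_field U X -> smooth_field U Y ->
    smooth_fun U (fun p => g p (X p) (Y p)) }.

Record levi_civita (R : realType) (n : nat) (M : manifold R n)
    (g : M -> 'rV[R]_n -> 'rV[R]_n -> R)
    (nabla : M -> 'rV[R]_n -> (M -> 'rV[R]_n) -> 'rV[R]_n) : Prop := {
  levi_civita_connection : affine_connection nabla;
  levi_civita_torsion : forall (U : set M) X Y p,
    open U -> U p -> smooth_field U X -> smooth_field U Y ->
    nabla p (X p) Y - nabla p (Y p) X = lie_bracket X Y p;
  levi_civita_metric : forall (U : set M) X Y p v,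
    open U -> U p -> smooth_field U X -> smooth_field U Y ->
    @tderive R n M R^o (fun q => g q (X q) (Y q)) p v =
      g p (nabla p v X) (Y p) + g p (X p) (nabla p v Y) }.

(* orthogonal complement, in the tangent space at p, of a set S of tangent
   vectors at p *)
Definition orthogonal_at (R : realType) (n : nat) (M : manifold R n)
    (g : M -> 'rV[R]_n -> 'rV[R]_n -> R) (p : M) (S : set 'rV[R]_n) :
    set 'rV[R]_n :=
  [set u | forall w, S w -> g p u w = 0].

(* Submanifolds: injectively immersed manifolds, with the induced metric *)

Record immersed_submanifold (R : realType) (n m : nat) (N : manifold R n)
    (M : manifold R m) (f : N -> M) : Prop := {
  submanifold_smooth : smooth_map f;
  submanifold_inj : injective f;
  submanifold_immersion : forall p, injective (tmap f p) }.

Definition induced_metric (R : realType) (n m : nat) (N : manifold R n)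
    (M : manifold R m) (f : N -> M) (g : M -> 'rV[R]_m -> 'rV[R]_m -> R)
    (p : N) (u v : 'rV[R]_n) : R :=
  g (f p) (tmap f p u) (tmap f p v).

Definition normal_space (R : realType) (n m : nat) (N : manifold R n)
    (M : manifold R m) (f : N -> M) (g : M -> 'rV[R]_m -> 'rV[R]_m -> R)
    (p : N) : set 'rV[R]_m :=
  orthogonal_at g (f p) (range (tmap f p)).

(* h(X, Y), where nablaN is the Levi-Civita connection of N and nablaf the
   connection on f^*TM induced by that of M *)
Definition second_fundamental_form (R : realType) (n m : nat)
    (N : manifold R n) (M : manifold R m) (f : N -> M)
    (nablaN : N -> 'rV[R]_n -> (N -> 'rV[R]_n) -> 'rV[R]_n)
    (nablaf : N -> 'rV[R]_n -> (N -> 'rV[R]_m) -> 'rV[R]_m)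
    (X Y : N -> 'rV[R]_n) (p : N) : 'rV[R]_m :=
  nablaf p (X p) (fun q => tmap f q (Y q)) - tmap f p (nablaN p (X p) Y).

(* both connections are uniquely determined *)
Definition totally_geodesic_immersion (R : realType) (n m : nat)
    (N : manifold R n) (M : manifold R m) (f : N -> M)
    (g : M -> 'rV[R]_m -> 'rV[R]_m -> R)
    (nabla : M -> 'rV[R]_m -> (M -> 'rV[R]_m) -> 'rV[R]_m) : Prop :=
  exists nablaN nablaf,
    [/\ levi_civita (induced_metric f g) nablaN,
        pullback_connection f nabla nablaf &
        forall X Y, smooth_field setT X -> smooth_field setT Y ->
          forall p, second_fundamental_form f nablaN nablaf X Y p = 0].

(* Distributions *)

(* a rank k subbundle of TN, spanned by k independent smooth vector fields near
   each point *)
Definition tangent_distribution (R : realType) (n : nat) (N : manifold R n)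
    (D : N -> set 'rV[R]_n) : Prop :=
  exists k : nat, forall p : N, exists (U : set N) (E : 'I_k -> N -> 'rV[R]_n),
    [/\ open U, U p, forall i, smooth_field U (E i) &
      forall q, U q -> free [seq E i q | i : 'I_k] /\
        D q = [set u | u \in <<[seq E i q | i : 'I_k]>>%VS]].

(* sections of f^*TM with values in the subspaces S p of T_(f p)M *)
Definition section_along (R : realType) (n m : nat) (N : manifold R n)
    (M : manifold R m) (f : N -> M) (S : N -> set 'rV[R]_m)
    (V : N -> 'rV[R]_m) : Prop :=
  smooth_along f setT V /\ forall p, S p (V p).

Definition section_of (R : realType) (n : nat) (N : manifold R n)
    (D : N -> set 'rV[R]_n) (X : N -> 'rV[R]_n) : Prop :=
  @section_along R n n N N idfun D X.

Definition integral_manifold (R : realType) (n k : nat) (N : manifold R n)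
    (D : N -> set 'rV[R]_n) (L : manifold R k) (j : L -> N) : Prop :=
  immersed_submanifold j /\ forall q, range (tmap j q) = D (j q).

Definition integrable_distribution (R : realType) (n : nat) (N : manifold R n)
    (D : N -> set 'rV[R]_n) : Prop :=
  forall p : N, exists (k : nat) (L : manifold R k) (j : L -> N),
    integral_manifold D j /\ range j p.

(* The leaves of the foliation defined by an integrable D are its maximal
   connected integral manifolds, and every integral manifold is locally an open
   piece of a leaf, so that the leaves are totally geodesic when all integral
   manifolds are, and conversely. *)
Definition totally_geodesic_foliation (R : realType) (n : nat)
    (N : manifold R n) (g : N -> 'rV[R]_n -> 'rV[R]_n -> R)
    (nabla : N -> 'rV[R]_n -> (N -> 'rV[R]_n) -> 'rV[R]_n)
    (D : N -> set 'rV[R]_n) : Prop :=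
  forall (k : nat) (L : manifold R k) (j : L -> N),
    integral_manifold D j -> totally_geodesic_immersion j g nabla.

(* (g, F, mu)-manifolds *)

Definition tensor11 (R : realType) (m : nat) (M : manifold R m)
    (F : M -> 'rV[R]_m -> 'rV[R]_m) : Prop :=
  (forall p, linear (F p)) /\
  forall (U : set M) X, open U -> smooth_field U X ->
    smooth_field U (fun p => F p (X p)).

Definition gFmu_manifold (R : realType) (m : nat) (M : manifold R m)
    (g : M -> 'rV[R]_m -> 'rV[R]_m -> R) (F : M -> 'rV[R]_m -> 'rV[R]_m)
    (mu : R) : Prop :=
  [/\ riemannian_metric g, tensor11 F &
      forall p u v, g p (F p u) v + mu * g p u (F p v) = 0].

Definition nondegenerate_tensor (R : realType) (m : nat) (M : manifold R m)
    (F : M -> 'rV[R]_m -> 'rV[R]_m) : Prop :=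
  forall p, bijective (F p).

(* (nabla_v F) Y = nabla_v (F Y) - F (nabla_v Y) = 0 *)
Definition parallel_tensor (R : realType) (m : nat) (M : manifold R m)
    (nabla : M -> 'rV[R]_m -> (M -> 'rV[R]_m) -> 'rV[R]_m)
    (F : M -> 'rV[R]_m -> 'rV[R]_m) : Prop :=
  forall (U : set M) Y p v, open U -> U p -> smooth_field U Y ->
    nabla p v (fun q => F q (Y q)) - F p (nabla p v Y) = 0.

(* D^perp in TN, for a distribution D on the submanifold f : N -> M *)
Definition anti_invariant (R : realType) (n m : nat) (N : manifold R n)
    (M : manifold R m) (f : N -> M) (g : M -> 'rV[R]_m -> 'rV[R]_m -> R)
    (D : N -> set 'rV[R]_n) (p : N) : set 'rV[R]_n :=
  orthogonal_at (induced_metric f g) p (D p).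

(* D is a distribution satisfying (i), (ii), (iii); subspaces of T_pN are viewed
   in T_(f p)M through tmap f p, so that (iii) asserts that F^2(D^perp) is the
   image of a distribution E on N *)
Record semi_invariant (R : realType) (n m : nat) (N : manifold R n)
    (M : manifold R m) (f : N -> M) (g : M -> 'rV[R]_m -> 'rV[R]_m -> R)
    (F : M -> 'rV[R]_m -> 'rV[R]_m) (D : N -> set 'rV[R]_n) : Prop := {
  semi_invariant_distribution : tangent_distribution D;
  semi_invariant_D : forall p,
    F (f p) @` (tmap f p @` D p) `<=` tmap f p @` D p;
  semi_invariant_Dperp : forall p,
    F (f p) @` (tmap f p @` anti_invariant f g D p) `<=` normal_space f g p;
  semi_invariant_F2 : exists E, tangent_distribution E /\ forall p,
    F (f p) @` (F (f p) @` (tmap f p @` anti_invariant f g D p)) =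
      tmap f p @` E p }.

(* the orthogonal complement of F(D^perp) in the normal space *)
Definition Dtilde (R : realType) (n m : nat) (N : manifold R n)
    (M : manifold R m) (f : N -> M) (g : M -> 'rV[R]_m -> 'rV[R]_m -> R)
    (F : M -> 'rV[R]_m -> 'rV[R]_m) (D : N -> set 'rV[R]_n) (p : N) :
    set 'rV[R]_m :=
  normal_space f g p `&`
  orthogonal_at g (f p) (F (f p) @` (tmap f p @` anti_invariant f g D p)).

(* Main.v *)
(** Since F is skew up to the sign mu and parallel, for X, Y in D and Z in
    D^perp one has g(h(X, Y), F Z) = - mu g(nabla_X (F Y), Z), where Gauss'
    formula removes the tangential terms because F Z is normal and F Y is again
    a section of D.  So h(X, Y) is orthogonal to F(D^perp) for all X, Y in D iff
    nabla_X (F Y) is in D for all X, Y in D, and, F being invertible on D, iff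
    nabla_X Y is in D for all X, Y in D.  This last condition yields both
    integrability (the bracket is nabla_X Y - nabla_Y X) by Frobenius' theorem
    and totally geodesic leaves, and follows from them.

    For Frobenius' theorem, normalize a local frame of D so that a fixed linear
    map of the chart sends it to the canonical basis: the frame then commutes,
    and the time-one flow of its linear combinations parametrizes a leaf, which
    is made an immersion of all of R^k by composing with a multiple of arctan. *)

Require Import Defs.
From HB Require Import structures.
From mathcomp Require Import all_boot all_order all_algebra.
From mathcomp Require Import all_classical all_reals all_analysis.
From mathcomp Require Import perm ring lra.
Import Order.TTheory GRing.Theory Num.Theory.
Import numFieldNormedType.Exports.

Set Implicit Arguments.
Unset Strict Implicit.
Unset Printing Implicit Defensive.

Local Open Scope classical_set_scope.
Local Open Scope ring_scope.

(** * C^k maps and differential calculus *)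

(** The condition on h is tested on global sections only, whereas frames, leaves and Frobenius'
    theorem are local: one bump function at p, multiplied into the local fields, bridges the two,
    and its derivative contributes only terms inside D. Preimages under tangent maps, coefficients
    in a frame and images of D under F are picked point by point; their smoothness is recovered each
    time by Cramer's rule for an invertible Gram matrix. The connection of N and the pull-back
    connection are known by their axioms alone, so Gauss' formula is itself deduced from vanishing
    torsion and compatibility with the metric, which are checked along a map by expanding sections
    in pulled-back coordinate fields. The flow is built by Picard iteration on a fixed time
    interval, the parameters being kept small instead. Its differentiability in the parameters rests
    on an explicit candidate for the differential, which commutation provides; higher smoothness
    then follows from the equation that this differential satisfies. *)

Lemma differentiable_eps (R : realType) (V W : normedModType R) (f : V -> W) x
    (L : {linear V -> W}) : continuous L ->
  (forall e, 0 < e ->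
     \forall h \near (0 : V), `|f (h + x) - f x - L h| <= e * `|h|) ->
  differentiable f x /\ 'd f x = L :> (V -> W).
Proof.
move=> Lc H.
have E : f \o shift x = cst (f x) + L +o_ 0 id.
  apply/eqaddoP => e e0; have := H _ e0; apply: filterS => h.
  by rewrite !fctE /= opprD addrA.
have dE := diff_unique Lc E; split => //.
apply/diff_locallyP; rewrite dE; split => //.
Qed.

Lemma differentiable_near (R : realType) (V W : normedModType R)
    (f g : V -> W) x :
  (\near x, f x = g x) -> differentiable f x -> differentiable g x.
Proof.
move=> fg df; have /diff_locallyP [dc E] := df.
have [//|e e0|//] := @differentiable_eps R V W g x ('d f x).
move/eqaddoP: E => /(_ _ e0) E.
have : \forall h \near (0 : V), f (h + x) = g (h + x).
  move: fg; rewrite (near_shift 0) /=; apply: filterS => h /=.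
  by rewrite subr0.
apply: filterS2 E => h; rewrite !fctE /= => + <-.
by rewrite (nbhs_singleton fg) opprD addrA.
Qed.

Lemma derivable_differentiable1 (R : realType) (f : R -> R^o) (x : R) (d : R) :
  is_derive x (1 : R) f d -> differentiable f x.
Proof. by case=> + _ => /derivable1_diffP. Qed.

Section Ck.
Context (R : realType) (n : nat).
Implicit Types (U W : set 'rV[R]_n) (V : normedModType R).

Lemma Ck_local V k U (f : 'rV[R]_n -> V) :
  (forall x, U x -> exists W, [/\ open W, W x & Ck k W f]) -> Ck k U f.
Proof.
elim: k U f => [|k IH] U f H /=.
  by move=> x /H [W [_ Wx /(_ _ Wx)]].
split=> [x /H [W [_ Wx [/(_ _ Wx)]]]//|v].
by apply: IH => x /H [W [oW Wx [_ Hf]]]; exists W; split=> //; exact: Hf.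
Qed.

Lemma Ck_sub V k U W (f : 'rV[R]_n -> V) : U `<=` W -> Ck k W f -> Ck k U f.
Proof.
elim: k f => [|k IH] f UW /=; first by move=> H x /UW /H.
by move=> [H1 H2]; split=> [x /UW /H1|v]//; apply: IH.
Qed.

Lemma Ck_ext V k U (f g : 'rV[R]_n -> V) : open U ->
  (forall x, U x -> f x = g x) -> Ck k U f -> Ck k U g.
Proof.
move=> oU; elim: k f g => [|k IH] f g fg /=.
  move=> H x Ux; have near_fg : \near x, f x = g x.
    by apply: filterS (open_nbhs_nbhs (conj oU Ux)).
  have := H _ Ux; rewrite /prop_for /continuous_at -(fg _ Ux) => fx.
  exact: cvg_trans (near_eq_cvg near_fg) fx.
move=> [H1 H2]; have near_fg x : U x -> \near x, f x = g x.
  by move=> Ux; apply: filterS (open_nbhs_nbhs (conj oU Ux)).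
split=> [x Ux|v]; first exact: differentiable_near (near_fg _ Ux) (H1 _ Ux).
apply: IH (H2 v) => x Ux; exact: near_eq_derive (near_fg _ Ux).
Qed.

Lemma Ck_pred V k U (f : 'rV[R]_n -> V) : Ck k.+1 U f -> Ck k U f.
Proof.
elim: k f => [|k IH] f [H1 H2].
  by move=> x Ux; apply: differentiable_continuous; apply: H1.
by split=> // v; apply: IH.
Qed.

Lemma CkS V k U (f : 'rV[R]_n -> V) : Ck k.+1 U f ->
  (forall x, U x -> differentiable f x) /\
  (forall v, Ck k U (fun x => 'D_v f x)).
Proof. by []. Qed.

Lemma Ck_cst V k U (a : V) : Ck k U (cst a).
Proof.
elim: k a => [|k IH] a /=; first by move=> x _; apply: cst_continuous.
split=> [x _|v]; first exact: differentiable_cst.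
have -> : (fun x => 'D_v (cst a) x) = cst 0 by apply/funext => x; rewrite derive_cst.
exact: IH.
Qed.

Lemma CkD k U (f g : 'rV[R]_n -> R^o) : open U ->
  Ck k U f -> Ck k U g -> Ck k U (fun x => f x + g x).
Proof.
move=> oU; elim: k f g => [|k IH] f g /=.
  by move=> Hf Hg x Ux; exact: cvgD (Hf x Ux) (Hg x Ux).
move=> [Hf1 Hf2] [Hg1 Hg2]; split=> [x Ux|v].
  by apply: differentiableD; [apply: Hf1|apply: Hg1].
apply: (@Ck_ext _ _ _ (fun x => 'D_v f x + 'D_v g x)) => //; last exact: IH.
move=> x Ux; rewrite -deriveD //; apply: diff_derivable; auto.
Qed.

Lemma CkM k U (f g : 'rV[R]_n -> R^o) : open U ->
  Ck k U f -> Ck k U g -> Ck k U (fun x => f x * g x : R^o).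
Proof.
move=> oU; elim: k f g => [|k IH] f g.
  by move=> Hf Hg x Ux; exact: cvgM (Hf x Ux) (Hg x Ux).
move=> Hf Hg; have [Hf1 Hf2] := CkS Hf; have [Hg1 Hg2] := CkS Hg; split=> [x Ux|v].
  by apply: differentiableM; [apply: Hf1|apply: Hg1].
apply: (@Ck_ext _ _ _ (fun x => f x * 'D_v g x + g x * 'D_v f x)) => //.
  by move=> x Ux; rewrite -[RHS]/('D_v (f * g) x) deriveM //; apply: diff_derivable; auto.
by apply: CkD => //; apply: IH => //; apply: Ck_pred.
Qed.

(** The derivative of 1/f is written with two factors 1/f and one derivative of f, all of which are
    of the order covered by the induction hypothesis. *)
Lemma CkV k U (f : 'rV[R]_n -> R^o) : open U -> (forall x, U x -> f x != 0) ->
  Ck k U f -> Ck k U (fun x => (f x)^-1 : R^o).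
Proof.
move=> oU f0; elim: k => [|k IH].
  by move=> Hf x Ux; exact: cvgV (f0 x Ux) (Hf x Ux).
move=> Hf; have [Hf1 Hf2] := CkS Hf; split=> [x Ux|v].
  by apply: differentiableV; [apply: Hf1|apply: f0].
apply: (@Ck_ext _ _ _ (fun x => - 1 * (((f x)^-1 * (f x)^-1) * 'D_v f x))) => //.
  move=> x Ux; rewrite deriveV ?f0 //; last by apply: diff_derivable; auto.
  by rewrite /GRing.scale /= expr2 invfM; ring.
apply: CkM => //; first exact: Ck_cst.
have IHf := IH (Ck_pred Hf).
by apply: CkM => //; apply: CkM.
Qed.

Lemma Ck_sum (I : Type) (r : seq I) (P : pred I) k U (f : I -> 'rV[R]_n -> R^o) :
  open U -> (forall i, P i -> Ck k U (f i)) ->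
  Ck k U (fun x => \sum_(i <- r | P i) f i x : R^o).
Proof.
move=> oU H.
have -> : (fun x => \sum_(i <- r | P i) f i x : R^o) =
    \big[(fun g h => fun x => g x + h x)/(cst 0)]_(i <- r | P i) f i.
  by apply/funext => x; elim/big_rec2: _ => //= i g y Pi ->.
by elim/big_ind: _ => // [|g h]; [apply: Ck_cst|apply: CkD].
Qed.

Lemma Ck_prod (I : Type) (r : seq I) (P : pred I) k U (f : I -> 'rV[R]_n -> R^o) :
  open U -> (forall i, P i -> Ck k U (f i)) ->
  Ck k U (fun x => \prod_(i <- r | P i) f i x : R^o).
Proof.
move=> oU H.
have -> : (fun x => \prod_(i <- r | P i) f i x : R^o) =
    \big[(fun g h => fun x => g x * h x)/(cst 1)]_(i <- r | P i) f i.
  by apply/funext => x; elim/big_rec2: _ => //= i g y Pi ->.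
by elim/big_ind: _ => // [|g h]; [apply: Ck_cst|apply: CkM].
Qed.

Lemma Ck_det k U p (f : 'I_p -> 'I_p -> 'rV[R]_n -> R^o) : open U ->
  (forall i j, Ck k U (f i j)) ->
  Ck k U (fun x => \det (\matrix_(i, j) f i j x) : R^o).
Proof.
move=> oU H; rewrite /determinant; apply: Ck_sum => // s _.
apply: CkM => //; first exact: Ck_cst.
apply: Ck_prod => // i _; have := H i (s i); apply: Ck_ext => // x _.
by rewrite mxE.
Qed.

End Ck.

Lemma coord_derive (R : realType) (V : normedModType R) m (f : V -> 'rV[R]_m)
    x v j : differentiable f x ->
  ('D_v f x) 0 j = 'D_v (fun y => f y 0 j : R^o) x.
Proof.
by move=> df; rewrite derive_mx ?mxE //; apply: diff_derivable.
Qed.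

Lemma differentiable_rV (R : realType) (V : normedModType R) m
    (f : V -> 'rV[R]_m) x :
  differentiable f x <-> forall j, differentiable (fun y => f y 0 j : R^o) x.
Proof.
split=> [df j|H].
  by apply: (@differentiable_comp _ _ _ _ f (fun u : 'rV[R]_m => u 0 j : R^o)) => //;
     apply: differentiable_coord.
have -> : f = \sum_(j < m) (fun y => (f y 0 j : R^o) *: (delta_mx 0 j : 'rV[R]_m)).
  apply/funext => y; rewrite [LHS]row_sum_delta.
  by elim/big_ind2: _ => // ? g ? h -> ->.
apply: differentiable_sum => j; apply: differentiableZl; exact: H.
Qed.

(** Sums, products and composites are treated for real-valued functions; this equivalence carries
    them over to vector-valued maps. *)
Lemma Ck_coord (R : realType) n m k (U : set 'rV[R]_n)
    (f : 'rV[R]_n -> 'rV[R]_m) : open U ->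
  Ck k U f <-> forall j, Ck k U (fun x => f x 0 j : R^o).
Proof.
move=> oU; elim: k f => [|k IH] f.
  split=> [H j x Ux|H x Ux].
    exact: continuous_comp (H _ Ux) (@coord_continuous _ _ _ 0 j (f x)).
  have xF : Filter (nbhs x) by exact: nbhs_filter.
  apply: (@cvgrPdist_lt _ _ _ (nbhs x) _ f (f x)).2 => e e0.
  have : \forall y \near x, forall j, `|f x 0 j - f y 0 j| < e.
    apply: (@filter_forall _ _ (fun j y => `|f x 0 j - f y 0 j| < e) _ xF) => j.
    exact: (@cvgrPdist_lt _ _ _ (nbhs x) xF _ (f x 0 j)).1 (H j x Ux) e e0.
  apply: filterS => y Hy.
  rewrite [ltLHS]/Num.Def.normr /= mx_normrE bigmax_lt // => -[i j] _ /=.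
  by rewrite !mxE (ord1 i).
split=> [[H1 H2] j|H]; last split=> [x Ux|v].
- split=> [x Ux|v]; first by apply: (iffLR (differentiable_rV _ _)); apply: H1.
  have /IH/(_ j) := H2 v; apply: Ck_ext => // x Ux.
  by rewrite coord_derive //; apply: H1.
- by apply/differentiable_rV => j; have [+ _] := H j; apply.
- apply/IH => j; have [_ /(_ v)] := H j; apply: Ck_ext => // x Ux.
  rewrite coord_derive //; apply/differentiable_rV => i.
  by have [+ _] := H i; apply.
Qed.

Lemma derive_comp (R : realType) (U V W : normedModType R) (g : U -> V)
    (f : V -> W) x v : differentiable g x -> differentiable f (g x) ->
  'D_v (f \o g) x = 'D_('D_v g x) f (g x).
Proof.
move=> dg df; rewrite !deriveE //; last exact: differentiable_comp.
by rewrite diff_comp.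
Qed.

Lemma derive_linear (R : realType) (V W : normedModType R) (f : V -> W) x a u v :
  differentiable f x -> 'D_(a *: u + v) f x = a *: 'D_u f x + 'D_v f x.
Proof. by move=> df; rewrite !deriveE // linearP. Qed.

Lemma derive_sum_coord (R : realType) m (W : normedModType R)
   (f : 'rV[R]_m -> W) x v : differentiable f x ->
  'D_v f x = \sum_(i < m) v 0 i *: 'D_(delta_mx 0 i) f x.
Proof.
move=> df; rewrite deriveE // {1}(row_sum_delta v) linear_sum /=.
by apply: eq_bigr => i _; rewrite linearZ deriveE.
Qed.

(** By the chain rule the derivative of the composite is a sum of products of components of ['D_v g]
    with partial derivatives of f composed with g; these composites are one order lower and fall
    under the induction hypothesis. *)
Lemma Ck_comp0 (R : realType) n m k (U : set 'rV[R]_n) (W : set 'rV[R]_m)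
    (g : 'rV[R]_n -> 'rV[R]_m) (f : 'rV[R]_m -> R^o) : open U ->
  (forall x, U x -> W (g x)) -> Ck k U g -> Ck k W f -> Ck k U (f \o g).
Proof.
move=> oU UW; elim: k f => [|k IH] f Hg Hf.
  by move=> x Ux; apply: continuous_comp; [apply: Hg|apply: Hf; apply: UW].
have [Hg1 Hg2] := CkS Hg; have [Hf1 Hf2] := CkS Hf; split=> [x Ux|v].
  by apply: differentiable_comp; [apply: Hg1|apply: Hf1; apply: UW].
apply: (@Ck_ext _ _ _ _ _ (fun x => \sum_(i < m)
   ('D_v g x) 0 i * ((fun y => 'D_(delta_mx 0 i) f y) \o g) x)) => //.
  move=> x Ux; rewrite (derive_comp v (Hg1 _ Ux) (Hf1 _ (UW _ Ux))).
  by rewrite (derive_sum_coord _ (Hf1 _ (UW _ Ux))).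
apply: Ck_sum => // i _; apply: CkM => //.
  by have /(Ck_coord _ _ oU)/(_ i) := Hg2 v.
by apply: IH; [apply: Ck_pred|apply: Hf2].
Qed.

Lemma Ck_comp (R : realType) n m p k (U : set 'rV[R]_n) (W : set 'rV[R]_m)
    (g : 'rV[R]_n -> 'rV[R]_m) (f : 'rV[R]_m -> 'rV[R]_p) : open U -> open W ->
  (forall x, U x -> W (g x)) -> Ck k U g -> Ck k W f -> Ck k U (f \o g).
Proof.
move=> oU oW UW Hg /(Ck_coord _ _ oW) Hf; apply/Ck_coord => // j.
exact: (Ck_comp0 oU UW Hg (Hf j)).
Qed.

Lemma Ck_linear (R : realType) n m k (U : set 'rV[R]_n)
    (f : {linear 'rV[R]_n -> 'rV[R]_m}) : continuous f -> Ck k U f.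
Proof.
move=> fc; case: k => [|k]; first by move=> x _; apply: fc.
split=> [x _|v]; first exact: linear_differentiable.
have -> : (fun x => 'D_v f x) = cst (f v).
  by apply/funext => x; rewrite deriveE ?diff_lin //; apply: linear_differentiable.
exact: Ck_cst.
Qed.

Lemma Ck_id (R : realType) n k (U : set 'rV[R]_n) : Ck k U (@id 'rV[R]_n).
Proof. by apply: (@Ck_linear R n n k U idfun) => x; apply: cvg_id. Qed.

Lemma Ck_proj (R : realType) n k (U : set 'rV[R]_n) j :
  Ck k U (fun x => x 0 j : R^o).
Proof.
apply: (@Ck_sub _ _ _ _ _ setT) => //.
by have /(Ck_coord k _ openT) := @Ck_id R n k setT; apply.
Qed.

Section linear_functions.
Context (R : realType) (V W : lmodType R) (L : V -> W).
Hypothesis Ll : forall a u v, L (a *: u + v) = a *: L u + L v.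

(** Tangent maps, chart components, tensors, the metric in one slot and connections in their
    direction are plain functions, linear only at given points or under smoothness conditions; hence
    linearity as a bare hypothesis instead of a bundled linear map. *)
Lemma linfun0 : L 0 = 0.
Proof. by have := Ll (- 1) 0 0; rewrite scaler0 addr0 scaleN1r addNr. Qed.

Lemma linfunD u v : L (u + v) = L u + L v.
Proof. by have := Ll 1 u v; rewrite !scale1r. Qed.

Lemma linfunZ a u : L (a *: u) = a *: L u.
Proof. by have := Ll a u 0; rewrite linfun0 !addr0. Qed.

Lemma linfunN u : L (- u) = - L u.
Proof. by rewrite -scaleN1r linfunZ scaleN1r. Qed.

Lemma linfunB u v : L (u - v) = L u - L v.
Proof. by rewrite linfunD linfunN. Qed.

Lemma linfun_sum (I : Type) (r : seq I) (P : pred I) (F : I -> V) :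
  L (\sum_(i <- r | P i) F i) = \sum_(i <- r | P i) L (F i).
Proof. exact: (big_morph L linfunD linfun0). Qed.

Lemma linfun_lincomb (I : Type) (r : seq I) (P : pred I) (a : I -> R) (F : I -> V) :
  L (\sum_(i <- r | P i) a i *: F i) = \sum_(i <- r | P i) a i *: L (F i).
Proof. by rewrite linfun_sum; apply: eq_bigr => i _; rewrite linfunZ. Qed.

End linear_functions.

(** * Mean values and ordinary differential equations *)

Lemma rV_coord_le (R : realType) n (v : 'rV[R]_n) j : `|v 0 j| <= `|v|.
Proof.
rewrite [leRHS]/Num.Def.normr /= mx_normrE.
exact: (le_bigmax _ (fun ij : 'I_1 * 'I_n => `|v ij.1 ij.2|) (0, j)).
Qed.

Lemma rV_norm_le (R : realType) n (v : 'rV[R]_n) e : 0 <= e ->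
  (forall j, `|v 0 j| <= e) -> `|v| <= e.
Proof.
move=> e0 H; rewrite [leLHS]/Num.Def.normr /= mx_normrE bigmax_le // => -[i j] _ /=.
by rewrite (ord1 i).
Qed.

Lemma norm_lincomb_le (R : realType) k (V : normedModType R) (x : 'rV[R]_k)
    (v : 'I_k -> V) C : 0 <= C -> (forall i, `|v i| <= C) ->
  `|\sum_i x 0 i *: v i| <= k%:R * (`|x| * C).
Proof.
move=> C0 H; apply: le_trans (ler_norm_sum _ _ _) _.
apply: le_trans (_ : \sum_(i < k) `|x| * C <= _).
  apply: ler_sum => i _; rewrite normrZ; apply: ler_pM => //.
  exact: rV_coord_le.
by rewrite sumr_const card_ord mulr_natl.
Qed.

Lemma is_derive_line (R : realType) (V W : normedModType R) (g : V -> W)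
    (x v : V) (t : R) : differentiable g (x + t *: v) ->
  is_derive t (1 : R) (fun s : R => g (x + s *: v)) ('D_v g (x + t *: v)).
Proof.
move=> dg.
have dl : is_diff t (fun s : R => x + s *: v) (0 + *:%R^~ v).
  by apply: is_diffD.
have dc := @differentiable_comp _ _ _ _ (fun s : R => x + s *: v) g t
  (@ex_diff _ _ _ _ _ _ _ dl) dg.
apply: DeriveDef; first exact: diff_derivable.
rewrite -[LHS]/('D_1 (g \o (fun s : R => x + s *: v)) t) deriveE //.
rewrite (@diff_comp _ _ _ _ (fun s : R => x + s *: v) g t _ dg); last exact: ex_diff.
by rewrite /= (@diff_val _ _ _ _ _ _ _ dl) fctE /= add0r scale1r -deriveE.
Qed.

Lemma is_derive_coord (R : realType) n (y : R -> 'rV[R]_n) (t : R) d j :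
  is_derive t (1 : R) y d -> is_derive t (1 : R) (fun s => y s 0 j : R^o) (d 0 j).
Proof.
move=> [dy <-]; have /derivable_mxP := dy => /(_ 0 j) H.
by apply: DeriveDef => //; rewrite derive_mx // mxE.
Qed.

Lemma is_derive_rV (R : realType) n (y : R -> 'rV[R]_n) (t : R) (d : 'rV[R]_n) :
  (forall j, is_derive t (1 : R) (fun s => y s 0 j : R^o) (d 0 j)) ->
  is_derive t (1 : R) y d.
Proof.
move=> H; have dy : derivable y t 1.
  by apply/derivable_mxP => i j; rewrite (ord1 i); apply: ex_derive.
apply: DeriveDef => //; rewrite derive_mx //; apply/rowP => j; rewrite mxE.
exact: derive_val.
Qed.

Lemma MVT_ball (R : realType) (f df : R -> R^o) (r a b : R) :
  (forall t, `|t| < r -> is_derive t (1 : R) f (df t)) ->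
  `|a| < r -> `|b| < r -> a <= b ->
  exists2 c, a <= c <= b & f b - f a = df c * (b - a).
Proof.
move=> H ar br ab.
have inr t : t \in `[a, b] -> `|t| < r.
  rewrite in_itv /= => /andP[at_ tb]; rewrite ltr_norml.
  move: ar br; rewrite !ltr_norml => /andP[ra _] /andP[_ rb].
  by rewrite (lt_le_trans ra at_) (le_lt_trans tb rb).
have [||c cab ->] := @MVT_segment R f df a b ab.
- by move=> t tab; apply: H; apply: inr; apply: subset_itv_oo_cc tab.
- apply: derivable_within_continuous => t tab.
  by have [] := H _ (inr _ tab).
by exists c => //; move: cab; rewrite in_itv.
Qed.

(** The norm of a row vector is its largest entry in absolute value, so the mean value theorem
    applied to each entry separately costs no constant. *)
Lemma mean_value_le (R : realType) n (y dy : R -> 'rV[R]_n) (r C a b : R) :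
  (forall t, `|t| < r -> is_derive t (1 : R) y (dy t)) ->
  (forall t, a <= t <= b -> `|dy t| <= C) ->
  `|a| < r -> `|b| < r -> a <= b -> `|y b - y a| <= C * (b - a).
Proof.
move=> H HC ar br ab; have C0 : 0 <= C.
  by apply: le_trans (HC a _) => //; rewrite lexx.
apply: rV_norm_le => [|j]; first by rewrite mulr_ge0 // subr_ge0.
have [|c cab E] := @MVT_ball R (fun t => y t 0 j) (fun t => dy t 0 j) r a b _ ar br ab.
  by move=> t tr; apply: is_derive_coord; apply: H.
rewrite !mxE E normrM (ger0_norm (_ : 0 <= b - a)) ?subr_ge0 //.
apply: ler_wpM2r; first by rewrite subr_ge0.
by apply: le_trans (HC _ cab); apply: rV_coord_le.
Qed.

Lemma mean_value_dist (R : realType) n (y dy : R -> 'rV[R]_n) (r C a b : R) :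
  (forall t, `|t| < r -> is_derive t (1 : R) y (dy t)) ->
  (forall t, `|t| < r -> `|dy t| <= C) ->
  `|a| < r -> `|b| < r -> `|y b - y a| <= C * `|b - a|.
Proof.
move=> H HC.
wlog ab : a b / a <= b => [W ar br|ar br].
  have [ab|/ltW ba] := leP a b; first exact: W.
  by rewrite distrC (distrC b); apply: W.
rewrite (ger0_norm (_ : 0 <= b - a)) ?subr_ge0 //.
apply: (@mean_value_le _ _ y dy r) => // t /andP[at_ tb]; apply: HC.
move: ar br; rewrite !ltr_norml => /andP[ra _] /andP[_ rb].
by rewrite (lt_le_trans ra at_) (le_lt_trans tb rb).
Qed.

Lemma second_difference_dist (R : realType) (a b c d X Y E : R) :
  `|a - b - (c - d) - X| <= E -> `|a - c - (b - d) - Y| <= E ->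
  `|X - Y| <= E + E.
Proof. by rewrite !ler_norml => /andP[? ?] /andP[? ?]; apply/andP; split; lra. Qed.

(** The second difference of f over the parallelogram with sides s u and s v is symmetric in u and
    v. Two applications of the mean value theorem write it as s^2 times a mixed derivative at a
    nearby point, and continuity of the second derivatives lets s tend to 0. *)
Lemma Schwarz_derive (R : realType) n (U : set 'rV[R]_n) (f : 'rV[R]_n -> R^o)
    x (u v : 'rV[R]_n) :
  open U -> U x -> Ck 2 U f ->
  'D_u (fun y => 'D_v f y) x = 'D_v (fun y => 'D_u f y) x.
Proof.
move=> oU Ux [df Hf].
have dDf w y : U y -> differentiable (fun y => 'D_w f y) y.
  by move=> Uy; have [+ _] := Hf w; apply.
have cont w w' : {for x, continuous (fun y => 'D_w' (fun y => 'D_w f y) y)}.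
  by have [_ /(_ w' x Ux)] := Hf w.
have key (a b : 'rV[R]_n) e : 0 < e -> \forall s \near (0 : R)^'+,
   `|f (x + s *: a + s *: b) - f (x + s *: a) - (f (x + s *: b) - f x)
     - 'D_b (fun y => 'D_a f y) x * (s * s)| <= e * (s * s).
  move=> e0; have := (cont a b); move=> /cvgrPdist_le /(_ _ e0) near_e.
  have nU : \forall y \near x, U y by apply: open_nbhs_nbhs.
  have [r /= r0 Hr] := (nbhs_ballP x _).1 (filterI near_e nU).
  (* For s below this bound the whole parallelogram stays in the ball of radius r; the summand 1
     covers the case where both directions vanish. *)
  have r1 : 0 < r / (`|a| + `|b| + 1).
    by rewrite divr_gt0 // ltr_wpDl // addr_ge0.
  near=> s.
  have s0 : 0 < s by near: s; exact: nbhs_right_gt.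
  have sr : s * (`|a| + `|b| + 1) < r.
    rewrite -ltr_pdivlMr; last by rewrite ltr_wpDl // addr_ge0.
    by near: s; exact: nbhs_right_lt.
  have inr c d : `|c| <= s -> `|d| <= s -> ball x r (x + c *: a + d *: b).
    move=> cs ds; rewrite -ball_normE /= -addrA opprD addNKr normrN.
    apply: le_lt_trans (ler_normD _ _) _; rewrite !normrZ.
    apply: le_lt_trans sr; rewrite -addrA mulrDr lerD // ?ler_wpM2r //.
    rewrite mulrDr -[leLHS]addr0 lerD // ?ler_wpM2r // mulr1; exact: ltW.
  have inU c d : `|c| <= s -> `|d| <= s -> U (x + c *: a + d *: b).
    by move=> cs ds; have [] := Hr _ (inr _ _ cs ds).
  have ss t : 0 <= t <= s -> `|t| <= s by case/andP=> t0 ts; rewrite ger0_norm.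
  have s00 : `|0 : R| <= s by rewrite normr0 ltW.
  (* The mean value theorem is applied to the difference in direction b as a function of the
     displacement along a, then to the resulting derivative along a as a function of the
     displacement along b. *)
  pose phi c : R := f (x + c *: a + s *: b) - f (x + c *: a).
  pose dphi c : R := 'D_a f (x + c *: a + s *: b) - 'D_a f (x + c *: a).
  have sle : 0 <= s := ltW s0.
  have dphiP t : 0 <= t <= s -> is_derive t (1 : R) (phi : R -> R^o) (dphi t).
    move=> ts; apply: is_deriveB.
      have -> : (fun c : R => f (x + c *: a + s *: b) : R^o) =
               (fun c : R => f ((x + s *: b) + c *: a)).
        by apply/funext => c; rewrite addrAC.
      rewrite addrAC; apply: is_derive_line; apply: df; rewrite addrAC.
      by apply: inU; [apply: ss|rewrite ger0_norm].
    apply: is_derive_line; apply: df.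
    by have := inU t 0 (ss _ ts) s00; rewrite scale0r addr0.
  have [|| c /andP[c0 cs] E1] := @MVT_segment R phi dphi 0 s sle.
  - move=> t; rewrite in_itv /= => /andP[t0 ts]; apply: dphiP.
    by rewrite !ltW.
  - apply: derivable_within_continuous => t; rewrite in_itv /= => /dphiP.
    by case.
  rewrite !bnd_simp in c0 cs.
  have cS : `|c| <= s by apply: ss; rewrite c0.
  pose psi d : R := 'D_a f (x + c *: a + d *: b).
  pose dpsi d : R := 'D_b (fun y => 'D_a f y) (x + c *: a + d *: b).
  have dpsiP t : 0 <= t <= s -> is_derive t (1 : R) (psi : R -> R^o) (dpsi t).
    move=> ts; apply: (is_derive_line (g := fun y => 'D_a f y)); apply: dDf.
    by apply: inU => //; apply: ss.
  have [|| d /andP[d0 ds] E2] := @MVT_segment R psi dpsi 0 s sle.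
  - move=> t; rewrite in_itv /= => /andP[t0 ts]; apply: dpsiP.
    by rewrite !ltW.
  - apply: derivable_within_continuous => t; rewrite in_itv /= => /dpsiP.
    by case.
  rewrite !bnd_simp in d0 ds.
  have -> : f (x + s *: a + s *: b) - f (x + s *: a) - (f (x + s *: b) - f x) =
      phi s - phi 0 by rewrite /phi scale0r addr0.
  have E3 : dphi c = psi s - psi 0 by rewrite /psi scale0r addr0.
  rewrite E1 E3 E2 !subr0 -mulrA -mulrBl normrM (ger0_norm (_ : 0 <= s * s)) ?mulr_ge0 //.
  rewrite ler_wpM2r ?mulr_ge0 // distrC.
  by have [] := Hr _ (inr _ d cS (ss _ _)); rewrite ?d0.
apply/eqP; rewrite -subr_eq0 -normr_le0; apply/ler_addgt0Pl => e e0.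
have e2 : 0 < e / 2 by rewrite divr_gt0.
have K1 := key v u _ e2; have K2 := key u v _ e2.
have FF : ProperFilter ((0 : R)^'+) by exact: at_right_proper_filter.
have [s [[H1 H2] s0]] := filter_ex (filterI (filterI K1 K2) (nbhs_right_gt 0)).
rewrite addr0 -(ler_pM2r (mulr_gt0 s0 s0)).
rewrite -[in leLHS](gtr0_norm (mulr_gt0 s0 s0)) -normrM mulrBl.
rewrite [x + s *: v + s *: u]addrAC in H1.
apply: le_trans (second_difference_dist H1 H2) _.
by rewrite -mulrDl -splitr.
Unshelve. all: by end_near. Qed.

(** Integrating from -2 instead of 0 lets one integral serve both signs of t; subtracting its value
    at 0 normalizes it. *)
Lemma continuous_primitive (R : realType) (g : R -> R^o) : continuous g ->
  exists P : R -> R^o, P 0 = 0 /\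
    forall t, `|t| < 2 -> is_derive t (1 : R) P (g t).
Proof.
move=> gc.
have gi : lebesgue_measure.-integrable [set` Interval (BLeft (- 2 : R)) (BRight (2 : R))] (EFin \o g).
  apply: continuous_compact_integrable; first exact: segment_compact.
  exact: continuous_subspaceT.
pose F (x : R) : R := \int[lebesgue_measure]_(t in [set` Interval (BLeft (- 2 : R)) (BRight x)]) g t.
exists (fun t => F t - F 0); split; first by rewrite subrr.
move=> t; rewrite ltr_norml => /andP[t1 t2].
have at_ : ((- 2)%:E < t%:E)%E by rewrite lte_fin.
have [dF FE] := @continuous_FTC1 R g (BLeft (- 2)) t 2 t2 gi at_ (gc t).
rewrite -[X in is_derive _ _ _ X]subr0.
apply: is_deriveB.
exact: DeriveDef dF (etrans (esym (derive1E _ _)) FE).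
Qed.

(** With d m = 2K / 2^m bounding the tail from m on, every u m - d m lies below every u p + d p, and
    the supremum of the lower ends is the limit. *)
Lemma geometric_limit (R : realType) (u : nat -> R) (K : R) :
  (forall m, `|u m.+1 - u m| <= K / 2 ^+ m) ->
  exists l, forall m, `|u m - l| <= K * 2 / 2 ^+ m.
Proof.
move=> H.
have K0 : 0 <= K by have := H 0; rewrite expr0 divr1; apply: le_trans.
have dist m p : `|u (m + p)%N - u m| <= K * 2 / 2 ^+ m - K * 2 / 2 ^+ (m + p).
  elim: p => [|p IH]; first by rewrite addn0 !subrr normr0.
  rewrite addnS; have := H (m + p)%N.
  have -> : K * 2 / 2 ^+ (m + p).+1 = K / 2 ^+ (m + p).
    by rewrite exprS invfM mulrA mulfK.
  have E : K * 2 / 2 ^+ (m + p) = K / 2 ^+ (m + p) + K / 2 ^+ (m + p).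
    by rewrite mulrAC mulr_natr mulr2n.
  rewrite E in IH.
  by move: IH; rewrite !ler_norml => /andP[? ?] /andP[? ?]; apply/andP; split; lra.
pose d m := K * 2 / 2 ^+ m.
have d0 m : 0 <= d m by rewrite /d !mulr_ge0 // invr_ge0 exprn_ge0.
have dmp m p : u m - d m <= u p + d p.
  have [mp|/ltnW pm] := leqP m p.
    have := dist m (p - m)%N; rewrite subnKC // -/(d _) -/(d _).
    have := d0 p; have := d0 m; rewrite ler_norml => ? ? /andP[? ?]; lra.
  have := dist p (m - p)%N; rewrite subnKC // -/(d _) -/(d _).
  have := d0 p; have := d0 m; rewrite ler_norml => ? ? /andP[? ?]; lra.
pose S := range (fun m => u m - d m).
have Su p : ubound S (u p + d p) by move=> _ [m _ <-]; exact: dmp.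
have Sne : S !=set0 by exists (u 0 - d 0), 0.
exists (sup S) => m; rewrite -/(d m) ler_norml; apply/andP; split.
  have : sup S <= u m + d m by apply: ge_sup => //; apply: Su.
  lra.
have : u m - d m <= sup S.
  by apply: ub_le_sup; [exists (u 0 + d 0); apply: Su|exists m].
lra.
Qed.

(** Projection to the interval [a - r, a + r]. Applied to times and to each coordinate of a point,
    it extends locally controlled data to the whole space without enlarging bounds or Lipschitz
    constants. *)
Definition clamp (R : realType) (a r t : R) : R :=
  Num.max (a - r) (Num.min (a + r) t).

Lemma clamp_id (R : realType) (a r t : R) : `|t - a| <= r -> clamp a r t = t.
Proof.
rewrite ler_norml => /andP[h1 h2]; rewrite /clamp min_r; last by lra.
by rewrite max_r //; lra.
Qed.

Lemma clamp_dist (R : realType) (a r t : R) : 0 <= r -> `|clamp a r t - a| <= r.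
Proof.
move=> r0; rewrite /clamp ler_norml.
case: (leP (a + r) t) => h; case: (leP (a - r) _) => h'; apply/andP; split; lra.
Qed.

Lemma clamp_lip (R : realType) (a r s t : R) : 0 <= r ->
  `|clamp a r s - clamp a r t| <= `|s - t|.
Proof.
move=> r0; wlog st : s t / s <= t => [W|].
  by have [|/ltW] := leP s t => [/W//|/W]; rewrite distrC (distrC s).
rewrite [leRHS]distrC (ger0_norm (_ : 0 <= t - s)) ?subr_ge0 // /clamp ler_norml.
case: (leP (a + r) s) => h1; case: (leP (a + r) t) => h2;
case: (leP (a - r) (a + r)) => h3; case: (leP (a - r) s) => h4;
by case: (leP (a - r) t) => h5; apply/andP; split; lra.
Qed.

Lemma lipschitz_continuous (R : realType) (V W : normedModType R) (f : V -> W) C :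
  (forall x y, `|f x - f y| <= C * `|x - y|) -> continuous f.
Proof.
move=> H x; apply: (@cvgrPdist_lt _ _ _ (nbhs x) _ f (f x)).2 => e e0.
have C1 : 0 < `|C| + 1 by rewrite ltr_wpDl.
near=> y; apply: le_lt_trans (H x y) _.
apply: le_lt_trans (_ : (`|C| + 1) * `|x - y| < e).
  rewrite ler_wpM2r //; apply: le_trans (ler_norm _) _; lra.
rewrite -ltr_pdivlMl //; near: y; apply: cvgr_dist_lt => //.
by rewrite mulr_gt0 ?invr_gt0.
Unshelve. all: by end_near. Qed.

(** Picard iteration. For |t| < 2 the Lipschitz constant 1/8 makes the integral operator contract by
    1/4, which is weakened to 1/2 to match [geometric_limit]. The interval |t| < 3/2 leaves room
    around time 1, where the flow is evaluated. *)
Lemma ODE_exists (R : realType) n (G : 'rV[R]_n -> 'rV[R]_n) (x0 : 'rV[R]_n) B :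
  (forall y, `|G y| <= B) ->
  (forall y z, `|G y - G z| <= `|y - z| / 8) ->
  exists y : R -> 'rV[R]_n, y 0 = x0 /\
    forall t, `|t| < 3 / 2 -> is_derive t (1 : R) y (G (y t)).
Proof.
move=> GB GL.
(* Iterates are controlled only for |t| < 2, whereas primitives are taken of functions continuous on
   the whole line; clamping time to [-3/2, 3/2] reconciles the two and explains the interval of the
   conclusion. *)
pose kap (t : R) : R := clamp 0 (3 / 2) t.
have h32 : 0 <= (3 / 2 : R) by lra.
have kap_lip s t : `|kap s - kap t| <= `|s - t| by apply: clamp_lip.
have kap2 t : `|kap t| < 2.
  by have := clamp_dist 0 t h32; rewrite subr0 -/(kap t) => /le_lt_trans; apply; lra.
have lipB (y : R -> 'rV[R]_n) : (forall s t, `|s| < 2 -> `|t| < 2 -> `|y s - y t| <= B * `|s - t|) ->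
    continuous (fun t : R => G (y (kap t))).
  move=> yL; apply: (@lipschitz_continuous R R _ _ (B / 8)) => s t.
  apply: le_trans (GL _ _) _; rewrite mulrAC ler_wpM2r //.
  apply: le_trans (yL _ _ (kap2 _) (kap2 _)) _; rewrite ler_wpM2l //.
  by apply: le_trans (GB 0).
(* Stated for every g, with continuity as a premise on the result, so that choice yields a total
   primitive operator [I]. *)
have prim (g : R -> 'rV[R]_n) : exists P : R -> 'rV[R]_n, continuous g ->
    P 0 = x0 /\ forall t, `|t| < 2 -> is_derive t (1 : R) P (g t).
  have [gc|] := pselect (continuous g); last by exists (cst 0).
  have /choice[P HP] : forall j, exists P : R -> R^o, P 0 = 0 /\
      forall t, `|t| < 2 -> is_derive t (1 : R) P (g t 0 j).
    move=> j; apply: (@continuous_primitive R (fun t => g t 0 j)) => t.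
    exact: continuous_comp (gc t) (@coord_continuous _ _ _ 0 j (g t)).
  exists (fun t => \row_j (P j t + x0 0 j)) => _; split.
    by apply/rowP => j; rewrite mxE (HP j).1 add0r.
  move=> t t2; apply: is_derive_rV => j.
  have -> : (fun s => (\row_j0 (P j0 s + x0 0 j0)) 0 j : R^o) = P j + cst (x0 0 j).
    by apply/funext => s; rewrite mxE.
  rewrite -[X in is_derive _ _ _ X]addr0.
  by apply: is_deriveD; apply: (HP j).2.
have [I HI] := choice prim.
pose T (y : R -> 'rV[R]_n) := I (fun t => G (y (kap t))).
pose Y := fix Y m := if m is m'.+1 then T (Y m') else cst x0.
have B0 : 0 <= B by apply: le_trans (GB 0).
have TL y : (forall s t, `|s| < 2 -> `|t| < 2 -> `|y s - y t| <= B * `|s - t|) ->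
    (forall s t, `|s| < 2 -> `|t| < 2 -> `|T y s - T y t| <= B * `|s - t|).
  move=> /lipB/HI[_ dT] s t s2 t2.
  exact: (mean_value_dist dT (fun t _ => GB _)).
have YL m s t : `|s| < 2 -> `|t| < 2 -> `|Y m s - Y m t| <= B * `|s - t|.
  elim: m s t => [|m IH]; last exact: TL.
  by move=> s t _ _; rewrite /= subrr normr0 mulr_ge0.
have n02 : `|0 : R| < 2 by rewrite normr0.
have Tdist y z C :
    (forall s t, `|s| < 2 -> `|t| < 2 -> `|y s - y t| <= B * `|s - t|) ->
    (forall s t, `|s| < 2 -> `|t| < 2 -> `|z s - z t| <= B * `|s - t|) ->
    (forall t, `|t| < 2 -> `|y t - z t| <= C) ->
    forall t, `|t| < 2 -> `|T y t - T z t| <= C / 2.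
  move=> /lipB/HI[T0 dT] /lipB/HI[T0' dT'] yz t t2.
  have C0 : 0 <= C by apply: le_trans (yz 0 n02).
  have d s : `|s| < 2 -> is_derive s (1 : R) (T y - T z) (G (y (kap s)) - G (z (kap s))).
    by move=> s2; apply: is_deriveB; [apply: dT|apply: dT'].
  have := @mean_value_dist R n _ _ 2 (C / 8) 0 t d _ n02 t2.
  rewrite !fctE /T T0 T0' subrr !subr0 => H.
  apply: le_trans (H _) _.
    by move=> s s2; apply: le_trans (GL _ _) _; rewrite ler_wpM2r ?invr_ge0 // yz.
  have : C / 8 * `|t| <= C / 8 * 2 by rewrite ler_wpM2l ?divr_ge0 // ltW.
  lra.
(* The first iteration step moves the constant curve by at most B |t|, hence by less than 2 B. *)
pose K := 2 * B.
have Ystep m t : `|t| < 2 -> `|Y m.+1 t - Y m t| <= K / 2 ^+ m.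
  elim: m t => [|m IH] t t2.
    have [T0 _] := HI _ (lipB _ (YL 0)).
    have := TL _ (YL 0) t 0 t2 n02; rewrite -/(Y 1) /= /T T0 subr0 expr0 divr1.
    move/le_trans; apply; rewrite /K mulrC ler_wpM2r //; exact: ltW.
  rewrite exprSr invfM mulrA.
  exact: (Tdist (Y m.+1) (Y m)) (YL _) (YL _) IH t t2.
have lim_ex t : exists l : 'rV[R]_n, `|t| < 2 ->
    forall m, `|Y m t - l| <= K * 2 / 2 ^+ m.
  have [t2|] := pselect (`|t| < 2); last by exists 0.
  have /choice[l Hl] : forall j, exists l, forall m, `|Y m t 0 j - l| <= K * 2 / 2 ^+ m.
    move=> j; apply: geometric_limit => m.
    by apply: le_trans (Ystep m t t2); apply: le_trans (rV_coord_le _ j); rewrite !mxE.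
  exists (\row_j l j) => _ m; apply: rV_norm_le => [|j]; last by rewrite !mxE.
  by rewrite !mulr_ge0 // invr_ge0 exprn_ge0.
have [y Hy] := choice lim_ex.
have small (C e : R) : 0 <= C -> 0 < e -> exists m, C / 2 ^+ m <= e.
  move=> C0 e0.
  have H0 : `|1 / 2 : R| < 1 by rewrite ger0_norm; lra.
  have := cvg_expr H0; move=> /cvgrPdist_le /(_ (e / (C + 1))) H.
  have /H [m _ /(_ m (leqnn m))] : 0 < e / (C + 1) by rewrite divr_gt0 // ltr_wpDl.
  rewrite /= sub0r normrN expr_div_n expr1n div1r ger0_norm ?invr_ge0 ?exprn_ge0 // => Hm.
  exists m; apply: le_trans (_ : (C + 1) / 2 ^+ m <= _).
    by rewrite ler_wpM2r ?invr_ge0 ?exprn_ge0 //; lra.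
  by rewrite mulrC -ler_pdivlMr // ltr_wpDl.
have le_small (a b C : R) : 0 <= C -> (forall m, a <= b + C / 2 ^+ m) -> a <= b.
  move=> C0 H; apply/ler_addgt0Pr => e e0; have [m Hm] := small C e C0 e0.
  by apply: le_trans (H m) _; rewrite lerD2l.
(* The limit inherits the Lipschitz bound; without it [T y] would not be known to be a primitive. *)
have yL s t : `|s| < 2 -> `|t| < 2 -> `|y s - y t| <= B * `|s - t|.
  move=> s2 t2; apply: (le_small _ _ (K * 4)) => [|m]; first by rewrite !mulr_ge0.
  have -> : y s - y t = (Y m s - Y m t) - (Y m s - y s) + (Y m t - y t).
    by apply/rowP => j; rewrite !mxE; ring.
  apply: le_trans (ler_normD _ _) _; apply: le_trans (lerD (ler_normB _ _) (lexx _)) _.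
  have := YL m s t s2 t2; have := Hy s s2 m; have := Hy t t2 m; clear; lra.
have yE t : `|t| < 2 -> y t = T y t.
  move=> t2; apply/eqP; rewrite -subr_eq0 -normr_le0.
  apply: (le_small _ _ (K * 4)) => [|m]; first by rewrite !mulr_ge0.
  have H1 := Tdist (Y m) y _ (YL m) yL (fun t t2 => Hy t t2 m) t t2.
  have H2 := Hy t t2 m.+1.
  have -> : y t - T y t = (T (Y m) t - T y t) - (Y m.+1 t - y t).
    by apply/rowP => j; rewrite !mxE; ring.
  apply: le_trans (ler_normB _ _) _.
  have K0 : 0 <= K / 2 ^+ m by rewrite divr_ge0 ?exprn_ge0 // mulr_ge0.
  rewrite exprS invfM in H2; clear - H1 H2 K0; lra.
have [T0 dT] := HI _ (lipB _ yL).
exists y; split; first by rewrite yE.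
move=> t t32; have t2 : `|t| < 2 by apply: lt_trans t32 _; lra.
have -> : G (y t) = G (y (kap t)).
  by rewrite /kap clamp_id // subr0 ltW.
apply: near_eq_is_derive (dT t t2).
apply/nbhs_ballP; exists (2 - `|t|) => /=; first by rewrite subr_gt0.
move=> s; rewrite -ball_normE /= => ts; rewrite yE //.
have := lerB_dist s t; rewrite distrC; clear - ts; lra.
Qed.

(** * Flows of commuting vector fields *)

Lemma near_bounded (R : realType) (V : normedModType R) (I : finType)
    (h : I -> V -> R^o) (x0 : V) : (forall i, {for x0, continuous (h i)}) ->
  exists2 C, 0 <= C & \forall y \near x0, forall i, `|h i y| <= C.
Proof.
move=> hc; exists (\sum_i (`|h i x0| + 1)).
  by apply: sumr_ge0 => i _; rewrite addr_ge0.
have xF : Filter (nbhs x0) by exact: nbhs_filter.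
apply: (@filter_forall _ _ (fun i y => `|h i y| <= \sum_i (`|h i x0| + 1)) _ xF) => i.
have := (@cvgrPdist_lt _ _ _ (nbhs x0) xF _ (h i x0)).1 (hc i) 1 ltr01.
apply: filterS => y H; rewrite (bigD1 i) //=.
apply: (@le_trans _ _ (`|h i x0| + 1)); last first.
  by rewrite lerDl sumr_ge0 // => j _; rewrite addr_ge0.
have := lerB_dist (h i y) (h i x0); rewrite distrC; clear - H; lra.
Qed.

Lemma segment_ball (R : realType) n (x0 y z : 'rV[R]_n) r t :
  `|y - x0| <= r -> `|z - x0| <= r -> 0 <= t <= 1 ->
  `|y + t *: (z - y) - x0| <= r.
Proof.
move=> yr zr /andP[t0 t1].
have -> : y + t *: (z - y) - x0 = (1 - t) *: (y - x0) + t *: (z - x0).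
  by apply/rowP => j; rewrite !mxE; ring.
apply: le_trans (ler_normD _ _) _; rewrite !normrZ.
rewrite (ger0_norm t0) ger0_norm ?subr_ge0 //.
apply: (@le_trans _ _ ((1 - t) * r + t * r)); last by clear; lra.
by apply: lerD; apply: ler_wpM2l; rewrite ?subr_ge0.
Qed.

Lemma MVT_rV (R : realType) n (g : 'rV[R]_n -> R^o) (x0 y z : 'rV[R]_n) r :
  (forall w, `|w - x0| <= r -> differentiable g w) ->
  `|y - x0| <= r -> `|z - x0| <= r ->
  exists w, [/\ `|w - x0| <= r, `|w - y| <= `|z - y| & g z - g y = 'D_(z - y) g w].
Proof.
move=> dg yr zr.
pose phi (t : R) : R^o := g (y + t *: (z - y)).
pose dphi (t : R) : R^o := 'D_(z - y) g (y + t *: (z - y)).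
have dP (t : R) : 0 <= t <= 1 -> is_derive t (1 : R) phi (dphi t).
  by move=> t01; apply: is_derive_line; apply: dg; apply: segment_ball.
have [||c c01 E] := @MVT_segment R phi dphi 0 1 ler01.
- move=> t; rewrite in_itv /= => /andP[t0 t1]; apply: dP.
  by rewrite !ltW.
- apply: derivable_within_continuous => t; rewrite in_itv /= => /dP.
  by case.
rewrite in_itv /= in c01; exists (y + c *: (z - y)); split.
- exact: segment_ball.
- have /andP[c0 c1] := c01; rewrite addrAC subrr add0r normrZ ger0_norm //.
  by rewrite -[leRHS]mul1r; apply: ler_wpM2r.
move: E; rewrite /phi /dphi scale0r addr0 scale1r subr0 mulr1.
by rewrite (addrC y) subrK.
Qed.

Lemma derive_le (R : realType) n (g : 'rV[R]_n -> R^o) w v C :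
  differentiable g w -> 0 <= C -> (forall a, `|'D_(delta_mx 0 a) g w| <= C) ->
  `|'D_v g w| <= n%:R * (`|v| * C).
Proof.
by move=> dg C0 H; rewrite derive_sum_coord //; apply: norm_lincomb_le.
Qed.

(** The mean value theorem bounds increments by first derivatives; applied once more to the first
    partial derivatives, it bounds the error of the linear approximation by the square of the
    increment. *)
Lemma Ck2_bounds (R : realType) n p k (W : set 'rV[R]_n)
    (b : 'I_k -> 'rV[R]_n -> 'rV[R]_p) x0 : open W -> W x0 ->
  (forall i, Ck 2 W (b i)) ->
  exists r C, [/\ 0 < r, 0 <= C, forall y, `|y - x0| <= r -> W y &
    forall i y, `|y - x0| <= r ->
    [/\ W y, `|b i y| <= C, forall v, `|'D_v (b i) y| <= C * `|v| &
      forall z, `|z - x0| <= r -> `|b i z - b i y| <= C * `|z - y| /\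
        `|b i z - b i y - 'D_(z - y) (b i) y| <= C * `|z - y| ^+ 2]].
Proof.
move=> oW Wx0 Hb.
have Hc i j : Ck 2 W (fun x => b i x 0 j : R^o) by have /(Ck_coord _ _ oW) := Hb i.
pose g (ij : 'I_k * 'I_p) (x : 'rV[R]_n) : R^o := b ij.1 x 0 ij.2.
pose dg (a : ('I_k * 'I_p) * 'I_n) (x : 'rV[R]_n) : R^o := 'D_(delta_mx 0 a.2) (g a.1) x.
pose ddg (a : (('I_k * 'I_p) * 'I_n) * 'I_n) (x : 'rV[R]_n) : R^o :=
  'D_(delta_mx 0 a.2) (dg a.1) x.
have g2 ij : Ck 2 W (g ij) by apply: Hc.
have dg1 a : Ck 1 W (dg a) by have [_] := CkS (g2 a.1); apply.
have ddg0 a : Ck 0 W (ddg a) by have [_] := CkS (dg1 a.1); apply.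
have [C0 C00 N0] := @near_bounded _ _ _ g x0 (fun ij => Ck_pred (Ck_pred (g2 ij)) x0 Wx0).
have [C1 C10 N1] := @near_bounded _ _ _ dg x0 (fun a => Ck_pred (dg1 a) x0 Wx0).
have [C2 C20 N2] := @near_bounded _ _ _ ddg x0 (fun a => ddg0 a x0 Wx0).
have NW : \forall y \near x0, W y by apply: open_nbhs_nbhs.
have [r /= r0 Hr] := (nbhs_ballP x0 _).1 (filterI (filterI N0 N1) (filterI N2 NW)).
have r2 : r / 2 < r by clear - r0; lra.
have inr y : `|y - x0| <= r / 2 ->
   [/\ W y, forall ij, `|g ij y| <= C0, forall a, `|dg a y| <= C1 & forall a, `|ddg a y| <= C2].
  move=> yr; have /Hr [[h1 h2] [h3 h4]] : ball x0 r y.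
    by rewrite -ball_normE /= distrC; apply: le_lt_trans yr r2.
  by split.
(* One constant for all the estimates: the summands control the values, the first derivatives
   together with the Lipschitz bound, and the quadratic remainder. *)
pose C := C0 + n%:R * C1 + n%:R * (n%:R * C2).
have nC1 : 0 <= n%:R * C1 by rewrite mulr_ge0.
have nC2 : 0 <= n%:R * (n%:R * C2) by rewrite !mulr_ge0.
exists (r / 2), C; split; [by rewrite divr_gt0|by rewrite !addr_ge0|by move=> y /inr[]|].
have C0C : C0 <= C by rewrite /C -addrA lerDl addr_ge0.
have C1C : n%:R * C1 <= C by rewrite /C addrAC lerDr addr_ge0.
have C2C : n%:R * (n%:R * C2) <= C by rewrite /C lerDr addr_ge0.
have CC : 0 <= C := le_trans C00 C0C.
have dfg ij y : `|y - x0| <= r / 2 -> differentiable (g ij) y.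
  by move=> /inr[Wy _ _ _]; have [+ _] := CkS (g2 ij); apply.
have dfdg a y : `|y - x0| <= r / 2 -> differentiable (dg a) y.
  by move=> /inr[Wy _ _ _]; have [+ _] := CkS (dg1 a); apply.
have dfb i y : `|y - x0| <= r / 2 -> differentiable (b i) y.
  by move=> yr; apply/differentiable_rV => j; exact: (dfg (i, j)).
have Dg ij y v : `|y - x0| <= r / 2 -> `|'D_v (g ij) y| <= n%:R * (`|v| * C1).
  move=> yr; apply: derive_le => //; first exact: dfg.
  by move=> a; have [_ _ /(_ (ij, a))] := inr y yr.
have Ddg a y v : `|y - x0| <= r / 2 -> `|'D_v (dg a) y| <= n%:R * (`|v| * C2).
  move=> yr; apply: derive_le => //; first exact: dfdg.
  by move=> c; have [_ _ _ /(_ (a, c))] := inr y yr.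
move=> i y yr; have [Wy yC0 _ _] := inr y yr; split=> // [|v|z zr].
- by apply: rV_norm_le => // j; apply: le_trans C0C; exact: (yC0 (i, j)).
- apply: rV_norm_le => [|j]; first by rewrite mulr_ge0.
  rewrite coord_derive; last exact: dfb.
  apply: le_trans (Dg (i, j) y v yr) _.
  by rewrite mulrCA mulrC; apply: ler_wpM2r.
- split; apply: rV_norm_le => [|j]; rewrite ?mulr_ge0 ?exprn_ge0 //.
    have [w [wr wy E]] := MVT_rV (dfg (i, j)) yr zr.
    rewrite !mxE -[X in `|X|]/(g (i, j) z - g (i, j) y) E.
    apply: le_trans (Dg (i, j) w _ wr) _.
    by rewrite mulrCA mulrC; apply: ler_wpM2r.
  (* The remainder becomes the sum over a of (z - y)_a times the increment of the a-th partial
     derivative between y and w, where |w - y| is at most |z - y|. *)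
  have [w [wr wy E]] := MVT_rV (dfg (i, j)) yr zr.
  rewrite mxE [X in _ + X]mxE coord_derive; last exact: dfb.
  rewrite !mxE -[X in `|X|]/(g (i, j) z - g (i, j) y - 'D_(z - y) (g (i, j)) y) E.
  rewrite !derive_sum_coord; [|exact: dfg..].
  rewrite -sumrB.
  have -> : \sum_(a < n) ((z - y) 0 a *: 'D_(delta_mx 0 a) (g (i, j)) w -
       (z - y) 0 a *: 'D_(delta_mx 0 a) (g (i, j)) y) =
     \sum_(a < n) ((z - y) 0 a *: (dg ((i, j), a) w - dg ((i, j), a) y : R^o)).
    by apply: eq_bigr => a _; rewrite scalerBr.
  apply: le_trans (@norm_lincomb_le _ _ _ _ _ (n%:R * (`|z - y| * C2)) _ _) _.
  - by rewrite !mulr_ge0.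
  - move=> a; have [u [ur _ ->]] := MVT_rV (dfdg ((i, j), a)) yr wr.
    apply: le_trans (Ddg _ u _ ur) _; apply: ler_wpM2l => //.
    exact: ler_wpM2r.
  - rewrite expr2.
    have -> : n%:R * (`|z - y| * (n%:R * (`|z - y| * C2))) =
      n%:R * (n%:R * C2) * (`|z - y| * `|z - y|) by ring.
    by apply: ler_wpM2r => //; rewrite mulr_ge0.
Qed.

(** On a unit interval no exponential is required: where |w| is maximal on [0, 1] the mean value
    inequality gives |w| <= |w| / 4 + d, hence |w| <= 4 d / 3. *)
Lemma gronwall_unit (R : realType) n (w dw : R -> 'rV[R]_n) (d : R) :
  (forall t : R, `|t| < 3 / 2 -> is_derive t (1 : R) w (dw t)) -> w 0 = 0 ->
  (forall t : R, 0 <= t <= 1 -> `|dw t| <= `|w t| / 4 + d) ->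
  forall t : R, 0 <= t <= 1 -> `|w t| <= 2 * d.
Proof.
move=> dwP w0 H.
have small (t : R) : 0 <= t <= 1 -> `|t| < 3 / 2.
  by move=> /andP[t0 t1]; rewrite ger0_norm //; clear - t1; lra.
have wc : {within `[0, 1], continuous w}.
  apply: derivable_within_continuous => t; rewrite in_itv /= => /small t2.
  by have [] := dwP t t2.
have nwc : {within `[0, 1], continuous (fun t => `|w t| : R)}.
  by move=> t; apply: continuous_comp; [apply: wc|apply: norm_continuous].
have [c c01 Hc] := EVT_max ler01 nwc.
rewrite in_itv /= in c01; have /andP[c0 c1] := c01.
have n0 : `|0 : R| < 3 / 2 by rewrite normr0; clear; lra.
have := @mean_value_le _ _ w dw (3 / 2) (`|w c| / 4 + d) 0 c dwP _ n0 (small _ c01) c0.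
rewrite w0 !subr0 => Hw.
have {}Hw : `|w c| <= (`|w c| / 4 + d) * c.
  apply: Hw => t /andP[t0 tc].
  have t01 : 0 <= t <= 1 by rewrite t0 (le_trans tc).
  apply: le_trans (H t t01) _; rewrite lerD2r ler_wpM2r ?invr_ge0 //.
  by apply: Hc; rewrite in_itv.
have p0 : 0 <= `|w c| / 4 + d by apply: le_trans (H c c01).
have le1 : `|w c| <= `|w c| / 4 + d.
  by apply: le_trans Hw _; rewrite -[leRHS]mulr1 ler_wpM2l.
move=> t t01; have : `|w t| <= `|w c| by apply: Hc; rewrite in_itv.
have := normr_ge0 (w c); clear - le1; lra.
Qed.

Lemma is_derive_scale_id (R : realType) n (z : R -> 'rV[R]_n) (t : R) dz :
  is_derive t (1 : R) z dz ->
  is_derive t (1 : R) (fun s => s *: z s) (z t + t *: dz).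
Proof.
move=> H; apply: is_derive_rV => j.
have Hj := is_derive_coord j H.
have -> : (fun s => (s *: z s) 0 j : R^o) = (id : R -> R) * (fun s => z s 0 j).
  by apply/funext => s; rewrite mxE.
rewrite !mxE addrC.
have := @is_deriveM R _ id (fun s => z s 0 j) t 1 1 _ (is_derive_id _ _) Hj.
by move/is_derive_eq; apply; rewrite /GRing.scale /= mulr1.
Qed.

Lemma is_derive_comp1 (R : realType) (V W : normedModType R) (f : V -> W)
    (y : R -> V) (t : R) dy : is_derive t (1 : R) y dy ->
  differentiable f (y t) -> is_derive t (1 : R) (f \o y) ('D_dy f (y t)).
Proof.
move=> [/derivable1_diffP dyt <-] df; apply: DeriveDef.
  by apply/derivable1_diffP; apply: differentiable_comp.
exact: derive_comp.
Qed.

(** B and B' stand for the values of the fields at two points, P for their derivatives along the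
    field with coefficients h, and W for those along the defect; the first sum on the right then
    collects the Taylor remainders. *)
Lemma flow_defect_expand (R : realType) k n (x h : 'rV[R]_k) (t : R)
    (B B' P W : 'I_k -> 'rV[R]_n) :
  \sum_i (x + h) 0 i *: B' i - \sum_i x 0 i *: B i -
    (\sum_i h 0 i *: B i + t *: \sum_i x 0 i *: P i) =
  \sum_i x 0 i *: (B' i - B i - (t *: P i + W i)) + \sum_i x 0 i *: W i +
    \sum_i h 0 i *: (B' i - B i).
Proof.
rewrite scaler_sumr -!big_split -!sumrN -!big_split /=.
apply: eq_bigr => i _; apply/rowP => j; rewrite !mxE.
ring.
Qed.

(** Used with D i l the derivative of b_i along b_l, whose symmetry is the commutation of the
    fields: the derivative of one combination along another may be taken the other way round. *)
Lemma exchange_scale_sum (R : realType) k (V : lmodType R) (a b : 'rV[R]_k)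
    (D : 'I_k -> 'I_k -> V) : (forall i l, D l i = D i l) ->
  \sum_i a 0 i *: (\sum_l b 0 l *: D l i) = \sum_l b 0 l *: (\sum_i a 0 i *: D i l).
Proof.
move=> sym; under eq_bigr do rewrite scaler_sumr.
rewrite exchange_big /=; apply: eq_bigr => l _; rewrite scaler_sumr.
by apply: eq_bigr => i _; rewrite !scalerA mulrC sym.
Qed.

(** With c = k C, the three terms are at most (c h)^2 / 2, w / 8 and 2 (c h)^2, so the constants 3
    and 1/4 leave some slack. *)
Lemma flow_defect_arith (R : realType) (k C x h w d s1 s2 s3 : R) :
  0 <= k -> 0 <= C -> 0 <= x -> 0 <= h -> 0 <= w -> 0 <= d ->
  x * (k * C) <= 1 / 8 -> d <= 2 * (k * C) * h ->
  s1 <= k * (x * (C * d ^+ 2)) -> s2 <= k * (x * (C * w)) ->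
  s3 <= k * (h * (C * d)) ->
  s1 + s2 + s3 <= w / 4 + 3 * (k * C) ^+ 2 * h ^+ 2.
Proof.
move=> k0 C0 x0 h0 w0 d0; set c := k * C => x8 dle H1 H2 H3.
have c0 : 0 <= c := mulr_ge0 k0 C0.
have e0 : 0 <= 2 * c * h := le_trans d0 dle.
have d2 : d ^+ 2 <= (2 * c * h) ^+ 2 by rewrite !expr2; exact: ler_pM.
have E1 : k * (x * (C * d ^+ 2)) = x * c * d ^+ 2 by rewrite /c; ring.
have E2 : k * (x * (C * w)) = x * c * w by rewrite /c; ring.
have E3 : k * (h * (C * d)) = h * c * d by rewrite /c; ring.
rewrite E1 in H1; rewrite E2 in H2; rewrite E3 in H3.
have B1 := ler_wpM2r (sqr_ge0 d) x8.
have B2 := ler_wpM2r w0 x8.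
have B3 := ler_wpM2l (mulr_ge0 h0 c0) dle.
have q0 := sqr_ge0 (c * h).
have F1 : (2 * c * h) ^+ 2 = 4 * (c * h) ^+ 2 by ring.
have F2 : h * c * (2 * c * h) = 2 * (c * h) ^+ 2 by ring.
have F3 : 3 * c ^+ 2 * h ^+ 2 = 3 * (c * h) ^+ 2 by ring.
rewrite F1 in d2; rewrite F2 in B3; rewrite F3.
move: H1 H2 H3 B1 B2 B3 q0 d2 w0.
move: ((c * h) ^+ 2) (d ^+ 2) (x * c * _) (x * c * _) (h * c * d) => q D P1 P2 P3.
clear; lra.
Qed.

(** Bounds the time derivative of the defect w. Commutation turns the derivative of sum_i h_i b_i
    along sum_j x_j b_j into that of sum_j x_j b_j along sum_i h_i b_i, which is the linear part of
    the increment of the latter field. First-order terms cancel, and what remains has the shape that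
    [gronwall_unit] accepts. *)
Lemma flow_defect_le (R : realType) k n (b : 'I_k -> 'rV[R]_n -> 'rV[R]_n)
    (x h : 'rV[R]_k) (y y' w : 'rV[R]_n) (C t : R) :
  0 <= C -> `|x| * (k%:R * C) <= 1 / 8 ->
  (forall l, differentiable (b l) y) ->
  (forall i l, 'D_(b l y) (b i) y = 'D_(b i y) (b l) y) ->
  (forall l v, `|'D_v (b l) y| <= C * `|v|) ->
  (forall l, `|b l y' - b l y| <= C * `|y' - y| /\
    `|b l y' - b l y - 'D_(y' - y) (b l) y| <= C * `|y' - y| ^+ 2) ->
  `|y' - y| <= 2 * (k%:R * C) * `|h| ->
  y' - y = t *: (\sum_i h 0 i *: b i y) + w ->
  `|\sum_i (x + h) 0 i *: b i y' - \sum_i x 0 i *: b i y -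
    (\sum_i h 0 i *: b i y +
     t *: \sum_i h 0 i *: 'D_(\sum_j x 0 j *: b j y) (b i) y)| <=
  `|w| / 4 + 3 * (k%:R * C) ^+ 2 * `|h| ^+ 2.
Proof.
move=> C0 x8 df comm DC Taylor dle yy'.
have Dlin (a : 'rV[R]_k) i :
    'D_(\sum_j a 0 j *: b j y) (b i) y = \sum_l a 0 l *: 'D_(b l y) (b i) y.
  by rewrite (linfun_lincomb (fun a u v => derive_linear a u v (df i))).
have swap : \sum_i h 0 i *: 'D_(\sum_j x 0 j *: b j y) (b i) y =
    \sum_l x 0 l *: 'D_(\sum_j h 0 j *: b j y) (b l) y.
  have := exchange_scale_sum h x comm.
  by under [in LHS]eq_bigr do rewrite -Dlin; under [in RHS]eq_bigr do rewrite -Dlin.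
have Dyy' l : 'D_(y' - y) (b l) y =
    t *: 'D_(\sum_j h 0 j *: b j y) (b l) y + 'D_w (b l) y.
  by rewrite yy'; apply: derive_linear.
rewrite swap (flow_defect_expand x h t (b ^~ y) (b ^~ y')
  (fun l => 'D_(\sum_j h 0 j *: b j y) (b l) y) (fun l => 'D_w (b l) y)) /=.
have A1 := norm_lincomb_le x (mulr_ge0 C0 (sqr_ge0 `|y' - y|)) (fun l => (Taylor l).2).
have A2 := norm_lincomb_le x (mulr_ge0 C0 (normr_ge0 w)) (fun l => DC l w).
have A3 := norm_lincomb_le h (mulr_ge0 C0 (normr_ge0 (y' - y))) (fun l => (Taylor l).1).
under [X in `|X + _ + _|]eq_bigr do rewrite -Dyy'.
apply: le_trans (ler_normD _ _) _; apply: le_trans (lerD (ler_normD _ _) (lexx _)) _.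
exact: (flow_defect_arith (ler0n R k) C0 (normr_ge0 x) (normr_ge0 h) (normr_ge0 w)
  (normr_ge0 (y' - y)) x8 dle A1 A2 A3).
Qed.

(* u x is the value at time 1 of the flow of sum_i x_i b_i; commutation makes
   Y (x + h) t - Y x t - t sum_i h_i b_i a second-order quantity in h, by
   Gronwall's lemma. *)
Lemma commuting_fields_flow (R : realType) n k (W : set 'rV[R]_n)
    (b : 'I_k -> 'rV[R]_n -> 'rV[R]_n) x0 : open W -> W x0 ->
  (forall i, Ck 2 W (b i)) ->
  (forall i j y, W y -> 'D_(b i y) (b j) y = 'D_(b j y) (b i) y) ->
  exists (e : R) (u : 'rV[R]_k -> 'rV[R]_n), [/\ 0 < e, u 0 = x0 &
    forall x, `|x| < e -> [/\ W (u x), differentiable u x &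
      forall h, 'D_h u x = \sum_i h 0 i *: b i (u x)]].
Proof.
move=> oW Wx0 Hb comm.
have [r [C [r0 C0 HW HC]]] := Ck2_bounds oW Wx0 Hb.
pose c := k%:R * C; have c0 : 0 <= c by rewrite mulr_ge0.
have c1 : 0 < c + 1 by rewrite ltr_wpDl.
(* The bound 1/8 on |x| c is the Lipschitz constant of [ODE_exists]; the bound r / 2 keeps the curve
   within r of x0 up to time 3/2. The denominator c + 1 is positive even when c is 0. *)
pose e := Num.min (1 / 8) (r / 2) / (c + 1).
have e0 : 0 < e by rewrite divr_gt0 // lt_min !divr_gt0.
have ec : e * c <= Num.min (1 / 8) (r / 2).
  rewrite /e mulrAC ler_pdivrMr // ler_wpM2l ?lerDl //.
  by rewrite le_min !divr_ge0 // ltW.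
have xc (x : 'rV[R]_k) : `|x| < e -> `|x| * c <= 1 / 8 /\ `|x| * c <= r / 2.
  move=> xe; have : `|x| * c <= Num.min (1 / 8) (r / 2).
    by apply: le_trans ec; rewrite ler_wpM2r // ltW.
  by rewrite le_min => /andP.
(* Projection to the cube of radius r about x0. It makes the fields bounded and Lipschitz
   everywhere; the solutions turn out to stay in the cube, where it is the identity. *)
pose Pi (y : 'rV[R]_n) : 'rV[R]_n := \row_j clamp (x0 0 j) r (y 0 j).
have rge0 : 0 <= r := ltW r0.
have Pir y : `|Pi y - x0| <= r.
  by apply: rV_norm_le => // j; rewrite !mxE; apply: clamp_dist.
have PiL y z : `|Pi y - Pi z| <= `|y - z|.
  apply: rV_norm_le => // j; rewrite !mxE; apply: le_trans (clamp_lip _ _ _ rge0) _.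
  by apply: le_trans (rV_coord_le _ j); rewrite !mxE.
have Piid y : `|y - x0| <= r -> Pi y = y.
  move=> yr; apply/rowP => j; rewrite !mxE clamp_id //.
  by apply: le_trans yr; apply: le_trans (rV_coord_le _ j); rewrite !mxE.
pose Phi (x : 'rV[R]_k) (y : 'rV[R]_n) : 'rV[R]_n := \sum_i x 0 i *: b i y.
have PhiB x y : `|y - x0| <= r -> `|Phi x y| <= `|x| * c.
  move=> yr; rewrite mulrCA; apply: norm_lincomb_le => // i.
  by have [] := HC i y yr.
have PhiL x y z : `|y - x0| <= r -> `|z - x0| <= r ->
    `|Phi x z - Phi x y| <= `|x| * c * `|z - y|.
  move=> yr zr; rewrite /Phi -sumrB.
  under eq_bigr do rewrite -scalerBr.
  have -> : `|x| * c * `|z - y| = k%:R * (`|x| * (C * `|z - y|)) by rewrite /c; ring.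
  apply: norm_lincomb_le => [|i]; first by rewrite mulr_ge0.
  by have [_ _ _ /(_ z zr) []] := HC i y yr.
have /choice[Y HY] : forall x : 'rV[R]_k, exists y : R -> 'rV[R]_n, `|x| < e ->
    y 0 = x0 /\ forall t : R, `|t| < 3 / 2 -> is_derive t (1 : R) y (Phi x (Pi (y t))).
  move=> x; have [xe|] := pselect (`|x| < e); last by exists (cst 0).
  have [x8 _] := xc x xe.
  have GL y z : `|Phi x (Pi y) - Phi x (Pi z)| <= `|y - z| / 8.
    apply: le_trans (PhiL _ _ _ (Pir _) (Pir _)) _.
    rewrite mulrC; apply: ler_pM => //; first by rewrite mulr_ge0.
    by rewrite -div1r.
  have [y [y0 Hy]] := @ODE_exists R n (fun y => Phi x (Pi y)) x0 (`|x| * c)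
    (fun y => PhiB x _ (Pir y)) GL.
  by exists y.
have n0 : `|0 : R| < 3 / 2 by rewrite normr0; clear; lra.
have Yr x t : `|x| < e -> `|t| < 3 / 2 -> `|Y x t - x0| <= r.
  move=> xe t32; have [Y0 dY] := HY x xe; have [_ xr] := xc x xe.
  have := @mean_value_dist _ _ _ _ (3 / 2) (`|x| * c) 0 t dY (fun s _ => PhiB x _ (Pir _)) n0 t32.
  rewrite Y0 subr0 => /le_trans; apply.
  have : `|x| * c * `|t| <= r / 2 * (3 / 2).
    by apply: ler_pM => //; [rewrite mulr_ge0|rewrite ltW].
  clear - r0; lra.
have dY x t : `|x| < e -> `|t| < 3 / 2 -> is_derive t (1 : R) (Y x) (Phi x (Y x t)).
  by move=> xe t32; have [_ /(_ t t32)] := HY x xe; rewrite Piid //; apply: Yr.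
have Y0 x : `|x| < e -> Y x 0 = x0 by move=> /HY[].
have small (t : R) : 0 <= t <= 1 -> `|t| < 3 / 2.
  by move=> /andP[t0 t1]; rewrite ger0_norm //; clear - t1; lra.
have i11 : 0 <= (1 : R) <= 1 by rewrite ler01 lexx.
(* First-order dependence on the parameter: the difference of the two velocities splits into a
   change of point, absorbed by Gronwall's lemma, and a change of parameter, which is linear in
   h. *)
have dist x h : `|x| < e -> `|x + h| < e ->
    forall t : R, 0 <= t <= 1 -> `|Y (x + h) t - Y x t| <= 2 * (c * `|h|).
  move=> xe xhe.
  apply: (@gronwall_unit _ _ (fun t => Y (x + h) t - Y x t)
    (fun t => Phi (x + h) (Y (x + h) t) - Phi x (Y x t))).
  - by move=> t t32; apply: is_deriveB; apply: dY.
  - by rewrite !Y0 // subrr.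
  move=> t /small t32.
  have -> : Phi (x + h) (Y (x + h) t) - Phi x (Y x t) =
     (Phi (x + h) (Y (x + h) t) - Phi (x + h) (Y x t)) + Phi h (Y x t).
    rewrite -addrA; congr (_ + _); apply/eqP; rewrite eq_sym addrC subr_eq.
    rewrite addrC -subr_eq opprK eq_sym /Phi -big_split /=; apply/eqP.
    by apply: eq_bigr => i _; rewrite mxE scalerDl addrC.
  apply: le_trans (ler_normD _ _) _; apply: lerD; last first.
    by rewrite mulrC; apply: PhiB; apply: Yr.
  apply: le_trans (PhiL _ _ _ (Yr _ _ xe t32) (Yr _ _ xhe t32)) _.
  rewrite mulrC; apply: ler_wpM2l => //.
  by have [] := xc _ xhe; clear; lra.
have key x h : `|x| < e -> `|x + h| < e ->
    `|Y (x + h) 1 - Y x 1 - Phi h (Y x 1)| <= 6 * c ^+ 2 * `|h| ^+ 2.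
  move=> xe xhe; have d_le := dist x h xe xhe.
  have dfb i y : `|y - x0| <= r -> differentiable (b i) y.
    by move=> yr; have [+ _] := CkS (Hb i); apply; apply: HW.
  pose w (t : R) := Y (x + h) t - Y x t - t *: Phi h (Y x t).
  pose dw (t : R) := Phi (x + h) (Y (x + h) t) - Phi x (Y x t) -
    (Phi h (Y x t) + t *: \sum_i h 0 i *: 'D_(Phi x (Y x t)) (b i) (Y x t)).
  have dwP (t : R) : `|t| < 3 / 2 -> is_derive t (1 : R) w (dw t).
    move=> t32; apply: is_deriveB; first by apply: is_deriveB; apply: dY.
    apply: is_derive_scale_id.
    have -> : (fun s => Phi h (Y x s)) = \sum_i (h 0 i *: (b i \o Y x)).
      by apply/funext => s; rewrite /Phi fct_sumE.
    apply: is_derive_sum => i; apply: is_deriveZ; apply: is_derive_comp1.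
      exact: dY.
    by apply: dfb; apply: Yr.
  have w0 : w 0 = 0 by rewrite /w !Y0 // subrr scale0r subrr.
  (* Gronwall's lemma doubles the forcing term, which is where the constant 6 comes from. *)
  have := @gronwall_unit _ _ w dw (3 * c ^+ 2 * `|h| ^+ 2) dwP w0 _ 1 i11.
  rewrite /w scale1r => H; apply: le_trans (H _) _; last by clear; lra.
  move=> t t01; have t32 := small _ t01.
  change (`|dw t| <= `|w t| / 4 + 3 * c ^+ 2 * `|h| ^+ 2).
  have yr : `|Y x t - x0| <= r by apply: Yr.
  have yr' : `|Y (x + h) t - x0| <= r by apply: Yr.
  have [x8 _] := xc x xe.
  apply: (@flow_defect_le _ _ _ b _ _ _ _ _ C) => //.
  - by move=> l; apply: dfb.
  - by move=> i l; apply: comm; apply: HW.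
  - by move=> l v; have [_ _ /(_ v)] := HC l _ yr.
  - by move=> l; have [_ _ _ /(_ _ yr')] := HC l _ yr.
  - by rewrite -mulrA; apply: d_le.
  - by rewrite /w subrKC.
exists e, (fun x => Y x 1); split=> //.
  have z0 : `|0 : 'rV[R]_k| < e by rewrite normr0.
  have := @mean_value_dist _ _ _ _ (3 / 2) 0 0 1 (fun t => dY 0 t z0) _ n0 (small 1 i11).
  rewrite Y0 // mul0r => H; apply/eqP; rewrite -subr_eq0 -normr_le0; apply: H => t t32.
  by have := PhiB 0 _ (Yr _ _ z0 t32); rewrite normr0 mul0r.
move=> x xe.
have yr : `|Y x 1 - x0| <= r by apply: Yr => //; apply: small.
pose L (h : 'rV[R]_k) := Phi h (Y x 1).
have Llin : linear L.
  move=> a p q; rewrite /L /Phi scaler_sumr -big_split /=; apply: eq_bigr => i _.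
  by rewrite !mxE scalerDl scalerA.
pose LM := GRing.isLinear.Build _ _ _ _ L Llin.
pose LL : {linear 'rV[R]_k -> 'rV[R]_n} := HB.pack L LM.
have Lc : continuous LL.
  apply: (@lipschitz_continuous _ _ _ _ c) => p q.
  by rewrite -linearB mulrC; apply: PhiB.
have [|df dE] := @differentiable_eps _ _ _ (fun x => Y x 1) x LL Lc.
  (* The summand 1 keeps the denominator positive when c is 0. *)
  move=> d d0; pose c6 := 6 * c ^+ 2 + 1.
  have c60 : 0 < c6 by rewrite /c6 ltr_wpDl // mulr_ge0 // sqr_ge0.
  apply/nbhs_ballP; exists (Num.min (e - `|x|) (d / c6)) => /=.
    by rewrite lt_min subr_gt0 xe divr_gt0.
  move=> h; rewrite -ball_normE /= sub0r normrN lt_min => /andP[h1 h2].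
  rewrite (addrC h); apply: le_trans (key x h xe _) _.
    by apply: le_lt_trans (ler_normD _ _) _; rewrite addrC -ltrBrDr.
  rewrite [`|h| ^+ 2]expr2 mulrA; apply: ler_wpM2r => //.
  rewrite ltr_pdivlMr // in h2; apply: le_trans (ltW h2).
  by rewrite mulrC; apply: ler_wpM2l => //; rewrite /c6 lerDl.
split=> //; first exact: HW.
by move=> h; rewrite deriveE // dE.
Qed.

(** * Charts, smooth functions and smooth sections *)

Section charts.
Context (R : realType) (n : nat) (M : manifold R n).
Implicit Types (c : chart R M n) (U W : set M) (p q : M).

Lemma chart_image_open c U : open U -> open (chart_image c U).
Proof.
move=> oU; rewrite openE => x [cx Ux].
apply: filterI; first by apply: open_nbhs_nbhs; split=> //; exact: chart_cod_open.
apply: (chart_inv_cts cx); exact: open_nbhs_nbhs.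
Qed.

Lemma chart_image_fun c U p : chart_dom c p -> U p -> chart_image c U (c p).
Proof. by move=> cp Up; split; [exact: chart_funS|rewrite /= chart_funK]. Qed.

Lemma chart_imageS c U W : U `<=` W -> chart_image c U `<=` chart_image c W.
Proof. by move=> UW x [cx Ux]; split=> //; apply: UW. Qed.

Lemma transition_Ck c c' k : atlas c -> atlas c' ->
  Ck k (chart_image c (chart_dom c')) (c' \o chart_inv c).
Proof. by move=> ac ac'; apply: atlas_compatible. Qed.

Lemma transition_differentiable c c' p : atlas c -> atlas c' ->
  chart_dom c p -> chart_dom c' p -> differentiable (c' \o chart_inv c) (c p).
Proof.
move=> ac ac' cp c'p; have [+ _] := CkS (transition_Ck 1 ac ac').
by apply; apply: chart_image_fun.
Qed.

Lemma chart_change_near (T : Type) (phi : M -> T) c c' p :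
  chart_dom c p -> chart_dom c' p ->
  \forall x \near (c' p), ((phi \o chart_inv c) \o (c \o chart_inv c')) x =
    (phi \o chart_inv c') x.
Proof.
move=> cp c'p.
have : nbhs (c' p) (chart_image c' (chart_dom c)).
  apply: open_nbhs_nbhs; split; last exact: chart_image_fun.
  by apply: chart_image_open; apply: chart_dom_open.
by apply: filterS => x [_ dx] /=; rewrite chart_funK.
Qed.

Lemma chart_change_differentiable (V : normedModType R) (phi : M -> V) c c' p :
  atlas c -> atlas c' -> chart_dom c p -> chart_dom c' p ->
  differentiable (phi \o chart_inv c) (c p) ->
  differentiable (phi \o chart_inv c') (c' p).
Proof.
move=> ac ac' cp c'p dphi.
apply: differentiable_near (chart_change_near _ cp c'p) _.
apply: differentiable_comp; first exact: transition_differentiable.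
by rewrite /= chart_funK.
Qed.

Lemma chart_change_derive (V : normedModType R) (phi : M -> V) c c' p v :
  atlas c -> atlas c' -> chart_dom c p -> chart_dom c' p ->
  differentiable (phi \o chart_inv c) (c p) ->
  'D_v (phi \o chart_inv c') (c' p) =
  'D_('D_v (c \o chart_inv c') (c' p)) (phi \o chart_inv c) (c p).
Proof.
move=> ac ac' cp c'p dphi.
rewrite -(near_eq_derive _ (chart_change_near phi cp c'p)) derive_comp.
- by rewrite /= chart_funK.
- exact: transition_differentiable.
- by rewrite /= chart_funK.
Qed.

Definition mdiff (V : normedModType R) (phi : M -> V) (p : M) : Prop :=
  differentiable (phi \o chart_inv (chart_at p)) (chart_at p p).

Lemma mdiffP (V : normedModType R) (phi : M -> V) c p : atlas c -> chart_dom c p ->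
  mdiff phi p <-> differentiable (phi \o chart_inv c) (c p).
Proof.
move=> ac cp; have dp := chart_at_dom p; have ap := chart_at_atlas p.
by split; apply: chart_change_differentiable.
Qed.

Lemma tderive_chart (V : normedModType R) (phi : M -> V) c p v :
  atlas c -> chart_dom c p -> mdiff phi p ->
  tderive phi p v = 'D_(tangent_coord c p v) (phi \o chart_inv c) (c p).
Proof.
move=> ac cp dphi; rewrite /tderive /tangent_coord /tderive.
apply: chart_change_derive => //; [exact: chart_at_atlas|exact: chart_at_dom|].
exact/mdiffP.
Qed.

Lemma tderive_linear (V : normedModType R) (phi : M -> V) p a u v :
  mdiff phi p -> tderive phi p (a *: u + v) = a *: tderive phi p u + tderive phi p v.
Proof. by move=> d; rewrite /tderive derive_linear. Qed.

Lemma near_chart c p (P : set M) : chart_dom c p -> nbhs p P ->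
  \forall x \near (c p), P (chart_inv c x).
Proof.
move=> cp Pp; apply: (chart_inv_cts (chart_funS cp)).
by rewrite /= chart_funK.
Qed.

Lemma tderive_near (V : normedModType R) (phi psi : M -> V) p v :
  (\near p, phi p = psi p) -> tderive phi p v = tderive psi p v.
Proof.
by move=> H; apply: near_eq_derive; apply: (near_chart (P := fun q => phi q = psi q)) => //; apply: chart_at_dom.
Qed.

Lemma open_near U p (P : M -> Prop) : open U -> U p -> (forall q, U q -> P q) ->
  \near p, P p.
Proof. by move=> oU Up H; apply: filterS (open_nbhs_nbhs (conj oU Up)). Qed.

Lemma mdiff_rV m (phi : M -> 'rV[R]_m) p :
  mdiff phi p <-> forall j, @mdiff R^o (fun q => phi q 0 j) p.
Proof. exact: differentiable_rV. Qed.

Lemma tderive_coord m (phi : M -> 'rV[R]_m) p v j : mdiff phi p ->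
  tderive phi p v 0 j = @tderive R n M R^o (fun q => phi q 0 j) p v.
Proof. by move=> d; rewrite /tderive coord_derive. Qed.

Lemma mdiff_chart c p : atlas c -> chart_dom c p -> mdiff c p.
Proof.
move=> ac cp; apply: transition_differentiable => //.
  exact: chart_at_atlas.
exact: chart_at_dom.
Qed.

(** The inverse of [tangent_coord c p], meaningful for p in the domain of c. *)
Definition tangent_vec c p (w : 'rV[R]_n) : 'rV[R]_n :=
  'D_w (chart_at p \o chart_inv c) (c p).

Lemma chart_id_near c x : chart_cod c x -> \forall y \near x, (c \o chart_inv c) y = id y.
Proof.
move=> cx; have : nbhs x (chart_cod c) by apply: open_nbhs_nbhs; split=> //; exact: chart_cod_open.
by apply: filterS => y cy; exact: chart_invK.
Qed.

Lemma derive_chart_id c p w : chart_dom c p -> 'D_w (c \o chart_inv c) (c p) = w.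
Proof.
move=> cp; rewrite (near_eq_derive _ (chart_id_near (chart_funS cp))).
by rewrite derive_id.
Qed.

Lemma tangent_coord_at p v : tangent_coord (chart_at p) p v = v.
Proof. by apply: derive_chart_id; apply: chart_at_dom. Qed.

Lemma tangent_coord_vec c c' p w : atlas c -> atlas c' ->
  chart_dom c p -> chart_dom c' p ->
  tangent_coord c' p (tangent_vec c p w) = 'D_w (c' \o chart_inv c) (c p).
Proof.
move=> ac ac' cp c'p; rewrite /tangent_coord /tderive /tangent_vec.
rewrite -chart_change_derive //; [exact: chart_at_atlas|exact: chart_at_dom|].
apply: transition_differentiable => //; [exact: chart_at_atlas|exact: chart_at_dom].
Qed.

Lemma tangent_vecK c p w : atlas c -> chart_dom c p ->
  tangent_coord c p (tangent_vec c p w) = w.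
Proof. by move=> ac cp; rewrite tangent_coord_vec // derive_chart_id. Qed.

Lemma tangent_coordK c p v : atlas c -> chart_dom c p ->
  tangent_vec c p (tangent_coord c p v) = v.
Proof.
move=> ac cp; rewrite -[RHS](derive_chart_id v (chart_at_dom p)).
rewrite (chart_change_derive _ ac (chart_at_atlas p) cp (chart_at_dom p)) //.
apply: transition_differentiable => //; [exact: chart_at_atlas|exact: chart_at_dom].
Qed.

Lemma tangent_coord_linear c p a u v : atlas c -> chart_dom c p ->
  tangent_coord c p (a *: u + v) = a *: tangent_coord c p u + tangent_coord c p v.
Proof. by move=> ac cp; apply: tderive_linear; apply: mdiff_chart. Qed.

Lemma tangent_vec_linear c p a u v : atlas c -> chart_dom c p ->
  tangent_vec c p (a *: u + v) = a *: tangent_vec c p u + tangent_vec c p v.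
Proof.
move=> ac cp; apply: derive_linear; apply: transition_differentiable => //.
  exact: chart_at_atlas.
exact: chart_at_dom.
Qed.

End charts.

Section frames.
Context (R : realType) (n : nat) (M : manifold R n).
Implicit Types (c : chart R M n) (p q : M).

(** The coordinate vector field d/dx_a of the chart c, meaningful on [chart_dom c] only. *)
Definition coord_field c (a : 'I_n) (q : M) : 'rV[R]_n :=
  tangent_vec c q (delta_mx 0 a).

Lemma coord_field_expand c p v : atlas c -> chart_dom c p ->
  v = \sum_a (tangent_coord c p v) 0 a *: coord_field c a p.
Proof.
move=> ac cp; rewrite -[LHS](tangent_coordK v ac cp).
rewrite {1}(row_sum_delta (tangent_coord c p v)).
by rewrite (linfun_lincomb (fun a u w => tangent_vec_linear a u w ac cp)).
Qed.

Lemma coord_fieldK c p a : atlas c -> chart_dom c p ->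
  tangent_coord c p (coord_field c a p) = delta_mx 0 a.
Proof. exact: tangent_vecK. Qed.

End frames.

Section smooth_functions.
Context (R : realType) (n : nat) (M : manifold R n).
Implicit Types (c : chart R M n) (U W : set M) (p q : M) (phi psi : M -> R).

Lemma smooth_fun_local U phi :
  (forall p, U p -> exists W, [/\ open W, W p & smooth_fun W phi]) ->
  smooth_fun U phi.
Proof.
move=> H c ac k; apply: Ck_local => x [cx /H[W [oW Wx sW]]].
exists (chart_image c W); split=> //; first exact: chart_image_open.
exact: sW.
Qed.

Lemma smooth_funS U W phi : U `<=` W -> smooth_fun W phi -> smooth_fun U phi.
Proof.
by move=> UW H c ac k; apply: Ck_sub (H c ac k); apply: chart_imageS.
Qed.

Lemma smooth_fun_ext U phi psi : open U -> (forall p, U p -> phi p = psi p) ->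
  smooth_fun U phi -> smooth_fun U psi.
Proof.
move=> oU E H c ac k; apply: Ck_ext (H c ac k); first exact: chart_image_open.
by move=> x [_ Ux] /=; apply: E.
Qed.

Lemma smooth_fun_cst U a : smooth_fun U (cst a : M -> R).
Proof. by move=> c ac k; apply: Ck_cst. Qed.

Lemma smooth_funD U phi psi : open U -> smooth_fun U phi -> smooth_fun U psi ->
  smooth_fun U (fun q => phi q + psi q).
Proof.
move=> oU H1 H2 c ac k; apply: CkD; [exact: chart_image_open|exact: H1|exact: H2].
Qed.

Lemma smooth_funM U phi psi : open U -> smooth_fun U phi -> smooth_fun U psi ->
  smooth_fun U (fun q => phi q * psi q).
Proof.
move=> oU H1 H2 c ac k; apply: CkM; [exact: chart_image_open|exact: H1|exact: H2].
Qed.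

Lemma smooth_funV U phi : open U -> (forall p, U p -> phi p != 0) ->
  smooth_fun U phi -> smooth_fun U (fun q => (phi q)^-1).
Proof.
move=> oU H0 H c ac k; apply: CkV; [exact: chart_image_open| |exact: H].
by move=> x [_ Ux]; apply: H0.
Qed.

Lemma smooth_fun_sum (I : Type) (r : seq I) (P : pred I) U (phi : I -> M -> R) :
  open U -> (forall i, P i -> smooth_fun U (phi i)) ->
  smooth_fun U (fun q => \sum_(i <- r | P i) phi i q).
Proof.
move=> oU H c ac k; apply: Ck_sum => [|i Pi]; first exact: chart_image_open.
exact: (H i Pi c ac k).
Qed.

Lemma smooth_fun_det m U (phi : 'I_m -> 'I_m -> M -> R) :
  open U -> (forall i j, smooth_fun U (phi i j)) ->
  smooth_fun U (fun q => \det (\matrix_(i, j) phi i j q)).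
Proof.
move=> oU H c ac k; apply: (@Ck_det _ _ _ _ _ (fun i j => phi i j \o chart_inv c)).
  exact: chart_image_open.
by move=> i j; exact: (H i j c ac k).
Qed.

(** One chart containing U suffices: in any other chart the function is composed with a smooth
    transition map. *)
Lemma smooth_fun_chart c U phi : atlas c -> open U -> U `<=` chart_dom c ->
  (forall k, @Ck R n R^o k (chart_image c U) (phi \o chart_inv c)) ->
  smooth_fun U phi.
Proof.
move=> ac oU Uc H c' ac' k.
apply: (@Ck_ext _ _ _ _ _ ((phi \o chart_inv c) \o (c \o chart_inv c'))).
- exact: chart_image_open.
- by move=> x [_ Ux] /=; rewrite chart_funK //; apply: Uc.
apply: (@Ck_comp0 _ _ _ _ _ (chart_image c U)) => //.
- exact: chart_image_open.
- by move=> x [_ Ux]; apply: chart_image_fun => //; apply: Uc.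
- by apply: Ck_sub (transition_Ck k ac' ac); apply: chart_imageS.
Qed.

Lemma smooth_fun_chart_coord c j : atlas c ->
  smooth_fun (chart_dom c) (fun q => c q 0 j).
Proof.
move=> ac; apply: (smooth_fun_chart ac) => [|//|k]; first exact: chart_dom_open.
apply: (@Ck_ext _ _ _ _ _ (fun x => x 0 j)); last exact: Ck_proj.
  by apply: chart_image_open; apply: chart_dom_open.
by move=> x [cx _] /=; rewrite chart_invK.
Qed.

Lemma smooth_mdiff U phi p : open U -> U p -> smooth_fun U phi -> @mdiff _ _ _ R^o phi p.
Proof.
move=> oU Up H; have [+ _] := CkS (H _ (chart_at_atlas p) 1%N).
by apply; apply: chart_image_fun => //; apply: chart_at_dom.
Qed.

Lemma smooth_fun_derive_coord c U phi a : atlas c -> open U -> U `<=` chart_dom c ->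
  smooth_fun U phi ->
  smooth_fun U (fun q => 'D_(delta_mx 0 a) (phi \o chart_inv c : _ -> R^o) (c q)).
Proof.
move=> ac oU Uc H; apply: (smooth_fun_chart ac oU Uc) => k.
have [_ /(_ (delta_mx 0 a))] := CkS (H c ac k.+1).
apply: Ck_ext; first exact: chart_image_open.
by move=> x [cx _] /=; rewrite chart_invK.
Qed.

Lemma tderive_fD phi psi p v : @mdiff _ _ _ R^o phi p -> @mdiff _ _ _ R^o psi p ->
  @tderive _ _ _ R^o (fun q => phi q + psi q) p v =
  @tderive _ _ _ R^o phi p v + @tderive _ _ _ R^o psi p v.
Proof. by move=> d1 d2; apply: deriveD; apply: diff_derivable. Qed.

Lemma tderive_fM phi psi p v : @mdiff _ _ _ R^o phi p -> @mdiff _ _ _ R^o psi p ->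
  @tderive _ _ _ R^o (fun q => phi q * psi q) p v =
  phi p * @tderive _ _ _ R^o psi p v + psi p * @tderive _ _ _ R^o phi p v.
Proof.
move=> d1 d2.
have := deriveM (diff_derivable (v := v) d1) (diff_derivable (v := v) d2).
by rewrite /= chart_funK //; apply: chart_at_dom.
Qed.

Lemma tderive_fsum (I : Type) (r : seq I) (P : pred I) (phi : I -> M -> R) p v :
  (forall i, @mdiff _ _ _ R^o (phi i) p) ->
  @tderive _ _ _ R^o (fun q => \sum_(i <- r | P i) phi i q) p v =
  \sum_(i <- r | P i) @tderive _ _ _ R^o (phi i) p v.
Proof.
move=> d; rewrite /tderive.
have -> : (fun q => \sum_(i <- r | P i) phi i q) \o chart_inv (chart_at p) =
  \sum_(i <- r | P i) (phi i \o chart_inv (chart_at p) : _ -> R^o).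
  by apply/funext => x; rewrite fct_sumE.
(* Differentiability of the partial sums is carried through the induction along with the formula for
   their derivative. *)
have [-> //] : 'D_v (\sum_(i <- r | P i) (phi i \o chart_inv (chart_at p) : _ -> R^o)) (chart_at p p) =
    \sum_(i <- r | P i) 'D_v (phi i \o chart_inv (chart_at p) : _ -> R^o) (chart_at p p) /\
  differentiable (\sum_(i <- r | P i) (phi i \o chart_inv (chart_at p) : _ -> R^o)) (chart_at p p).
elim/big_rec2: _ => [|i y f _ [<- df]].
  by split; [exact: derive_cst|exact: differentiable_cst].
split; last by apply: differentiableD => //; exact: d.
by rewrite deriveD //; apply: diff_derivable => //; exact: d.
Qed.

Lemma tderive_cst (V : normedModType R) (a : V) p v : tderive (cst a : M -> V) p v = 0.
Proof. exact: derive_cst. Qed.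

End smooth_functions.

Lemma smooth_fun_Ck (R : realType) n (M : manifold R n) (c : chart R M n) U
    (phi : M -> R) k : atlas c -> smooth_fun U phi ->
  @Ck R n R^o k (chart_image c U) (phi \o chart_inv c).
Proof. by move=> ac H; exact: H. Qed.

Section along.
Context (R : realType) (n m : nat) (N : manifold R n) (M : manifold R m) (f : N -> M).
Hypothesis fS : smooth_map f.
Implicit Types (c : chart R N n) (U W : set N) (p q : N).
Implicit Types (V : N -> 'rV[R]_m).

Lemma smooth_map_preimage_open (A : set M) : open A -> open (f @^-1` A).
Proof. by move=> oA; apply: open_comp => // x _; have [+ _] := fS; apply. Qed.

Lemma chart_comp_smooth (c' : chart R M m) : atlas c' ->
  forall j, smooth_fun (f @^-1` chart_dom c') (fun q => c' (f q) 0 j).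
Proof.
move=> ac' j c ac k; have [_ H] := fS.
have oU : open (chart_image c (f @^-1` chart_dom c')).
  by apply: chart_image_open; apply: smooth_map_preimage_open; apply: chart_dom_open.
by have /(Ck_coord _ _ oU)/(_ j) := H c c' ac ac' k.
Qed.

Lemma chart_comp_mdiff (c' : chart R M m) p : atlas c' -> chart_dom c' (f p) -> mdiff (c' \o f) p.
Proof.
move=> ac' c'p; apply/mdiff_rV => j.
apply: (smooth_mdiff _ _ (chart_comp_smooth ac' j)) => //.
by apply: smooth_map_preimage_open; apply: chart_dom_open.
Qed.

Lemma smooth_fun_comp (A : set M) (phi : M -> R) : open A -> smooth_fun A phi ->
  smooth_fun (f @^-1` A) (phi \o f).
Proof.
move=> oA H; apply: smooth_fun_local => p Ap.
pose c := chart_at p; pose c' := chart_at (f p).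
have ac : atlas c := chart_at_atlas p; have ac' : atlas c' := chart_at_atlas (f p).
pose W := chart_dom c `&` f @^-1` (chart_dom c' `&` A).
have oW : open W.
  apply: openI; first exact: chart_dom_open.
  by apply: smooth_map_preimage_open; apply: openI => //; exact: chart_dom_open.
exists W; split=> //; first by split; [|split=> //]; apply: chart_at_dom.
apply: (smooth_fun_chart ac oW) => [q []//|k].
apply: (@Ck_ext _ _ _ _ _ ((phi \o chart_inv c') \o (c' \o f \o chart_inv c))).
- exact: chart_image_open.
- by move=> x [_ [_ [c'x _]]] /=; rewrite chart_funK.
apply: (@Ck_comp0 _ _ _ _ _ (chart_image c' A)) => //.
- exact: chart_image_open.
- by move=> x [_ [_ [c'x Ax]]]; apply: chart_image_fun.
- have [_ /(_ c c' ac ac' k)] := fS; apply: Ck_sub; apply: chart_imageS.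
  by move=> q [_ []].
- exact: H.
Qed.

Lemma tderive_comp (V : normedModType R) (phi : M -> V) p v :
  mdiff phi (f p) -> tderive (phi \o f) p v = tderive phi (f p) (tmap f p v).
Proof.
move=> d; have := chart_comp_mdiff (chart_at_atlas (f p)) (chart_at_dom (f p)).
move=> df.
have H : \forall q \near p, ((phi \o chart_inv (chart_at (f p))) \o (chart_at (f p) \o f)) q = (phi \o f) q.
  apply: (@open_near _ _ _ (f @^-1` chart_dom (chart_at (f p)))).
  - by apply: smooth_map_preimage_open; apply: chart_dom_open.
  - exact: chart_at_dom.
  - by move=> q dq /=; rewrite chart_funK.
rewrite -(tderive_near v H) /tderive -compA derive_comp //.
  by rewrite /= chart_funK //; apply: chart_at_dom.
by rewrite /= chart_funK //; apply: chart_at_dom.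
Qed.

Lemma tangent_coord_tmap (c' : chart R M m) p v : atlas c' -> chart_dom c' (f p) ->
  tangent_coord c' (f p) (tmap f p v) = tderive (c' \o f) p v.
Proof. by move=> ac' c'p; rewrite tderive_comp //; apply: mdiff_chart. Qed.

Lemma tmap_linear p a u v : tmap f p (a *: u + v) = a *: tmap f p u + tmap f p v.
Proof.
apply: tderive_linear; apply: chart_comp_mdiff; [exact: chart_at_atlas|exact: chart_at_dom].
Qed.

Lemma preimage_chart_open U (c' : chart R M m) : open U -> open (U `&` f @^-1` chart_dom c').
Proof.
by move=> oU; apply: openI => //; apply: smooth_map_preimage_open; apply: chart_dom_open.
Qed.

Lemma smooth_along_coord U V (c' : chart R M m) a : open U -> smooth_along f U V ->
  atlas c' -> smooth_fun (U `&` f @^-1` chart_dom c')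
    (fun q => tangent_coord c' (f q) (V q) 0 a).
Proof.
move=> oU H ac' c ac k.
have oW := chart_image_open (c := c) (preimage_chart_open c' oU).
exact: (Ck_coord k _ oW).1 (H c c' ac ac' k) a.
Qed.

(** Reduces sections of the pull-back bundle to real functions, from which the closure properties
    below are inherited. *)
Lemma smooth_along_of_coord U V : open U ->
  (forall c' : chart R M m, atlas c' -> forall j, smooth_fun (U `&` f @^-1` chart_dom c')
    (fun q => tangent_coord c' (f q) (V q) 0 j)) ->
  smooth_along f U V.
Proof.
move=> oU H c c' ac ac' k.
have oW := chart_image_open (c := c) (preimage_chart_open c' oU).
apply: (Ck_coord k _ oW).2 => j; exact: (H c' ac' j c ac k).
Qed.

Local Opaque smooth_along smooth_fun.

Lemma smooth_along_local U V : open U ->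
  (forall p, U p -> exists W, [/\ open W, W p & smooth_along f W V]) ->
  smooth_along f U V.
Proof.
move=> oU H; apply: (smooth_along_of_coord oU) => c' ac' j; apply: smooth_fun_local.
move=> p [/H[W [oW Wp sW]] c'p].
exists (W `&` f @^-1` chart_dom c'); split=> //; first exact: preimage_chart_open.
exact: smooth_along_coord.
Qed.

Lemma smooth_alongS U W V : open U -> open W -> U `<=` W ->
  smooth_along f W V -> smooth_along f U V.
Proof.
move=> oU oW UW H; apply: (smooth_along_of_coord oU) => c' ac' j.
by apply: smooth_funS (smooth_along_coord j oW H ac'); move=> q [/UW].
Qed.

Lemma smooth_along_ext U V1 V2 : open U -> (forall p, U p -> V1 p = V2 p) ->
  smooth_along f U V1 -> smooth_along f U V2.
Proof.
move=> oU E H; apply: (smooth_along_of_coord oU) => c' ac' j.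
apply: smooth_fun_ext (smooth_along_coord j oU H ac'); first exact: preimage_chart_open.
by move=> q [Uq _]; rewrite E.
Qed.

Lemma smooth_along0 U : open U -> smooth_along f U (fun=> 0).
Proof.
move=> oU; apply: (smooth_along_of_coord oU) => c' ac' j.
apply: (@smooth_fun_ext _ _ _ _ (cst 0)); [exact: preimage_chart_open| |exact: smooth_fun_cst].
move=> q [_ c'q]; rewrite (linfun0 (fun a u v => tangent_coord_linear a u v ac' c'q)).
by rewrite mxE.
Qed.

Lemma smooth_alongD U V1 V2 : open U -> smooth_along f U V1 -> smooth_along f U V2 ->
  smooth_along f U (fun q => V1 q + V2 q).
Proof.
move=> oU H1 H2.
apply: (smooth_along_of_coord oU) => c' ac' j.
have oW := preimage_chart_open c' oU.
apply: smooth_fun_ext (smooth_funD oW (smooth_along_coord j oU H1 ac') (smooth_along_coord j oU H2 ac')) => //.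
move=> q [_ c'q]; rewrite (linfunD (fun a u v => tangent_coord_linear a u v ac' c'q)).
by rewrite mxE.
Qed.

Lemma smooth_alongZ U phi V : open U -> smooth_fun U phi -> smooth_along f U V ->
  smooth_along f U (fun q => phi q *: V q).
Proof.
move=> oU Hphi H; apply: (smooth_along_of_coord oU) => c' ac' j.
have oW := preimage_chart_open c' oU.
have Hphi' : smooth_fun (U `&` f @^-1` chart_dom c') phi by apply: smooth_funS Hphi => q [].
apply: smooth_fun_ext (smooth_funM oW Hphi' (smooth_along_coord j oU H ac')) => //.
move=> q [_ c'q]; rewrite (linfunZ (fun a u v => tangent_coord_linear a u v ac' c'q)).
by rewrite mxE.
Qed.

Lemma smooth_alongN U V : open U -> smooth_along f U V ->
  smooth_along f U (fun q => - V q).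
Proof.
move=> oU H; apply: smooth_along_ext (smooth_alongZ oU (@smooth_fun_cst _ _ _ _ (-1)) H) => //.
by move=> q _; rewrite scaleN1r.
Qed.

Lemma smooth_alongB U V1 V2 : open U -> smooth_along f U V1 -> smooth_along f U V2 ->
  smooth_along f U (fun q => V1 q - V2 q).
Proof. by move=> oU H1 H2; exact: smooth_alongD oU H1 (smooth_alongN oU H2). Qed.

Lemma smooth_along_sum (I : Type) (r : seq I) (P : pred I) U (V : I -> N -> 'rV[R]_m) :
  open U -> (forall i, P i -> smooth_along f U (V i)) ->
  smooth_along f U (fun q => \sum_(i <- r | P i) V i q).
Proof.
move=> oU H.
have -> : (fun q => \sum_(i <- r | P i) V i q) =
    \big[(fun g h => fun x => g x + h x)/(fun=> 0)]_(i <- r | P i) V i.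
  by apply/funext => x; elim/big_rec2: _ => //= i g y Pi ->.
elim/big_ind: _ => [|g h Hg Hh|i Pi]; [exact: smooth_along0|exact: smooth_alongD oU Hg Hh|exact: H].
Qed.

End along.

Lemma smooth_map_id (R : realType) (n : nat) (M : manifold R n) :
  @smooth_map R n n M M idfun.
Proof.
split; first by move=> x; apply: cvg_id.
by move=> c c' ac ac' k; apply: transition_Ck.
Qed.

Section fields.
Context (R : realType) (n : nat) (M : manifold R n).
Implicit Types (c : chart R M n) (U W : set M) (p q : M) (X Y : M -> 'rV[R]_n).

Lemma smooth_field_coord U X c j : open U -> smooth_field U X -> atlas c ->
  smooth_fun (U `&` chart_dom c) (fun q => tangent_coord c q (X q) 0 j).
Proof. exact: (smooth_along_coord (smooth_map_id M)). Qed.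

Lemma smooth_field_of_coord U X : open U ->
  (forall c, atlas c -> forall j,
    smooth_fun (U `&` chart_dom c) (fun q => tangent_coord c q (X q) 0 j)) ->
  smooth_field U X.
Proof. exact: (smooth_along_of_coord (smooth_map_id M)). Qed.

(** The components in another chart are first partial derivatives of the transition map, whence the
    use of one order more. *)
Lemma coord_field_smooth c a : atlas c -> smooth_field (chart_dom c) (coord_field c a).
Proof.
move=> ac; apply: smooth_field_of_coord; first exact: chart_dom_open.
move=> c' ac' j.
have oW : open (chart_dom c `&` chart_dom c') by apply: openI; apply: chart_dom_open.
apply: (smooth_fun_chart ac oW) => [q []//|k].
have oV := chart_image_open (c := c) oW.
have T := CkS (transition_Ck k.+1 ac ac').
have {T} := T.2 (delta_mx 0 a).
have oV' : open (chart_image c (chart_dom c')) by apply: chart_image_open; apply: chart_dom_open.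
move=> /(Ck_coord _ _ oV')/(_ j) /(Ck_sub (U := chart_image c (chart_dom c `&` chart_dom c'))) H.
apply: Ck_ext (H _) => //; last by apply: chart_imageS => q [].
move=> x [cx [dx d'x]] /=; rewrite tangent_coord_vec //.
by rewrite chart_invK.
Qed.

Lemma tderive_field_smooth U X (phi : M -> R) : open U -> smooth_fun U phi ->
  smooth_field U X -> smooth_fun U (fun q => @tderive _ _ _ R^o phi q (X q)).
Proof.
move=> oU sphi sX; apply: smooth_fun_local => p Up.
pose c := chart_at p; have ac : atlas c := chart_at_atlas p.
exists (U `&` chart_dom c).
have oW : open (U `&` chart_dom c) by apply: openI => //; apply: chart_dom_open.
split=> //; first by split=> //; apply: chart_at_dom.
have sphiW : smooth_fun (U `&` chart_dom c) phi by apply: smooth_funS sphi => q [].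
have H a := smooth_funM oW (smooth_field_coord a oU sX ac) (smooth_fun_derive_coord a ac oW (fun q => @proj2 _ _) sphiW).
apply: smooth_fun_ext (smooth_fun_sum (index_enum 'I_n) (P := xpredT) oW (fun a _ => H a)) => //.
move=> q [Uq cq]; have d := smooth_mdiff oU Uq sphi.
by rewrite (tderive_chart _ ac cq d) derive_sum_coord //; apply/(mdiffP _ ac cq).
Qed.

(** In a chart c' the j-th component of the image is the derivative along X of the function c'_j o
    f. *)
Lemma tmap_smooth m (M' : manifold R m) (f : M -> M') U X : smooth_map f ->
  open U -> smooth_field U X -> smooth_along f U (fun q => tmap f q (X q)).
Proof.
move=> fS oU sX; apply: (smooth_along_of_coord fS oU) => c' ac' j.
have oW := preimage_chart_open fS c' oU.
have sXW : smooth_field (U `&` f @^-1` chart_dom c') X.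
  by apply: (smooth_alongS (smooth_map_id M) oW oU) sX => q [].
have sphi : smooth_fun (U `&` f @^-1` chart_dom c') (fun q => c' (f q) 0 j).
  by apply: smooth_funS (chart_comp_smooth fS ac' j) => q [].
apply: smooth_fun_ext (tderive_field_smooth oW sphi sXW) => //.
move=> q [Uq c'q]; rewrite tangent_coord_tmap //.
by rewrite tderive_coord //; apply: chart_comp_mdiff.
Qed.

(** The extension of u has constant coefficients in the coordinate frame at p. *)
Lemma coord_fields_value p (u : 'rV[R]_n) :
  exists X, smooth_field (chart_dom (chart_at p)) X /\ X p = u.
Proof.
have ac := chart_at_atlas p; have cp := chart_at_dom p.
exists (fun q => \sum_a u 0 a *: coord_field (chart_at p) a q); split.
  apply: (smooth_along_sum (smooth_map_id M)); first exact: chart_dom_open.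
  move=> a _; apply: (smooth_alongZ (smooth_map_id M)); first exact: chart_dom_open.
    exact: smooth_fun_cst.
  exact: coord_field_smooth.
by rewrite [RHS](coord_field_expand u ac cp) tangent_coord_at.
Qed.

End fields.

Lemma smooth_field_comp (R : realType) (n m : nat) (N : manifold R n)
    (M : manifold R m) (f : N -> M) (U : set M) (Y : M -> 'rV[R]_m) :
  smooth_map f -> open U -> smooth_field U Y -> smooth_along f (f @^-1` U) (Y \o f).
Proof.
move=> fS oU sY.
apply: (smooth_along_of_coord fS (smooth_map_preimage_open fS oU)) => c' ac' j.
apply: (smooth_fun_comp fS _ (smooth_field_coord j oU sY ac')).
by apply: openI => //; apply: chart_dom_open.
Qed.

(** * Smooth coefficients and bump functions *)

Local Opaque smooth_along smooth_fun tmap tangent_coord.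

(** If y A A^T = 0 then (y A)(y A)^T, a sum of squares, vanishes, so y A = 0. *)
Lemma gram_unit (R : realType) k m (A : 'M[R]_(k, m)) :
  (forall y : 'rV[R]_k, y *m A = 0 -> y = 0) -> A *m A^T \in unitmx.
Proof.
move=> H; rewrite -row_free_unit; apply: inj_row_free => y Hy; apply: H.
have : (y *m A) *m (y *m A)^T = 0 by rewrite trmx_mul mulmxA -(mulmxA y) Hy mul0mx.
move=> /matrixP/(_ 0 0); rewrite !mxE => S0; apply/rowP => j; rewrite [RHS]mxE.
have S0' : \sum_i (y *m A) 0 i ^+ 2 = 0.
  by rewrite -[RHS]S0; apply: eq_bigr => i _; rewrite expr2; congr (_ * _); rewrite [RHS]mxE.
have := psumr_eq0P (fun i _ => sqr_ge0 ((y *m A) 0 i)) S0'.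
by move=> /(_ j isT)/eqP; rewrite sqrf_eq0 => /eqP.
Qed.

(** Multiplying v = x A by A^T gives x G = v A^T with G the Gram matrix of the w_i, invertible by
    independence; Cramer's rule writes x as a quotient of smooth functions. Coefficients chosen
    point by point thus become smooth. *)
Lemma smooth_coefficients (R : realType) n (N : manifold R n) k m (U : set N)
    (w : 'I_k -> N -> 'rV[R]_m) (x : N -> 'rV[R]_k) (v : N -> 'rV[R]_m) :
  open U -> (forall i j, smooth_fun U (fun q => w i q 0 j)) ->
  (forall j, smooth_fun U (fun q => v q 0 j)) ->
  (forall q, U q -> v q = \sum_i x q 0 i *: w i q) ->
  (forall q, U q -> forall y : 'rV[R]_k, \sum_i y 0 i *: w i q = 0 -> y = 0) ->
  forall i, smooth_fun U (fun q => x q 0 i).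
Proof.
move=> oU sw sv E inj i.
pose A q : 'M[R]_(k, m) := \matrix_(a, j) w a q 0 j.
have AE q (y : 'rV[R]_k) : y *m A q = \sum_a y 0 a *: w a q.
  apply/rowP => j; rewrite !mxE summxE; apply: eq_bigr => a _.
  by rewrite !mxE.
pose G (a b : 'I_k) q := \sum_j w a q 0 j * w b q 0 j.
pose GM q : 'M[R]_k := \matrix_(a, b) G a b q.
have GME q : GM q = A q *m (A q)^T.
  apply/matrixP => a b; rewrite !mxE; apply: eq_bigr => j _.
  by rewrite !mxE.
have sG a b : smooth_fun U (G a b).
  by apply: (smooth_fun_sum _ oU) => j _; apply: (smooth_funM oU); apply: sw.
pose d q := \det (GM q).
have sd : smooth_fun U d by apply: (smooth_fun_det oU).
have GU q : U q -> GM q \in unitmx.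
  by move=> Uq; rewrite GME; apply: gram_unit => y; rewrite AE; apply: inj.
have d0 q : U q -> d q != 0 by move=> /GU; rewrite unitmxE unitfE.
have xE q : U q -> x q = ((v q *m (A q)^T) *m \adj (GM q)) *m ((d q)^-1)%:M.
  move=> Uq; have -> : v q *m (A q)^T = x q *m GM q by rewrite (E q Uq) -AE -mulmxA -GME.
  rewrite -(mulmxA (x q)) mul_mx_adj -mulmxA -scalar_mxM mulfV ?mulmx1 //.
  exact: d0.
have scof a b : smooth_fun U (fun q => cofactor (GM q) a b).
  apply: (smooth_funM oU); first exact: smooth_fun_cst.
  have -> : (fun q => \det (row' a (col' b (GM q)))) =
     (fun q => \det (\matrix_(s, t) G (lift a s) (lift b t) q)).
    by apply/funext => q; congr (\det _); apply/matrixP => s t; rewrite !mxE.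
  by apply: (smooth_fun_det oU) => s t; apply: sG.
have s1 a : smooth_fun U (fun q => \sum_j v q 0 j * w a q 0 j).
  by apply: (smooth_fun_sum _ oU) => j _; apply: (smooth_funM oU); [apply: sv|apply: sw].
have s2 : smooth_fun U (fun q => \sum_a (\sum_j v q 0 j * w a q 0 j) * cofactor (GM q) i a).
  by apply: (smooth_fun_sum _ oU) => a _; apply: (smooth_funM oU); [apply: s1|apply: scof].
apply: (smooth_fun_ext oU _ (smooth_funM oU s2 (smooth_funV oU d0 sd))).
move=> q Uq; rewrite [in RHS](xE q Uq) mul_mx_scalar !mxE mulrC; congr (_ * _).
apply: eq_bigr => a _; rewrite !mxE; congr (_ * _).
by apply: eq_bigr => j _; rewrite !mxE.
Qed.

Lemma along_coefficients (R : realType) n m (N : manifold R n) (M : manifold R m)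
    (f : N -> M) k (U : set N) (E : 'I_k -> N -> 'rV[R]_m) (y : N -> 'rV[R]_k)
    (V : N -> 'rV[R]_m) : smooth_map f -> open U ->
  (forall i, smooth_along f U (E i)) -> smooth_along f U V ->
  (forall q, U q -> V q = \sum_i y q 0 i *: E i q) ->
  (forall q, U q -> forall z : 'rV[R]_k, \sum_i z 0 i *: E i q = 0 -> z = 0) ->
  forall i, smooth_fun U (fun q => y q 0 i).
Proof.
move=> fS oU sE sV VE inj i; apply: smooth_fun_local => p Up.
pose c' := chart_at (f p); have ac' : atlas c' := chart_at_atlas (f p).
exists (U `&` f @^-1` chart_dom c').
have oW := preimage_chart_open fS c' oU.
split; [exact: oW|by split; [|exact: chart_at_dom]|].
apply: (@smooth_coefficients _ _ _ _ _ _ (fun i q => tangent_coord c' (f q) (E i q)) y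
  (fun q => tangent_coord c' (f q) (V q)) oW).
- by move=> a j; exact: smooth_along_coord fS _ _ _ _ oU (sE a) ac'.
- by move=> j; exact: smooth_along_coord fS _ _ _ _ oU sV ac'.
- move=> q [Uq c'q].
  by rewrite (VE q Uq) (linfun_lincomb (fun a u w => tangent_coord_linear a u w ac' c'q)).
- move=> q [Uq c'q] z.
  rewrite -(linfun_lincomb (fun a u w => tangent_coord_linear a u w ac' c'q)) => Hz.
  apply: (inj q Uq); rewrite -[LHS](tangent_coordK _ ac' c'q) Hz.
  exact: (linfun0 (fun a u w => tangent_vec_linear a u w ac' c'q)).
Qed.

(** The components of X in a coordinate frame are the coefficients of its image in the image of that
    frame, which stays independent because tangent maps are injective. *)
Lemma immersion_field_smooth (R : realType) n m (N : manifold R n) (M : manifold R m)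
    (f : N -> M) (U : set N) (X : N -> 'rV[R]_n) : smooth_map f ->
  (forall p, injective (tmap f p)) -> open U ->
  smooth_along f U (fun q => tmap f q (X q)) -> smooth_field U X.
Proof.
move=> fS finj oU sV; have idS := smooth_map_id N.
apply: (smooth_along_local idS oU) => p Up.
pose c := chart_at p; have ac : atlas c := chart_at_atlas p.
have oW : open (U `&` chart_dom c) by apply: openI => //; apply: chart_dom_open.
exists (U `&` chart_dom c); split; [exact: oW|by split; [|exact: chart_at_dom]|].
have sE a : smooth_field (U `&` chart_dom c) (coord_field c a).
  by apply: (smooth_alongS idS oW (@chart_dom_open _ _ _ c)) (coord_field_smooth a ac) => q [].
have XE q : (U `&` chart_dom c) q -> X q = \sum_a tangent_coord c q (X q) 0 a *: coord_field c a q.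
  by move=> [_ cq]; apply: coord_field_expand.
have sy : forall a, smooth_fun (U `&` chart_dom c) (fun q => tangent_coord c q (X q) 0 a).
  apply: (@along_coefficients _ _ _ _ _ f _ _ (fun a q => tmap f q (coord_field c a q)) _
    (fun q => tmap f q (X q)) fS oW).
  - by move=> a; apply: (tmap_smooth fS oW (sE a)).
  - by apply: (smooth_alongS fS oW oU) sV => q [].
  - by move=> q Wq; rewrite {1}(XE q Wq) (linfun_lincomb (tmap_linear fS q)).
  - move=> q [Uq cq] z; rewrite -(linfun_lincomb (tmap_linear fS q)) => Hz.
    have : \sum_a z 0 a *: coord_field c a q = 0.
      by apply: (finj q); rewrite Hz (linfun0 (tmap_linear fS q)).
    rewrite -(linfun_lincomb (fun a u w => tangent_vec_linear a u w ac cq)).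
    rewrite -row_sum_delta => Hz0.
    rewrite -[LHS](tangent_vecK _ ac cq) Hz0.
    exact: (linfun0 (fun a u w => tangent_coord_linear a u w ac cq)).
apply: (smooth_along_ext idS oW (fun q Wq => esym (XE q Wq))).
apply: (smooth_along_sum idS); first exact: oW.
move=> a _.
apply: (smooth_alongZ idS); [exact: oW|exact: sy|exact: sE].
Qed.

(** The function t^(-i) exp(-1/t), continued by 0 to t <= 0. The exponent i makes the span of the
    family stable under differentiation, so that smoothness is an induction. *)
Definition flat (R : realType) (i : nat) (t : R) : R^o :=
  if 0 < t then (t^-1) ^+ i * expR (- t^-1) else 0.

(** Raise s / n <= 1 + s / n <= exp(s / n) to the power n. *)
Lemma expR_pow_ge (R : realType) (n : nat) (s : R) : 0 <= s ->
  s ^+ n <= n%:R ^+ n * expR s.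
Proof.
move=> s0; case: n => [|n]; first by rewrite !expr0 mul1r; apply: le_trans (expR_ge1Dx s); rewrite lerDl.
have n0 : 0 < n.+1%:R :> R by rewrite ltr0n.
have -> : s = n.+1%:R * (s / n.+1%:R) by rewrite mulrC mulfVK // gt_eqF.
rewrite [expR _]expRM_natl exprMn; apply: ler_wpM2l; first by rewrite exprn_ge0 // ltW.
rewrite lerXn2r ?nnegrE ?expR_ge0 ?divr_ge0 ?ler0n //.
by apply: le_trans (expR_ge1Dx _); rewrite lerDr.
Qed.

(** The preceding inequality for s = 1/t, with exponent i + 2 instead of i, leaves a factor t^2;
    this forces the derivative at 0 to exist and vanish. *)
Lemma flat_le_sqr (R : realType) (i : nat) (t : R) :
  `|flat i t| <= (i.+2)%:R ^+ i.+2 * t ^+ 2.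
Proof.
rewrite /flat; case: ltP => [t0|_]; last first.
  by rewrite normr0 mulr_ge0 ?sqr_ge0 ?exprn_ge0.
have s0 : 0 <= t^-1 by rewrite invr_ge0 ltW.
have tn0 : t != 0 by rewrite gt_eqF.
rewrite ger0_norm ?mulr_ge0 ?expR_ge0 ?exprn_ge0 //.
have := expR_pow_ge i.+2 s0; rewrite expRN.
rewrite -ler_pdivrMr ?expR_gt0 // => H.
apply: le_trans (ler_wpM2r (sqr_ge0 t) H).
have -> // : t^-1 ^+ i / expR t^-1 = t^-1 ^+ i.+2 / expR t^-1 * t ^+ 2.
rewrite -[i.+2]addn2 exprD; move: (t^-1 ^+ i) ((expR t^-1)^-1) => a E.
by field.
Qed.

Lemma is_derive_flat (R : realType) (i : nat) (t : R) :
  is_derive t (1 : R) (flat i : R -> R^o) (- i%:R * flat i.+1 t + flat i.+2 t).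
Proof.
have [t0|t0|->] := ltgtP t 0.
- have -> : - i%:R * flat i.+1 t + flat i.+2 t = 0.
    by rewrite /flat ltNge ltW //= mulr0 addr0.
  apply: (near_eq_is_derive _ (@is_derive_cst R R R^o 0 t 1)).
  have : nbhs t [set s | s < 0] by exact: lt_nbhsl.
  by apply: filterS => s /= s0; rewrite /flat ltNge ltW.
- have tn0 : t != 0 by rewrite gt_eqF.
  apply: (@near_eq_is_derive R R R^o (fun s : R => (s^-1) ^+ i * expR (- s^-1))).
    have : nbhs t [set s | 0 < s] by exact: lt_nbhsr.
    by apply: filterS => s /= s0; rewrite /flat s0.
  have dV : is_derive t (1 : R) (fun s : R => s^-1) (- t ^- 2).
    have := @is_deriveV R id t 1 1 tn0 (is_derive_id _ _).
    by move/is_derive_eq; apply; rewrite /GRing.scale /= mulr1.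
  have dX : is_derive t (1 : R) (fun s : R => (s^-1) ^+ i)
      (i%:R * t^-1 ^+ i.-1 * (- t ^- 2)).
    have := @is_deriveX R R (fun s : R => s^-1) i t 1 _ dV.
    by rewrite exprfctE.
  have dE : is_derive t (1 : R) (fun s : R => expR (- s^-1)) (expR (- t^-1) * t ^- 2).
    have := @is_derive1_comp R expR (fun s : R => - s^-1) t _ _ (is_derive_expR _)
      (is_deriveN dV).
    by rewrite opprK.
  have := @is_deriveM R R _ _ t 1 _ _ dX dE.
  move/is_derive_eq; apply; rewrite /flat t0 /GRing.scale /=.
  case: i {dX} => [|i]; first by rewrite /= !exprS !expr0; field.
  rewrite [_.+1.-1]/= !exprS; move: (t^-1 ^+ i) => a; by field.
- have -> : - i%:R * flat i.+1 0 + flat i.+2 0 = 0 :> R by rewrite /flat ltxx mulr0 addr0.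
  have [||df dE] := @differentiable_eps R R R^o (flat i) 0 \0.
  - by move=> x; apply: cvg_cst.
  - move=> e e0; pose C : R := i.+2%:R ^+ i.+2.
    have C0 : 0 < C by rewrite exprn_gt0 // ltr0n.
    have : nbhs (0 : R) [set s | `|s| < e / C].
      apply/nbhs_ballP; exists (e / C) => /=; first by rewrite divr_gt0.
      by move=> s; rewrite -ball_normE /= sub0r normrN.
    apply: filterS => h /= he; rewrite addr0 {2}/flat ltxx !subr0.
    apply: le_trans (flat_le_sqr _ _) _; rewrite -/C -real_normK ?num_real // expr2 mulrA.
    by apply: ler_wpM2r => //; rewrite mulrC -ler_pdivlMr // ltW.
  by apply: DeriveDef; [exact: diff_derivable|rewrite deriveE // dE].
Qed.

Lemma Ck_flat (R : realType) n k i (U : set 'rV[R]_n) (f : 'rV[R]_n -> R^o) :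
  open U -> Ck k U f -> @Ck R n R^o k U (fun x => flat i (f x)).
Proof.
move=> oU; elim: k i f => [|k IH] i f Hf.
  move=> x Ux; apply: (continuous_comp (Hf x Ux)).
  by apply: differentiable_continuous; apply/derivable1_diffP; apply: ex_derive; apply: is_derive_flat.
have [Hf1 Hf2] := CkS Hf; have Hf0 := Ck_pred Hf.
have dflat j t : differentiable (flat j : R -> R^o) t.
  by apply/derivable1_diffP; have [] := is_derive_flat j t.
split=> [x Ux|v].
  exact: (@differentiable_comp _ _ _ _ f (flat i) x (Hf1 x Ux) (dflat _ _)).
apply: (@Ck_ext _ _ _ _ _ (fun x => ((- i%:R) * flat i.+1 (f x) + flat i.+2 (f x)) * 'D_v f x)) => //.
  move=> x Ux; rewrite -[RHS]/('D_v (flat i \o f) x).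
  rewrite (derive_comp v (Hf1 x Ux) (dflat i (f x))).
  have := linfunZ (fun a u w => derive_linear a u w (dflat i (f x))) ('D_v f x) 1.
  rewrite /GRing.scale /= mulr1 => ->; rewrite mulrC; congr (_ * _).
  by have [_ ->] := is_derive_flat i (f x).
apply: CkM => //; apply: CkD; [exact: oU| |exact: IH].
by apply: CkM; [exact: oU|exact: Ck_cst|exact: IH].
Qed.

(** The Hausdorff property makes a compact piece of one chart closed in all of M, so that a function
    vanishing off it can be continued by 0. *)
Lemma compact_in_chart (R : realType) n (M : manifold R n) (c : chart R M n)
    (B : set 'rV[R]_n) : compact B -> B `<=` chart_cod c ->
  closed (chart_inv c @` B).
Proof.
move=> cB Bc; apply: compact_closed; first exact: manifold_hausdorff.
apply: continuous_compact => //; apply: continuous_in_subspaceT => x /set_mem Bx.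
by apply: chart_inv_cts; apply: Bc.
Qed.

Lemma sqr_dist_le (R : realType) n (x : 'rV[R]_n) r : 0 <= r ->
  \sum_j x 0 j ^+ 2 <= r ^+ 2 -> `|x| <= r.
Proof.
move=> r0 H; apply: rV_norm_le => // j.
rewrite -(ler_pXn2r (n := 2)) ?nnegrE // real_normK ?num_real //.
apply: le_trans H; rewrite (bigD1 j) //= lerDl.
by apply: sumr_ge0 => i _; apply: sqr_ge0.
Qed.

Lemma bump_function (R : realType) n (M : manifold R n) (p : M) (U : set M) :
  open U -> U p ->
  exists (phi : M -> R) (K : set M), [/\ smooth_fun setT phi, phi p != 0,
    closed K, K `<=` U & forall q, ~ K q -> phi q = 0].
Proof.
move=> oU Up; pose c := chart_at p; have ac : atlas c := chart_at_atlas p.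
have cp : chart_dom c p := chart_at_dom p.
pose x0 := c p.
have : nbhs x0 (chart_image c U).
  by apply: open_nbhs_nbhs; split; [exact: chart_image_open|exact: chart_image_fun].
move=> /nbhs_ballP[e /= e0 He]; pose r := e / 2.
have r0 : 0 < r by rewrite divr_gt0.
(* The squared Euclidean distance is smooth, unlike the norm, and its balls lie in those of the
   norm. *)
pose s (x : 'rV[R]_n) : R := \sum_j (x 0 j - x0 0 j) ^+ 2.
pose B := [set x | s x <= r ^+ 2].
have Bball x : B x -> `|x - x0| <= r.
  move=> Bx; apply: sqr_dist_le; first exact: ltW.
  by apply: le_trans Bx; apply: ler_sum => j _; rewrite !mxE.
have BU : B `<=` chart_image c U.
  move=> x /Bball xr; apply: He; rewrite -ball_normE /= distrC.
  by apply: le_lt_trans xr _; rewrite /r ltr_pdivrMr // ltr_pMr // ltr1n.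
have sCk k : @Ck R n R^o k setT s.
  apply: Ck_sum; first exact: openT.
  move=> j _; have H : @Ck R n R^o k setT (fun x => x 0 j - x0 0 j).
    by apply: CkD; [exact: openT|exact: Ck_proj|exact: Ck_cst].
  by have := CkM openT H H.
have cB : compact B.
  apply: bounded_closed_compact.
    exists (r + `|x0|); split; first exact: num_real.
    move=> t tr x /Bball xr; apply: le_trans (ltW tr).
    rewrite -[x](subrK x0); apply: le_trans (ler_normD _ _) _.
    by rewrite lerD2r.
  apply: (@closed_comp _ _ s [set t | t <= r ^+ 2]); last exact: closed_le.
  by move=> x _; exact: (sCk 0%N x I).
pose K := chart_inv c @` B.
have Kc : closed K by apply: compact_in_chart => // x /BU[].
(* The values [chart_fun] takes outside the chart domain are meaningless, hence the case
   distinction. Smoothness there is checked on the complement of K, where phi is 0. *)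
pose phi q : R := if pselect (chart_dom c q) then flat 0 (r ^+ 2 - s (c q)) else 0.
have phiK q : ~ K q -> phi q = 0.
  move=> nK; rewrite /phi; case: pselect => [cq|//].
  rewrite /flat; case: ltP => // H; exfalso; apply: nK; exists (c q).
    by rewrite /B /= -subr_ge0 ltW.
  exact: chart_funK.
exists phi, K; split=> //.
- apply: smooth_fun_local => q _; have [cq|ncq] := pselect (chart_dom c q).
    exists (chart_dom c); split; [exact: chart_dom_open|exact: cq|].
    apply: (smooth_fun_chart ac) => [|//|k]; first exact: chart_dom_open.
    have oc : open (chart_image c (chart_dom c)) by apply: chart_image_open; apply: chart_dom_open.
    apply: (@Ck_ext _ _ _ _ _ (fun x => flat 0 (r ^+ 2 - s x)) _ oc).
      move=> x [cx dx] /=; rewrite /phi; case: pselect => [?|//].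
      by rewrite chart_invK.
    apply: Ck_flat => //; apply: CkD => //; first exact: Ck_cst.
    apply: (@Ck_ext _ _ _ _ _ (fun x => -1 * s x)) => //; first by move=> x _; rewrite mulN1r.
    apply: CkM => //; first exact: Ck_cst.
    by apply: Ck_sub (sCk k).
  exists (~` K); split.
  - exact: closed_openC.
  - move=> [x Bx E]; apply: ncq; rewrite -E; apply: chart_invS.
    by have [] := BU x Bx.
  - apply: (smooth_fun_ext (phi := cst 0)); [exact: closed_openC| |exact: smooth_fun_cst].
    by move=> q' /phiK.
- rewrite /phi; case: pselect => [?|//].
  have s0 : s (c p) = 0 by apply: big1 => j _; rewrite subrr expr0n.
  rewrite s0 subr0 /flat exprn_gt0 // expr0 mul1r.
  by apply: lt0r_neq0; apply: expR_gt0.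
- by move=> _ [x Bx <-]; have [] := BU x Bx.
Qed.

Lemma extend_field (R : realType) n (M : manifold R n) (U K : set M) (phi : M -> R)
    (X : M -> 'rV[R]_n) : open U -> smooth_field U X -> smooth_fun setT phi ->
  closed K -> K `<=` U -> (forall q, ~ K q -> phi q = 0) ->
  smooth_field setT (fun q => phi q *: X q).
Proof.
move=> oU sX sphi cK KU phiK; have idS := smooth_map_id M.
apply: (smooth_along_local idS openT) => p _.
have [Kp|nKp] := pselect (K p).
  exists U; split; [exact: oU|exact: KU|].
  apply: (smooth_alongZ idS); [exact: oU| |exact: sX].
  exact: smooth_funS sphi.
have oK : open (~` K) by exact: closed_openC.
exists (~` K); split; [exact: oK|exact: nKp|].
apply: (smooth_along_ext idS oK (V1 := fun=> 0)); last exact: smooth_along0.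
by move=> q nKq; rewrite phiK // scale0r.
Qed.

(** * Connections and metrics along a map *)

Section local_formula.
Context (R : realType) (n m : nat) (N : manifold R n) (M : manifold R m) (f : N -> M).
Hypothesis fS : smooth_map f.
Variable D : N -> 'rV[R]_n -> (N -> 'rV[R]_m) -> 'rV[R]_m.
Hypothesis D_add : forall (U : set N) V W p v,
  open U -> U p -> smooth_along f U V -> smooth_along f U W ->
  D p v (fun q => V q + W q) = D p v V + D p v W.
Hypothesis D_leibniz : forall (U : set N) (phi : N -> R) V p v,
  open U -> U p -> smooth_fun U phi -> smooth_along f U V ->
  D p v (fun q => phi q *: V q) =
    (@tderive R n N R^o phi p v : R) *: V p + phi p *: D p v V.
Hypothesis D_local : forall (U : set N) V W p v,
  open U -> U p -> smooth_along f U V -> smooth_along f U W ->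
  (forall q, U q -> V q = W q) -> D p v V = D p v W.

Lemma connection_zero p v : D p v (fun=> 0) = 0.
Proof.
have H := D_leibniz v openT (I : [set: N] p) (@smooth_fun_cst _ _ N setT 0)
  (smooth_along0 fS openT).
have E : (fun q : N => (cst 0 q : R) *: (0 : 'rV[R]_m)) = (fun=> 0).
  by apply/funext => q; rewrite scaler0.
by rewrite E in H; rewrite H /= scale0r scaler0 addr0.
Qed.

Lemma connection_sum (I : Type) (r : seq I) (P : pred I) (U : set N)
    (V : I -> N -> 'rV[R]_m) p v :
  open U -> U p -> (forall i, P i -> smooth_along f U (V i)) ->
  D p v (fun q => \sum_(i <- r | P i) V i q) = \sum_(i <- r | P i) D p v (V i).
Proof.
move=> oU Up sV; elim: r => [|i r IH].
  rewrite big_nil -[RHS](connection_zero p v).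
  by congr (D p v _); apply/funext => q; rewrite big_nil.
rewrite big_cons; case: ifP => Pi; last first.
  by rewrite -IH; congr (D p v _); apply/funext => q; rewrite big_cons Pi.
rewrite -IH -(D_add v oU Up (sV i Pi)); last exact: (smooth_along_sum fS).
by congr (D p v _); apply/funext => q; rewrite big_cons Pi.
Qed.

Lemma connection_lincomb (I : Type) (r : seq I) (U : set N)
    (phi : I -> N -> R) (V : I -> N -> 'rV[R]_m) p v :
  open U -> U p -> (forall i, smooth_fun U (phi i)) ->
  (forall i, smooth_along f U (V i)) ->
  D p v (fun q => \sum_(i <- r) phi i q *: V i q) =
  \sum_(i <- r) ((@tderive R n N R^o (phi i) p v : R) *: V i p + phi i p *: D p v (V i)).
Proof.
move=> oU Up sphi sV; rewrite (@connection_sum I r xpredT U (fun i q => phi i q *: V i q)) //.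
  by apply: eq_bigr => i _; rewrite (D_leibniz v oU Up (sphi i) (sV i)).
by move=> i _; exact: (smooth_alongZ fS oU (sphi i) (sV i)).
Qed.

Lemma coord_frame_smooth (c' : chart R M m) a : atlas c' ->
  smooth_along f (f @^-1` chart_dom c') (coord_field c' a \o f).
Proof.
move=> ac'; apply: (smooth_field_comp fS (@chart_dom_open _ _ _ c')).
exact: coord_field_smooth.
Qed.

Lemma along_expand U V (c' : chart R M m) : open U -> smooth_along f U V -> atlas c' ->
  smooth_along f (U `&` f @^-1` chart_dom c')
    (fun q => \sum_a tangent_coord c' (f q) (V q) 0 a *: (coord_field c' a \o f) q).
Proof.
move=> oU sV ac'; have oW := preimage_chart_open fS c' oU.
apply: (smooth_along_ext fS oW (V1 := V)).
  by move=> q [_ c'q]; exact: coord_field_expand.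
by apply: (smooth_alongS fS oW oU) sV => q [].
Qed.

(** The coordinate expression of covariant differentiation. Its assumptions are additivity, the
    Leibniz rule and locality, so that it already applies to the operator from which the pull-back
    connection is built, before that operator is known to preserve smoothness. *)
Lemma connection_coord U V (c' : chart R M m) p v : open U -> smooth_along f U V ->
  atlas c' -> U p -> chart_dom c' (f p) ->
  D p v V = \sum_a
    ((@tderive R n N R^o (fun q => tangent_coord c' (f q) (V q) 0 a) p v : R)
       *: coord_field c' a (f p) +
     tangent_coord c' (f p) (V p) 0 a *: D p v (coord_field c' a \o f)).
Proof.
move=> oU sV ac' Up c'p; have oW := preimage_chart_open fS c' oU.
have Wp : (U `&` f @^-1` chart_dom c') p by split.
have sVW : smooth_along f (U `&` f @^-1` chart_dom c') V.
  by apply: (smooth_alongS fS oW oU) sV => q [].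
rewrite (D_local v oW Wp sVW (along_expand oU sV ac')); last first.
  by move=> q [_ c'q]; exact: coord_field_expand.
apply: (connection_lincomb (index_enum 'I_m) v oW Wp
  (phi := fun a q => tangent_coord c' (f q) (V q) 0 a)
  (V := fun a => coord_field c' a \o f)).
- by move=> a; exact: (smooth_along_coord fS a oU sV ac').
- move=> a; have oP := smooth_map_preimage_open fS (@chart_dom_open _ _ _ c').
  by apply: (smooth_alongS fS oW oP _ (coord_frame_smooth a ac')) => q [].
Qed.

End local_formula.

Section metric_along.
Context (R : realType) (n m : nat) (N : manifold R n) (M : manifold R m) (f : N -> M).
Hypothesis fS : smooth_map f.
Variable g : M -> 'rV[R]_m -> 'rV[R]_m -> R.
Hypothesis gM : riemannian_metric g.

Lemma metric_lincomb (I : Type) (r : seq I) p (a : I -> R) (u : I -> 'rV[R]_m) w :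
  g p (\sum_(i <- r) a i *: u i) w = \sum_(i <- r) a i * g p (u i) w.
Proof.
exact: (linfun_lincomb (V := 'rV[R]_m) (W := R^o) (L := fun x => g p x w)
  (fun a u v => metric_linear gM p a u v w)).
Qed.

Lemma metric_lincomb_r (I : Type) (r : seq I) p (a : I -> R) (u : I -> 'rV[R]_m) w :
  g p w (\sum_(i <- r) a i *: u i) = \sum_(i <- r) a i * g p w (u i).
Proof.
rewrite (Defs.metric_sym gM) metric_lincomb.
by apply: eq_bigr => i _; rewrite (Defs.metric_sym gM).
Qed.

Lemma metricD p u v w : g p (u + v) w = g p u w + g p v w.
Proof. by have := metric_linear gM p 1 u v w; rewrite scale1r mul1r. Qed.

Lemma metricZ p a u w : g p (a *: u) w = a * g p u w.
Proof.
exact: (linfunZ (V := 'rV[R]_m) (W := R^o) (L := fun x => g p x w)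
  (fun a u v => metric_linear gM p a u v w)).
Qed.

Lemma metricB p u v w : g p (u - v) w = g p u w - g p v w.
Proof. by rewrite metricD -scaleN1r metricZ mulN1r. Qed.

(** The smoothness axiom of g concerns fields on M; sections along f are expanded in pulled-back
    coordinate fields, whose products are functions on M composed with f. *)
Lemma metric_along_smooth U V W : open U -> smooth_along f U V -> smooth_along f U W ->
  smooth_fun U (fun q => g (f q) (V q) (W q)).
Proof.
move=> oU sV sW; apply: smooth_fun_local => p Up.
pose c' := chart_at (f p); have ac' : atlas c' := chart_at_atlas (f p).
have oX := preimage_chart_open fS c' oU.
exists (U `&` f @^-1` chart_dom c'); split; [exact: oX|by split; [|exact: chart_at_dom]|].
have sG a b : smooth_fun (U `&` f @^-1` chart_dom c')
    (fun q => g (f q) (coord_field c' a (f q)) (coord_field c' b (f q))).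
  have oc : open (chart_dom c') := @chart_dom_open _ _ _ c'.
  have := smooth_fun_comp fS oc (metric_smooth gM oc
    (coord_field_smooth a ac') (coord_field_smooth b ac')).
  by apply: smooth_funS => q [].
have sT : smooth_fun (U `&` f @^-1` chart_dom c') (fun q =>
    \sum_a tangent_coord c' (f q) (V q) 0 a * (\sum_b tangent_coord c' (f q) (W q) 0 b *
      g (f q) (coord_field c' a (f q)) (coord_field c' b (f q)))).
  apply: (smooth_fun_sum _ oX) => a _; apply: (smooth_funM oX).
    exact: (smooth_along_coord fS a oU sV ac').
  apply: (smooth_fun_sum _ oX) => b _; apply: (smooth_funM oX).
    exact: (smooth_along_coord fS b oU sW ac').
  exact: sG.
apply: (smooth_fun_ext oX _ sT) => q [_ c'q].
rewrite [in RHS](coord_field_expand (V q) ac' c'q) metric_lincomb.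
apply: eq_bigr => a _; congr (_ * _).
by rewrite [in RHS](coord_field_expand (W q) ac' c'q) metric_lincomb_r.
Qed.

End metric_along.

Lemma mulr_swap (R : comPzRingType) (x y s t : R) : s = t -> x * (y * s) = y * (x * t).
Proof. by move=> ->; exact: mulrCA. Qed.

Lemma sub_common_sum (R : comPzRingType) n (D a b : 'I_n -> R) S :
  (\sum_i D i * a i + S) - (\sum_i D i * b i + S) = \sum_i (a i - b i) * D i.
Proof.
rewrite opprD addrACA subrr addr0 -sumrB; apply: eq_bigr => i _.
by rewrite -mulrBr mulrC.
Qed.

Lemma sub_common_sumZ (R : pzRingType) (V : lmodType R) n (e : 'I_n -> V)
    (a b : 'I_n -> R) S :
  (\sum_i a i *: e i + S) - (\sum_i b i *: e i + S) = \sum_i (a i - b i) *: e i.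
Proof.
rewrite opprD addrACA subrr addr0 -sumrB; apply: eq_bigr => i _.
by rewrite -scalerBl.
Qed.

(** In coordinates each iterated derivative is a term differentiating the components of the inner
    field plus the Hessian of phi on both fields; the Hessian terms cancel by Schwarz. This gives
    access to the bracket independently of the chart that defines it. *)
Lemma lie_bracket_derive (R : realType) n (N : manifold R n) (U : set N)
    (phi : N -> R) (X Y : N -> 'rV[R]_n) p :
  open U -> U p -> smooth_fun U phi -> smooth_field U X -> smooth_field U Y ->
  @tderive _ _ _ R^o (fun q => @tderive _ _ _ R^o phi q (Y q)) p (X p) -
  @tderive _ _ _ R^o (fun q => @tderive _ _ _ R^o phi q (X q)) p (Y p) =
  @tderive _ _ _ R^o phi p (lie_bracket X Y p).
Proof.
move=> oU Up sphi sX sY.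
pose c := chart_at p; have ac : atlas c := chart_at_atlas p.
have cp : chart_dom c p := chart_at_dom p.
have oW : open (U `&` chart_dom c) by apply: openI => //; apply: chart_dom_open.
pose W := U `&` chart_dom c; have Wp : W p by split.
have sphiW : smooth_fun W phi by apply: smooth_funS sphi => q [].
pose ph : 'rV[R]_n -> R^o := phi \o chart_inv c.
have oI : open (chart_image c W) by apply: chart_image_open.
have Ip : chart_image c W (c p) by apply: chart_image_fun.
have Cph k : Ck k (chart_image c W) ph := smooth_fun_Ck k ac sphiW.
pose Dph a q : R := 'D_(delta_mx 0 a) ph (c q).
have sD a : smooth_fun W (Dph a).
  by apply: (smooth_fun_derive_coord a ac oW) => // q [].
have dD a : @mdiff _ _ _ R^o (Dph a) p := smooth_mdiff oW Wp (sD a).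
have dphi q : W q -> @mdiff _ _ _ R^o phi q by move=> Wq; exact: smooth_mdiff oW Wq sphiW.
have step (Z Z' : N -> 'rV[R]_n) : smooth_field U Z ->
  @tderive _ _ _ R^o (fun q => @tderive _ _ _ R^o phi q (Z q)) p (Z' p) =
  \sum_a (Dph a p * tderive (fun q => tangent_coord c q (Z q)) p (Z' p) 0 a) +
  \sum_a \sum_b Z p 0 a * (Z' p 0 b * 'D_(delta_mx 0 b) (fun x => 'D_(delta_mx 0 a) ph x) (c p)).
  move=> sZ.
  have sz a : smooth_fun W (fun q => tangent_coord c q (Z q) 0 a).
    exact: smooth_field_coord.
  have dz a : @mdiff _ _ _ R^o (fun q => tangent_coord c q (Z q) 0 a) p := smooth_mdiff oW Wp (sz a).
  have dzD a : @mdiff _ _ _ R^o (fun q => tangent_coord c q (Z q) 0 a * Dph a q) p.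
    exact: (smooth_mdiff oW Wp (smooth_funM oW (sz a) (sD a))).
  have -> : @tderive _ _ _ R^o (fun q => @tderive _ _ _ R^o phi q (Z q)) p (Z' p) =
     @tderive _ _ _ R^o (fun q => \sum_a tangent_coord c q (Z q) 0 a * Dph a q) p (Z' p).
    apply: tderive_near; apply: (open_near oW Wp) => q Wq.
    have [_ cq] := Wq; rewrite (tderive_chart _ ac cq (dphi q Wq)).
    by rewrite derive_sum_coord //; apply/(mdiffP _ ac cq); exact: dphi.
  rewrite (tderive_fsum _ _ _ dzD) -big_split /=; apply: eq_bigr => a _.
  rewrite (tderive_fM _ (dz a) (dD a)) addrC; congr (_ + _); last first.
    have dzv : mdiff (fun q => tangent_coord c q (Z q)) p by apply: (mdiff_rV _ p).2; exact: dz.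
    exact: (congr1 ( *%R (Dph a p)) (esym (tderive_coord (Z' p) a dzv))).
  rewrite tangent_coord_at -mulr_sumr; congr (_ * _).
  have dDa : differentiable (fun x => 'D_(delta_mx 0 a) ph x) (c p).
    by have [_ /(_ (delta_mx 0 a))/CkS[+ _]] := CkS (Cph 2%N); apply.
  rewrite (tderive_chart _ ac cp (dD a)) tangent_coord_at.
  have -> : 'D_(Z' p) (Dph a \o chart_inv c : _ -> R^o) (c p) =
      'D_(Z' p) (fun x => 'D_(delta_mx 0 a) ph x) (c p).
    apply: near_eq_derive.
    have : nbhs (c p) (chart_image c W) by apply: open_nbhs_nbhs.
    by apply: filterS => x [cx _]; rewrite /Dph /= chart_invK.
  by rewrite (derive_sum_coord _ dDa).
rewrite (step Y X sY) (step X Y sX).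
have -> : \sum_a \sum_b X p 0 a * (Y p 0 b * 'D_(delta_mx 0 b) (fun x => 'D_(delta_mx 0 a) ph x) (c p)) =
  \sum_a \sum_b Y p 0 a * (X p 0 b * 'D_(delta_mx 0 b) (fun x => 'D_(delta_mx 0 a) ph x) (c p)).
  rewrite exchange_big /=; apply: eq_bigr => a _; apply: eq_bigr => b _.
  apply: mulr_swap; exact: (Schwarz_derive _ _ oI Ip (Cph 2%N)).
apply: etrans (sub_common_sum _ _ _ _) _.
apply/esym; apply: etrans (tderive_chart _ ac cp (dphi p Wp)) _.
have dph : differentiable ph (c p) by apply: (mdiffP _ ac cp).1; exact: dphi.
rewrite tangent_coord_at; apply: etrans (derive_sum_coord _ dph) _.
by apply: eq_bigr => a _; rewrite /lie_bracket !mxE.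
Qed.

(** The bracket at p is computed in [chart_at p], where these fields have constant components near
    p. *)
Lemma lie_bracket_coord_field (R : realType) n (M : manifold R n) (p : M) a b :
  lie_bracket (coord_field (chart_at p) a) (coord_field (chart_at p) b) p = 0.
Proof.
have H d v : tderive (fun q => tangent_coord (chart_at p) q (coord_field (chart_at p) d q)) p v = 0.
  rewrite -(tderive_cst (delta_mx 0 d : 'rV[R]_n) p v).
  apply: tderive_near; apply: (open_near (@chart_dom_open _ _ _ (chart_at p)) (chart_at_dom p)).
  by move=> q cq; apply: coord_fieldK => //; exact: chart_at_atlas.
apply/eqP; rewrite /lie_bracket subr_eq0; apply/eqP.
exact: etrans (H b _) (esym (H a _)).
Qed.

Section pullback.
Context (R : realType) (n m : nat) (N : manifold R n) (M : manifold R m) (f : N -> M).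
Hypothesis fS : smooth_map f.
Variable nabla : M -> 'rV[R]_m -> (M -> 'rV[R]_m) -> 'rV[R]_m.
Variable nablaf : N -> 'rV[R]_n -> (N -> 'rV[R]_m) -> 'rV[R]_m.
Hypothesis nablaP : affine_connection nabla.
Hypothesis nablafP : pullback_connection f nabla nablaf.

Lemma pullback_coord_field (c' : chart R M m) a p v : atlas c' -> chart_dom c' (f p) ->
  nablaf p v (coord_field c' a \o f) = nabla (f p) (tmap f p v) (coord_field c' a).
Proof.
move=> ac' c'p; have [_ H] := nablafP.
exact: (H _ _ p v (@chart_dom_open _ _ _ c') c'p (coord_field_smooth a ac')).
Qed.

Lemma pullback_coord U V (c' : chart R M m) p v : open U -> smooth_along f U V ->
  atlas c' -> U p -> chart_dom c' (f p) ->
  nablaf p v V = \sum_a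
    ((@tderive R n N R^o (fun q => tangent_coord c' (f q) (V q) 0 a) p v : R)
       *: coord_field c' a (f p) +
     tangent_coord c' (f p) (V p) 0 a *: nabla (f p) (tmap f p v) (coord_field c' a)).
Proof.
move=> oU sV ac' Up c'p; have [nf _] := nablafP.
rewrite (connection_coord fS (connection_add nf) (connection_leibniz nf)
  (connection_local nf) v oU sV ac' Up c'p).
by apply: eq_bigr => a _; rewrite pullback_coord_field.
Qed.

Lemma connection_lincomb_vec p (I : Type) (r : seq I) (a : I -> R)
    (u : I -> 'rV[R]_m) U Y : open U -> U p -> smooth_field U Y ->
  nabla p (\sum_(i <- r) a i *: u i) Y = \sum_(i <- r) a i *: nabla p (u i) Y.
Proof.
move=> oU Up sY.
exact: (linfun_lincomb (L := fun w => nabla p w Y)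
  (fun a u v => connection_linear nablaP a u v oU Up sY)).
Qed.

Section metric.
Variable g : M -> 'rV[R]_m -> 'rV[R]_m -> R.
Hypothesis gM : riemannian_metric g.
Hypothesis nabla_metric : forall (U : set M) X Y p v,
  open U -> U p -> smooth_field U X -> smooth_field U Y ->
  @tderive R m M R^o (fun q => g q (X q) (Y q)) p v =
    g p (nabla p v X) (Y p) + g p (X p) (nabla p v Y).

Let compatible p v (V W : N -> 'rV[R]_m) : Prop :=
  @tderive R n N R^o (fun q => g (f q) (V q) (W q)) p v =
    g (f p) (nablaf p v V) (W p) + g (f p) (V p) (nablaf p v W).

Let compatible_sym p v V W : compatible p v V W -> compatible p v W V.
Proof.
rewrite /compatible => H; rewrite addrC !(Defs.metric_sym gM (f p) _ (V p)).
rewrite (Defs.metric_sym gM _ (W p)) -H; congr (tderive _ p v).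
by apply/funext => q; rewrite (Defs.metric_sym gM).
Qed.

Let compatible_lincomb p v U (phi : 'I_m -> N -> R) V W : open U -> U p ->
  (forall i, smooth_fun U (phi i)) -> (forall i, smooth_along f U (V i)) ->
  smooth_along f U W -> (forall i, compatible p v (V i) W) ->
  compatible p v (fun q => \sum_i phi i q *: V i q) W.
Proof.
move=> oU Up sphi sV sW H; have [nf _] := nablafP.
have dphi i : @mdiff _ _ _ R^o (phi i) p := smooth_mdiff oU Up (sphi i).
have sg i := metric_along_smooth fS gM oU (sV i) sW.
have dg i : @mdiff _ _ _ R^o (fun q => g (f q) (V i q) (W q)) p := smooth_mdiff oU Up (sg i).
have dpg i : @mdiff _ _ _ R^o (fun q => phi i q * g (f q) (V i q) (W q)) p.
  exact: (smooth_mdiff oU Up (smooth_funM oU (sphi i) (sg i))).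
rewrite /compatible.
have -> : (fun q => g (f q) (\sum_i phi i q *: V i q) (W q)) =
    (fun q => \sum_i phi i q * g (f q) (V i q) (W q)).
  by apply/funext => q; rewrite (metric_lincomb gM).
rewrite (tderive_fsum _ _ v dpg).
rewrite (connection_lincomb fS (connection_add nf) (connection_leibniz nf) _ v oU Up sphi sV).
rewrite (metric_lincomb gM).
rewrite (linfun_sum (V := 'rV[R]_m) (W := R^o) (L := fun x => g (f p) x (W p))
  (fun a u v => metric_linear gM (f p) a u v (W p))) -big_split /=.
apply: eq_bigr => i _.
rewrite tderive_fM // (H i) (metricD gM) !(metricZ gM).
by move: (g (f p) (nablaf p v _) _) (g (f p) (V i p) (nablaf p v W)) => x y; ring.
Qed.

(** For pulled-back coordinate fields the identity is the one on M composed with f. By the Leibniz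
    rule it passes to combinations with function coefficients, in one argument and then, by
    symmetry, in the other. *)
Lemma pullback_metric U V W p v : open U -> U p ->
  smooth_along f U V -> smooth_along f U W ->
  @tderive R n N R^o (fun q => g (f q) (V q) (W q)) p v =
    g (f p) (nablaf p v V) (W p) + g (f p) (V p) (nablaf p v W).
Proof.
move=> oU Up sV sW; have [nf _] := nablafP.
pose c' := chart_at (f p); have ac' : atlas c' := chart_at_atlas (f p).
have c'p : chart_dom c' (f p) := chart_at_dom (f p).
have oX := preimage_chart_open fS c' oU.
pose X := U `&` f @^-1` chart_dom c'.
have Xp : X p by split.
have oc : open (chart_dom c') := @chart_dom_open _ _ _ c'.
have sE a : smooth_along f X (coord_field c' a \o f).
  by apply: (smooth_alongS fS oX (smooth_map_preimage_open fS oc) _ (coord_frame_smooth fS a ac')) => q [].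
have base a b : compatible p v (coord_field c' a \o f) (coord_field c' b \o f).
  rewrite /compatible !(pullback_coord_field _ _ ac' c'p) /=.
  rewrite -(nabla_metric _ oc c'p (coord_field_smooth a ac') (coord_field_smooth b ac')).
  have sG := metric_smooth gM oc (coord_field_smooth a ac') (coord_field_smooth b ac').
  exact: (tderive_comp fS v (smooth_mdiff oc c'p sG)).
pose ex (V : N -> 'rV[R]_m) q := \sum_a tangent_coord c' (f q) (V q) 0 a *: (coord_field c' a \o f) q.
have sex V' : smooth_along f U V' -> smooth_along f X (ex V').
  by move=> sV'; exact: (along_expand fS oU sV' ac').
have exE V' q : X q -> V' q = ex V' q by move=> [_ c'q]; exact: coord_field_expand.
have sX V' : smooth_along f U V' -> smooth_along f X V'.
  by apply: (smooth_alongS fS oX oU) => q [].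
have scoord V' : smooth_along f U V' -> forall a,
    smooth_fun X (fun q => tangent_coord c' (f q) (V' q) 0 a).
  by move=> sV' a; exact: (smooth_along_coord fS a oU sV' ac').
have step1 b : compatible p v (ex V) (coord_field c' b \o f).
  exact: (compatible_lincomb oX Xp (scoord V sV) sE (sE b) (fun a => base a b)).
have step2 : compatible p v (ex V) (ex W).
  apply: compatible_sym.
  apply: (compatible_lincomb oX Xp (scoord W sW) sE (sex V sV)) => b.
  exact: compatible_sym (step1 b).
rewrite (connection_local nf v oX Xp (sX V sV) (sex V sV) (exE V)).
rewrite (connection_local nf v oX Xp (sX W sW) (sex W sW) (exE W)).
rewrite (exE V p Xp) (exE W p Xp) -step2.
apply: tderive_near; apply: (open_near oX Xp) => q Xq.
by rewrite -(exE V q Xq) -(exE W q Xq).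
Qed.

End metric.

Section parallel.
Variable F : M -> 'rV[R]_m -> 'rV[R]_m.
Hypothesis FT : tensor11 F.

Let F_linear p a u v : F p (a *: u + v) = a *: F p u + F p v.
Proof. by have [H _] := FT; have := H p; move=> L; rewrite L. Qed.

Lemma tensor_along_smooth U V : open U -> smooth_along f U V ->
  smooth_along f U (fun q => F (f q) (V q)).
Proof.
move=> oU sV; apply: (smooth_along_local fS oU) => p Up.
pose c' := chart_at (f p); have ac' : atlas c' := chart_at_atlas (f p).
have oX := preimage_chart_open fS c' oU.
exists (U `&` f @^-1` chart_dom c').
split; [exact: oX|by split; [|exact: chart_at_dom]|].
have oc : open (chart_dom c') := @chart_dom_open _ _ _ c'.
have sFE a : smooth_along f (U `&` f @^-1` chart_dom c') (fun q => F (f q) (coord_field c' a (f q))).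
  have [_ sF] := FT.
  have H := smooth_field_comp fS oc (sF _ _ oc (coord_field_smooth a ac')).
  by apply: (smooth_alongS fS oX (smooth_map_preimage_open fS oc) _ H) => q [].
apply: (smooth_along_ext fS oX (V1 := fun q => \sum_a tangent_coord c' (f q) (V q) 0 a *:
   F (f q) (coord_field c' a (f q)))).
  move=> q [_ c'q]; rewrite [in RHS](coord_field_expand (V q) ac' c'q).
  by rewrite (linfun_lincomb (F_linear (f q))).
apply: (smooth_along_sum fS); first exact: oX.
move=> a _; apply: (smooth_alongZ fS); [exact: oX| |exact: sFE].
exact: (smooth_along_coord fS a oU sV ac').
Qed.

Hypothesis F_parallel : parallel_tensor nabla F.

(** Once V is expanded in pulled-back coordinate fields, the terms differentiating coefficients
    agree by linearity of F, and the others because F is parallel on M. *)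
Lemma pullback_parallel U V p v : open U -> U p -> smooth_along f U V ->
  nablaf p v (fun q => F (f q) (V q)) = F (f p) (nablaf p v V).
Proof.
move=> oU Up sV; have [nf nfE] := nablafP.
pose c' := chart_at (f p); have ac' : atlas c' := chart_at_atlas (f p).
have c'p : chart_dom c' (f p) := chart_at_dom (f p).
have oX := preimage_chart_open fS c' oU.
pose X := U `&` f @^-1` chart_dom c'.
have Xp : X p by split.
have oc : open (chart_dom c') := @chart_dom_open _ _ _ c'.
have [_ sF] := FT.
have sFE0 a := sF _ _ oc (coord_field_smooth a ac').
have sFE a : smooth_along f X ((fun q => F q (coord_field c' a q)) \o f).
  have H := smooth_field_comp fS oc (sFE0 a).
  by apply: (smooth_alongS fS oX (smooth_map_preimage_open fS oc) _ H) => q [].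
have sphi a : smooth_fun X (fun q => tangent_coord c' (f q) (V q) 0 a).
  exact: (smooth_along_coord fS a oU sV ac').
have E q : X q -> F (f q) (V q) = \sum_a tangent_coord c' (f q) (V q) 0 a *:
    ((fun q => F q (coord_field c' a q)) \o f) q.
  move=> [_ c'q]; rewrite {1}(coord_field_expand (V q) ac' c'q).
  by rewrite (linfun_lincomb (F_linear (f q))).
have sFV : smooth_along f X (fun q => F (f q) (V q)).
  by apply: (smooth_alongS fS oX oU _ (tensor_along_smooth oU sV)) => q [].
have sS : smooth_along f X (fun q => \sum_a tangent_coord c' (f q) (V q) 0 a *:
    ((fun q => F q (coord_field c' a q)) \o f) q).
  exact: (smooth_along_ext fS oX E sFV).
rewrite (connection_local nf v oX Xp sFV sS E).
rewrite (connection_lincomb fS (connection_add nf) (connection_leibniz nf) _ v oX Xp sphi sFE).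
rewrite (pullback_coord v oU sV ac' Up c'p) (linfun_sum (F_linear (f p))).
apply: eq_bigr => a _; rewrite (linfunD (F_linear (f p))) !(linfunZ (F_linear (f p))).
congr (_ *: _ + _ *: _).
rewrite (nfE _ _ p v oc c'p (sFE0 a)); apply/subr0_eq.
exact: (F_parallel _ oc c'p (coord_field_smooth a ac')).
Qed.

End parallel.

(** The image of Y has components Y(f_a), with f_a the coordinates of f. The Leibniz terms give
    X(Y(f_a)) - Y(X(f_a)) = [X, Y](f_a); the terms with derivatives of coordinate fields are
    symmetric, because such fields commute and the torsion on M vanishes. *)
Lemma pullback_torsion U (X Y : N -> 'rV[R]_n) p :
  (forall (A : set M) (X Y : M -> 'rV[R]_m) p,
    open A -> A p -> smooth_field A X -> smooth_field A Y ->
    nabla p (X p) Y - nabla p (Y p) X = lie_bracket X Y p) ->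
  open U -> U p -> smooth_field U X -> smooth_field U Y ->
  nablaf p (X p) (fun q => tmap f q (Y q)) - nablaf p (Y p) (fun q => tmap f q (X q)) =
  tmap f p (lie_bracket X Y p).
Proof.
move=> torsion oU Up sX sY.
pose c' := chart_at (f p); have ac' : atlas c' := chart_at_atlas (f p).
have c'p : chart_dom c' (f p) := chart_at_dom (f p).
have oc : open (chart_dom c') := @chart_dom_open _ _ _ c'.
have oW := preimage_chart_open fS c' oU.
pose W := U `&` f @^-1` chart_dom c'.
have Wp : W p by split.
have sE a := coord_field_smooth a ac'.
have symE a b : nabla (f p) (coord_field c' a (f p)) (coord_field c' b) =
    nabla (f p) (coord_field c' b (f p)) (coord_field c' a).
  apply/subr0_eq; rewrite (torsion _ _ _ _ oc c'p (sE a) (sE b)).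
  exact: lie_bracket_coord_field.
pose F a (q : N) : R := c' (f q) 0 a.
have sF a : smooth_fun W (F a) by apply: smooth_funS (chart_comp_smooth fS ac' a) => q [].
have dF a : @mdiff _ _ _ R^o (F a) p := smooth_mdiff oW Wp (sF a).
have sXW : smooth_field W X by apply: (smooth_alongS (smooth_map_id N) oW oU) sX => q [].
have sYW : smooth_field W Y by apply: (smooth_alongS (smooth_map_id N) oW oU) sY => q [].
have coordE Z q a : W q -> tangent_coord c' (f q) (tmap f q (Z q)) 0 a =
    @tderive _ _ _ R^o (F a) q (Z q).
  move=> [_ c'q]; rewrite tangent_coord_tmap // tderive_coord //.
  exact: chart_comp_mdiff.
have key (Z Z' : N -> 'rV[R]_n) : smooth_field U Z ->
   nablaf p (Z' p) (fun q => tmap f q (Z q)) =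
   \sum_a ((@tderive _ _ _ R^o (fun q => @tderive _ _ _ R^o (F a) q (Z q)) p (Z' p) : R) *:
       coord_field c' a (f p)) +
   \sum_a \sum_b (@tderive _ _ _ R^o (F a) p (Z p) * @tderive _ _ _ R^o (F b) p (Z' p)) *:
       nabla (f p) (coord_field c' b (f p)) (coord_field c' a).
  move=> sZ; rewrite (pullback_coord (Z' p) oU (tmap_smooth fS oU sZ) ac' Up c'p) big_split /=.
  congr (_ + _); apply: eq_bigr => a _.
    congr (_ *: _); apply: tderive_near; apply: (open_near oW Wp) => q Wq.
    exact: coordE.
  rewrite (coordE Z p a Wp) [in X in nabla _ X](coord_field_expand (tmap f p (Z' p)) ac' c'p).
  rewrite (connection_lincomb_vec _ _ _ oc c'p (sE a)) scaler_sumr.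
  by apply: eq_bigr => b _; rewrite scalerA (coordE Z' p b Wp).
rewrite (key Y X sY) (key X Y sX).
have -> : \sum_a \sum_b (@tderive _ _ _ R^o (F a) p (X p) * @tderive _ _ _ R^o (F b) p (Y p)) *:
       nabla (f p) (coord_field c' b (f p)) (coord_field c' a) =
   \sum_a \sum_b (@tderive _ _ _ R^o (F a) p (Y p) * @tderive _ _ _ R^o (F b) p (X p)) *:
       nabla (f p) (coord_field c' b (f p)) (coord_field c' a).
  rewrite exchange_big /=; apply: eq_bigr => a _; apply: eq_bigr => b _.
  by rewrite mulrC symE.
apply: etrans (sub_common_sumZ _ _ _ _) _.
apply/esym; apply: etrans (coord_field_expand (tmap f p (lie_bracket X Y p)) ac' c'p) _.
apply: eq_bigr => a _; apply: (congr1 ( *:%R ^~ _)).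
apply: etrans (coordE (fun=> lie_bracket X Y p) p a Wp) _.
apply/esym; exact: lie_bracket_derive oW Wp (sF a) sXW sYW.
Qed.

End pullback.

(** * The pull-back connection and the formula of Gauss *)

Section pullback_existence.
Context (R : realType) (n m : nat) (N : manifold R n) (M : manifold R m) (f : N -> M).
Hypothesis fS : smooth_map f.
Variable nabla : M -> 'rV[R]_m -> (M -> 'rV[R]_m) -> 'rV[R]_m.
Hypothesis nablaP : affine_connection nabla.

Let scalerDD (x y c1 c2 : R) (E1 E2 : 'rV[R]_m) :
  (x + y) *: E1 + (c1 + c2) *: E2 = x *: E1 + c1 *: E2 + (y *: E1 + c2 *: E2).
Proof. by rewrite !scalerDl addrACA. Qed.

Let scaler_leibniz (a x c y : R) (E1 E2 : 'rV[R]_m) :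
  (a * x + c * y) *: E1 + (a * c) *: E2 = y *: (c *: E1) + a *: (x *: E1 + c *: E2).
Proof. by rewrite scalerDl scalerDr !scalerA (mulrC c) addrCA addrA. Qed.

Let crd (V : N -> 'rV[R]_m) p a (q : N) : R :=
  tangent_coord (chart_at (f p)) (f q) (V q) 0 a.

Let frame (p : N) a : M -> 'rV[R]_m := coord_field (chart_at (f p)) a.

(** The formula which the Leibniz rule forces on the pull-back connection, written at each p in the
    chart chosen at f p. *)
Let D (p : N) (v : 'rV[R]_n) (V : N -> 'rV[R]_m) : 'rV[R]_m :=
  \sum_a ((@tderive R n N R^o (crd V p a) p v : R) *: frame p a (f p) +
          crd V p a p *: nabla (f p) (tmap f p v) (frame p a)).

Let W U (p : N) := U `&` f @^-1` chart_dom (chart_at (f p)).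

Let oW U p : open U -> open (W U p).
Proof. exact: preimage_chart_open. Qed.

Let Wp (U : set N) p : U p -> W U p p.
Proof. by move=> Up; split; [|exact: chart_at_dom]. Qed.

Let scrd U V p a : open U -> smooth_along f U V -> smooth_fun (W U p) (crd V p a).
Proof. by move=> oU sV; exact: (smooth_along_coord fS a oU sV (chart_at_atlas (f p))). Qed.

Let dcrd U V p a : open U -> U p -> smooth_along f U V -> @mdiff _ _ _ R^o (crd V p a) p.
Proof. by move=> oU Up sV; exact: smooth_mdiff (oW p oU) (Wp Up) (scrd p a oU sV). Qed.

Let tc_linear p q a u v : chart_dom (chart_at (f p)) (f q) ->
  tangent_coord (chart_at (f p)) (f q) (a *: u + v) =
  a *: tangent_coord (chart_at (f p)) (f q) u + tangent_coord (chart_at (f p)) (f q) v.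
Proof. by move=> c'q; apply: tangent_coord_linear => //; exact: chart_at_atlas. Qed.

Let crdD V1 V2 p a q : chart_dom (chart_at (f p)) (f q) ->
  crd (fun q => V1 q + V2 q) p a q = crd V1 p a q + crd V2 p a q.
Proof. by move=> c'q; rewrite /crd (linfunD (fun a u v => tc_linear a u v c'q)) mxE. Qed.

Let crdZ phi V p a q : chart_dom (chart_at (f p)) (f q) ->
  crd (fun q => phi q *: V q) p a q = phi q * crd V p a q.
Proof. by move=> c'q; rewrite /crd (linfunZ (fun a u v => tc_linear a u v c'q)) mxE. Qed.

Let D_add (U : set N) V1 V2 p v :
  open U -> U p -> smooth_along f U V1 -> smooth_along f U V2 ->
  D p v (fun q => V1 q + V2 q) = D p v V1 + D p v V2.
Proof.
move=> oU Up s1 s2; rewrite /D -big_split /=; apply: eq_bigr => a _.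
have -> : @tderive R n N R^o (crd (fun q => V1 q + V2 q) p a) p v =
    @tderive R n N R^o (crd V1 p a) p v + @tderive R n N R^o (crd V2 p a) p v.
  apply: etrans (tderive_fD v (dcrd a oU Up s1) (dcrd a oU Up s2)).
  by apply: tderive_near; apply: (open_near (oW p oU) (Wp Up)) => q [_ c'q]; exact: crdD.
by rewrite (crdD V1 V2 a (chart_at_dom (f p))); exact: scalerDD.
Qed.

Let D_leibniz (U : set N) (phi : N -> R) V p v :
  open U -> U p -> smooth_fun U phi -> smooth_along f U V ->
  D p v (fun q => phi q *: V q) =
    (@tderive R n N R^o phi p v : R) *: V p + phi p *: D p v V.
Proof.
move=> oU Up sphi sV; have dphi := smooth_mdiff oU Up sphi.
rewrite [in RHS](coord_field_expand (V p) (chart_at_atlas (f p)) (chart_at_dom (f p))).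
rewrite /D !scaler_sumr -big_split /=; apply: eq_bigr => a _.
have -> : @tderive R n N R^o (crd (fun q => phi q *: V q) p a) p v =
    phi p * @tderive R n N R^o (crd V p a) p v + crd V p a p * @tderive R n N R^o phi p v.
  apply: etrans (tderive_fM v dphi (dcrd a oU Up sV)).
  by apply: tderive_near; apply: (open_near (oW p oU) (Wp Up)) => q [_ c'q]; exact: crdZ.
by rewrite (crdZ phi V a (chart_at_dom (f p))); exact: scaler_leibniz.
Qed.

Let D_local (U : set N) V1 V2 p v :
  open U -> U p -> smooth_along f U V1 -> smooth_along f U V2 ->
  (forall q, U q -> V1 q = V2 q) -> D p v V1 = D p v V2.
Proof.
move=> oU Up _ _ E; rewrite /D; apply: eq_bigr => a _.
have -> : @tderive R n N R^o (crd V1 p a) p v = @tderive R n N R^o (crd V2 p a) p v.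
  by apply: tderive_near; apply: (open_near oU Up) => q Uq; rewrite /crd E.
by rewrite /crd E.
Qed.

Let D_linear (U : set N) V p a (u v : 'rV[R]_n) :
  open U -> U p -> smooth_along f U V ->
  D p (a *: u + v) V = a *: D p u V + D p v V.
Proof.
move=> oU Up sV; rewrite /D scaler_sumr -big_split /=; apply: eq_bigr => b _.
rewrite (tderive_linear _ _ _ (dcrd b oU Up sV)) (tmap_linear fS).
rewrite (connection_linear nablaP _ _ _ (@chart_dom_open _ _ _ (chart_at (f p))) (chart_at_dom (f p))
  (coord_field_smooth b (chart_at_atlas (f p)))).
rewrite scalerDl !scalerDr !scalerA (mulrC (crd V p b p)) addrACA.
by congr (_ + _ + (_ + _)).
Qed.

(** The covariant derivative on M has the same coordinate expression; the chain rule identifies the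
    derivatives of the components. *)
Let D_pullback (U : set M) (Y : M -> 'rV[R]_m) p v :
  open U -> U (f p) -> smooth_field U Y ->
  D p v (Y \o f) = nabla (f p) (tmap f p v) Y.
Proof.
move=> oU Up sY; have idS := smooth_map_id M.
pose c' := chart_at (f p); have ac' : atlas c' := chart_at_atlas (f p).
have c'p : chart_dom c' (f p) := chart_at_dom (f p).
apply/esym; apply: etrans (connection_coord idS (connection_add nablaP)
  (connection_leibniz nablaP) (connection_local nablaP) _ oU sY ac' Up c'p) _.
apply: eq_bigr => a _.
have sc := smooth_field_coord a oU sY ac'.
have oX : open (U `&` chart_dom c') by apply: openI => //; apply: chart_dom_open.
exact: (congr1 (fun x : R => x *: _ + _)
  (esym (tderive_comp fS v (smooth_mdiff oX (conj Up c'p) sc)))).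
Qed.

Let D_smooth (U : set N) X V :
  open U -> smooth_field U X -> smooth_along f U V ->
  smooth_along f U (fun q => D q (X q) V).
Proof.
move=> oU sX sV; apply: (smooth_along_local fS oU) => p Up.
pose c' := chart_at (f p); have ac' : atlas c' := chart_at_atlas (f p).
have oX := oW p oU; have oc : open (chart_dom c') := @chart_dom_open _ _ _ c'.
exists (W U p); split; [exact: oX|exact: Wp|].
have sE a := coord_field_smooth a ac'.
have sfX : smooth_along f U (fun q => tmap f q (X q)) := tmap_smooth fS oU sX.
have sXW : smooth_field (W U p) X.
  by apply: (smooth_alongS (smooth_map_id N) oX oU) sX => q [].
(* The chart used by [D] changes with q; the coordinate formula rewrites all nearby values in the
   single chart c', where smoothness can be read off. *)
have DE q : W U p q -> D q (X q) V = \sum_a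
    ((@tderive R n N R^o (crd V p a) q (X q) : R) *: (coord_field c' a \o f) q +
     crd V p a q *: (\sum_b crd (fun q => tmap f q (X q)) p b q *:
        ((fun q => nabla q (coord_field c' b q) (coord_field c' a)) \o f) q)).
  move=> [Uq c'q].
  apply: etrans (connection_coord fS D_add D_leibniz D_local (X q) oU sV ac' Uq c'q) _.
  apply: eq_bigr => a _; congr (_ + _ *: _).
  apply: etrans (D_pullback (X q) oc c'q (sE a)) _.
  rewrite {1}(coord_field_expand (tmap f q (X q)) ac' c'q).
  exact: (connection_lincomb_vec nablaP _ _ _ oc c'q (sE a)).
have sub q : W U p q -> (f @^-1` chart_dom c') q by case.
have oP := smooth_map_preimage_open fS oc.
apply: (smooth_along_ext fS oX (fun q Wq => esym (DE q Wq))).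
apply: (smooth_along_sum fS); first exact: oX.
move=> a _; apply: (smooth_alongD fS); first exact: oX.
  apply: (smooth_alongZ fS); first exact: oX.
    exact: (tderive_field_smooth oX (scrd p a oU sV) sXW).
  exact: (smooth_alongS fS oX oP sub (coord_frame_smooth fS a ac')).
apply: (smooth_alongZ fS); first exact: oX.
  exact: scrd.
apply: (smooth_along_sum fS); first exact: oX.
move=> b _; apply: (smooth_alongZ fS); first exact: oX.
  exact: (scrd p b oU sfX).
have sN := connection_smooth nablaP oc (sE b) (sE a).
exact: (smooth_alongS fS oX oP sub (smooth_field_comp fS oc sN)).
Qed.

Lemma pullback_connection_exists : exists nablaf, pullback_connection f nabla nablaf.
Proof.
exists D; split; last exact: D_pullback.
by split; [exact: D_linear|exact: D_add|exact: D_leibniz|exact: D_local|exact: D_smooth].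
Qed.

End pullback_existence.

Lemma subr_swap (V : zmodType) (a b c d : V) : a - c = b - d -> a - b = c - d.
Proof.
move=> H; have -> : a = b - d + c by rewrite -H subrK.
by rewrite addrAC (addrAC b) subrr add0r addrC.
Qed.

Lemma addr_swap (V : zmodType) (a b c d : V) : a + b = c + d -> a - c = - (b - d).
Proof. by move=> H; apply/eqP; rewrite opprB subr_eq addrAC (addrC d) -H addrK. Qed.

Lemma opp_cycle (V : zmodType) (a b c : V) : a = - b -> b = - c -> c = - a -> a = - a.
Proof. by move=> -> -> {1}->; rewrite !opprK. Qed.

Section gauss.
Context (R : realType) (n m : nat) (N : manifold R n) (M : manifold R m) (f : N -> M).
Hypothesis fI : immersed_submanifold f.
Variable g : M -> 'rV[R]_m -> 'rV[R]_m -> R.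
Hypothesis gM : riemannian_metric g.

Let fS : smooth_map f := submanifold_smooth fI.

Lemma induced_metric_riemannian : riemannian_metric (induced_metric f g).
Proof.
split.
- move=> p a u v w; rewrite /induced_metric (tmap_linear fS).
  exact: (metric_linear gM).
- by move=> p u v; exact: (Defs.metric_sym gM).
- move=> p u u0; apply: (metric_pos gM); apply: contra_neq u0 => H.
  by apply: (submanifold_immersion fI (p := p)); rewrite H (linfun0 (tmap_linear fS p)).
- move=> U X Y oU sX sY.
  exact: (metric_along_smooth fS gM oU (tmap_smooth fS oU sX) (tmap_smooth fS oU sY)).
Qed.

Variable nabla : M -> 'rV[R]_m -> (M -> 'rV[R]_m) -> 'rV[R]_m.
Variable nablaf : N -> 'rV[R]_n -> (N -> 'rV[R]_m) -> 'rV[R]_m.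
Variable nablaN : N -> 'rV[R]_n -> (N -> 'rV[R]_n) -> 'rV[R]_n.
Hypothesis nabla_lc : levi_civita g nabla.
Hypothesis nablafP : pullback_connection f nabla nablaf.
Hypothesis nablaN_lc : levi_civita (induced_metric f g) nablaN.

Let nablaP : affine_connection nabla := levi_civita_connection nabla_lc.

(** The trilinear expression g(h(X, Y), Z) is symmetric in X and Y, both connections being torsion
    free, and skew in Y and Z, both being metric; such an expression vanishes, as in the uniqueness
    of the Levi-Civita connection. *)
Lemma second_fundamental_form_normal U X Y p w : open U -> U p ->
  smooth_field U X -> smooth_field U Y ->
  g (f p) (second_fundamental_form f nablaN nablaf X Y p) (tmap f p w) = 0.
Proof.
move=> oU Up sX sY; pose A X Y Z : R :=
  g (f p) (second_fundamental_form f nablaN nablaf X Y p) (tmap f p (Z p)).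
have [Z0 [sZ0 Zp]] := coord_fields_value p w.
pose c := chart_at p; pose V := U `&` chart_dom c.
have oV : open V by apply: openI => //; apply: chart_dom_open.
have Vp : V p by split; [|exact: chart_at_dom].
have idS := smooth_map_id N.
have sXV : smooth_field V X by apply: (smooth_alongS idS oV oU) sX => q [].
have sYV : smooth_field V Y by apply: (smooth_alongS idS oV oU) sY => q [].
have sZV : smooth_field V Z0.
  by apply: (smooth_alongS idS oV (@chart_dom_open _ _ _ c)) sZ0 => q [].
have symA X1 Y1 Z1 : smooth_field V X1 -> smooth_field V Y1 -> A X1 Y1 Z1 = A Y1 X1 Z1.
  move=> s1 s2; rewrite /A; apply: (congr1 (fun x => g (f p) x (tmap f p (Z1 p)))).
  rewrite /second_fundamental_form.
  have T1 := pullback_torsion fS nablaP nablafP (levi_civita_torsion nabla_lc) oV Vp s1 s2.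
  have T2 := levi_civita_torsion nablaN_lc oV Vp s1 s2.
  have T3 := etrans T1 (etrans (congr1 (tmap f p) (esym T2)) (linfunB (tmap_linear fS p) _ _)).
  exact: subr_swap T3.
have skewA X1 Y1 Z1 : smooth_field V Y1 -> smooth_field V Z1 -> A X1 Y1 Z1 = - A X1 Z1 Y1.
  move=> s2 s3.
  have M1 := pullback_metric fS nablafP gM (levi_civita_metric nabla_lc) (X1 p) oV Vp
    (tmap_smooth fS oV s2) (tmap_smooth fS oV s3).
  have M2 := levi_civita_metric nablaN_lc (X1 p) oV Vp s2 s3.
  have gC := Defs.metric_sym gM (f p) (tmap f p (Y1 p)).
  have M3 := etrans (esym (etrans M1 (congr1 (fun x => _ + x) (gC _))))
    (etrans M2 (congr1 (fun x => _ + x) (gC _))).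
  apply: etrans (metricB gM _ _ _ _) _.
  apply: etrans (addr_swap M3) _.
  exact: (congr1 -%R (esym (metricB gM _ _ _ _))).
have A0 : A X Y Z0 = - A X Y Z0.
  have E1 : A X Y Z0 = - A Z0 X Y := etrans (skewA X Y Z0 sYV sZV) (congr1 -%R (symA X Z0 Y sXV sZV)).
  have E2 : A Z0 X Y = - A Y Z0 X := etrans (skewA Z0 X Y sXV sYV) (congr1 -%R (symA Z0 Y X sZV sYV)).
  have E3 : A Y Z0 X = - A X Y Z0 := etrans (skewA Y Z0 X sZV sXV) (congr1 -%R (symA Y X Z0 sYV sXV)).
  exact: opp_cycle E1 E2 E3.
have {A0} : A X Y Z0 = 0.
  move/eqP: A0; rewrite -addr_eq0 -mulr2n mulrn_eq0 /= => /eqP.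
  exact.
by rewrite /A Zp.
Qed.

End gauss.

(** * Distributions and their leaves *)

Lemma unitmx_inj (R : fieldType) k (A : 'M[R]_k) :
  (forall y : 'rV[R]_k, y *m A = 0 -> y = 0) -> A \in unitmx.
Proof.
move=> H; rewrite -row_free_unit -kermx_eq0; apply/rowV0P => y /sub_kermxP.
exact: H.
Qed.

Section frames.
Context (R : realType) (n : nat) (N : manifold R n).
Implicit Types (D : N -> set 'rV[R]_n).

Record local_frame k D (U : set N) (E : 'I_k -> N -> 'rV[R]_n) : Prop := {
  frame_open : open U;
  frame_smooth : forall i, smooth_field U (E i);
  frame_free : forall q, U q ->
    forall z : 'rV[R]_k, \sum_i z 0 i *: E i q = 0 -> z = 0;
  frame_in : forall q, U q -> forall z : 'rV[R]_k, D q (\sum_i z 0 i *: E i q);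
  frame_span : forall q, U q -> forall u, D q u ->
    exists z : 'rV[R]_k, u = \sum_i z 0 i *: E i q }.

Lemma distribution_frame D : tangent_distribution D ->
  exists k, forall p, exists U (E : 'I_k -> N -> 'rV[R]_n), U p /\ local_frame D U E.
Proof.
move=> [k H]; exists k => p; have [U [E [oU Up sE HE]]] := H p.
exists U, E; split=> //; split=> // q Uq; have [fE DE] := HE q Uq.
- move=> z z0; apply/rowP => i; rewrite mxE.
  have /freeP := fE : free (mktuple (fun i => E i q)); apply.
  by rewrite -[RHS]z0; apply: eq_bigr => l _; rewrite -tnth_nth tnth_mktuple.
- move=> z; rewrite DE /=; apply: memv_suml => i _; apply: memvZ.
  by apply: memv_span; apply: map_f; rewrite mem_enum.
- move=> u; rewrite DE /= => uD.
  have uD' : u \in <<(mktuple (fun i => E i q))>>%VS by [].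
  exists (\row_i coord (mktuple (fun i => E i q)) i u).
  rewrite {1}(coord_span uD'); apply: eq_bigr => l _.
  by rewrite mxE -tnth_nth tnth_mktuple.
Qed.

Lemma local_frameS k D U W (E : 'I_k -> N -> 'rV[R]_n) : open W -> W `<=` U ->
  local_frame D U E -> local_frame D W E.
Proof.
move=> oW WU [oU sE fE iE spE]; split.
- exact: oW.
- by move=> i; apply: (smooth_alongS (smooth_map_id N) oW oU WU (sE i)).
- by move=> q /WU; exact: fE.
- by move=> q /WU; exact: iE.
- by move=> q /WU; exact: spE.
Qed.

Lemma frame_mem k D U (E : 'I_k -> N -> 'rV[R]_n) i q :
  local_frame D U E -> U q -> D q (E i q).
Proof.
move=> [_ _ _ iE _] Uq; have := iE q Uq (delta_mx 0 i).
rewrite (bigD1 i) //= mxE !eqxx scale1r big1 ?addr0 // => l li.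
by rewrite mxE (negbTE li) andbF scale0r.
Qed.

Lemma distribution0 D q : tangent_distribution D -> D q 0.
Proof.
move=> /distribution_frame[k /(_ q)[U [E [Uq [_ _ _ iE _]]]]].
have := iE q Uq 0; rewrite big1 // => i _; by rewrite mxE scale0r.
Qed.

Lemma distributionZ D q a u : tangent_distribution D -> D q u -> D q (a *: u).
Proof.
move=> /distribution_frame[k /(_ q)[U [E [Uq [_ _ _ iE spE]]]]] /(spE q Uq)[z ->].
have := iE q Uq (a *: z); rewrite scaler_sumr.
by under eq_bigr do rewrite mxE -scalerA.
Qed.

(** If E2 = A E, independence of E2 makes the kernel of the square matrix A trivial; A is then
    invertible and E2 spans D as well. *)
Lemma frame_change k D U (E E2 : 'I_k -> N -> 'rV[R]_n) : local_frame D U E ->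
  (forall i, smooth_field U (E2 i)) -> (forall q, U q -> forall i, D q (E2 i q)) ->
  (forall q, U q -> forall z : 'rV[R]_k, \sum_i z 0 i *: E2 i q = 0 -> z = 0) ->
  local_frame D U E2.
Proof.
move=> [oU sE fE iE spE] sE2 DE2 fE2.
have HA q : U q -> exists A : 'M[R]_k, forall i, E2 i q = \sum_j A i j *: E j q.
  move=> Uq; have /choice[a Ha] : forall i, exists z : 'rV[R]_k, E2 i q = \sum_j z 0 j *: E j q.
    by move=> i; apply: spE => //; apply: DE2.
  by exists (\matrix_(i, j) a i 0 j) => i; rewrite Ha; apply: eq_bigr => j _; rewrite mxE.
have comb q (A : 'M[R]_k) (z : 'rV[R]_k) : (forall i, E2 i q = \sum_j A i j *: E j q) ->
    \sum_i z 0 i *: E2 i q = \sum_j (z *m A) 0 j *: E j q.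
  move=> EA; under eq_bigr do rewrite EA scaler_sumr.
  rewrite exchange_big; apply: eq_bigr => j _ /=; rewrite mxE scaler_suml.
  by apply: eq_bigr => i _; rewrite scalerA.
split=> // q Uq; have [A EA] := HA q Uq.
  by move=> z; rewrite (comb _ _ _ EA); exact: iE.
move=> u /(spE q Uq)[z ->].
have Au : A \in unitmx.
  apply: unitmx_inj => y yA; apply: (fE2 q Uq); rewrite (comb _ _ _ EA) yA.
  by rewrite big1 // => j _; rewrite mxE scale0r.
by exists (z *m invmx A); rewrite (comb _ _ _ EA) mulmxKV.
Qed.

(** Turns local sections of D into global ones at the price of a factor that is nonzero at p. The
    same phi serves all sections over U. *)
Lemma bump_section k D U (E : 'I_k -> N -> 'rV[R]_n) p : tangent_distribution D ->
  local_frame D U E -> U p ->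
  exists phi : N -> R, [/\ smooth_fun setT phi, phi p != 0 &
    forall X, smooth_field U X -> (forall q, U q -> D q (X q)) ->
      section_of D (fun q => phi q *: X q)].
Proof.
move=> tD [oU _ _ _ _] Up; have [phi [K [sphi p0 cK KU phi0]]] := bump_function oU Up.
exists phi; split; [exact: sphi|exact: p0|]; move=> X sX DX; split; first exact: (extend_field oU sX sphi cK KU phi0).
move=> q; have [Kq|nKq] := pselect (K q).
  by apply: distributionZ => //; apply: DX; apply: KU.
by rewrite phi0 // scale0r; exact: distribution0.
Qed.

(** Inverting the Gram matrix of the frame yields the orthogonal projection w of u to D. The
    difference u - w is orthogonal to D, hence to w, and to u by hypothesis; so it vanishes. *)
Lemma double_orthogonal k D U (E : 'I_k -> N -> 'rV[R]_n) p u
    (g : N -> 'rV[R]_n -> 'rV[R]_n -> R) : riemannian_metric g ->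
  local_frame D U E -> U p ->
  (forall z, orthogonal_at g p (D p) z -> g p u z = 0) -> D p u.
Proof.
move=> gM fr Up H; have gC := Defs.metric_sym gM p.
pose G : 'M[R]_k := \matrix_(i, j) g p (E i p) (E j p).
have GE (y : 'rV[R]_k) j : (y *m G) 0 j = g p (\sum_i y 0 i *: E i p) (E j p).
  by rewrite mxE (metric_lincomb gM); apply: eq_bigr => i _; rewrite mxE.
have nondeg w : g p w w = 0 -> w = 0.
  by move=> w0; apply/eqP; apply: contraT => /(metric_pos gM p); rewrite w0 ltxx.
have Gu : G \in unitmx.
  apply: unitmx_inj => y yG; apply: (frame_free fr Up); apply: nondeg.
  rewrite (metric_lincomb_r gM) big1 // => j _.
  by rewrite -GE yG mxE mulr0.
pose b : 'rV[R]_k := \row_j g p u (E j p).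
pose y := b *m invmx G; pose w := \sum_i y 0 i *: E i p.
have yE j : g p w (E j p) = g p u (E j p) by rewrite -GE mulmxKV // mxE.
have orth : orthogonal_at g p (D p) (u - w).
  move=> v /(frame_span fr Up)[z ->]; rewrite (metric_lincomb_r gM) big1 // => j _.
  by rewrite (metricB gM) yE subrr mulr0.
have : g p (u - w) (u - w) = 0.
  rewrite (metricB gM) H // gC; apply/eqP; rewrite sub0r oppr_eq0; apply/eqP.
  by apply: orth; exact: (frame_in fr Up).
move=> /nondeg /eqP; rewrite subr_eq0 => /eqP ->; exact: (frame_in fr Up).
Qed.

End frames.

Section leaves.
Context (R : realType) (n k : nat) (N : manifold R n) (L : manifold R k) (j : L -> N).
Variable D : N -> set 'rV[R]_n.
Hypothesis jD : integral_manifold D j.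
Variable gN : N -> 'rV[R]_n -> 'rV[R]_n -> R.
Variable nablaN : N -> 'rV[R]_n -> (N -> 'rV[R]_n) -> 'rV[R]_n.

Let jI : immersed_submanifold j := jD.1.
Let jS : smooth_map j := submanifold_smooth jI.

(** The preimages are chosen point by point; the immersion j makes them smooth. *)
Lemma leaf_lift (U : set L) (V : L -> 'rV[R]_n) : open U -> smooth_along j U V ->
  (forall q, U q -> D (j q) (V q)) ->
  exists X, smooth_field U X /\ forall q, U q -> tmap j q (X q) = V q.
Proof.
move=> oU sV DV.
have /choice[X HX] : forall q, exists w, U q -> tmap j q w = V q.
  move=> q; have [Uq|] := pselect (U q); last by exists 0.
  have := DV q Uq; rewrite -(jD.2 q) => -[w _ wE]; by exists w.
exists X; split; last exact: HX.
apply: (immersion_field_smooth jS (submanifold_immersion jI) oU).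
by apply: (smooth_along_ext jS oU) sV => q Uq; rewrite HX.
Qed.

(** Along the leaf, X and Y are images of fields on L. As the second fundamental form of the leaf
    vanishes on these, the derivative of Y along X is the image of a vector tangent to L. *)
Lemma totally_geodesic_leaf_autoparallel X Y q :
  totally_geodesic_immersion j gN nablaN ->
  section_of D X -> section_of D Y ->
  D (j q) (nablaN (j q) (X (j q)) Y).
Proof.
move=> [nablaL [nablaj [_ [_ njE] sff]]] [sX DX] [sY DY].
have lift Z : smooth_field setT Z -> (forall p, D p (Z p)) ->
    exists ZL, smooth_field setT ZL /\ forall q, tmap j q (ZL q) = Z (j q).
  move=> sZ DZ; have sZj := smooth_field_comp jS openT sZ.
  rewrite preimage_setT in sZj.
  have [ZL [sZL ZLE]] := leaf_lift openT sZj (fun q _ => DZ (j q)).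
  by exists ZL; split=> // q'; exact: ZLE.
have [XL [sXL XLE]] := lift X sX DX; have [YL [sYL YLE]] := lift Y sY DY.
have := sff XL YL sXL sYL q; rewrite /second_fundamental_form.
have -> : (fun q => tmap j q (YL q)) = Y \o j by apply/funext => q'; rewrite YLE.
move/eqP; rewrite subr_eq0 => /eqP.
have -> : nablaj q (XL q) (Y \o j) = nablaN (j q) (tmap j q (XL q)) Y.
  exact: (njE setT Y q (XL q) openT I sY).
by rewrite XLE => ->; rewrite -(jD.2 q); exists (nablaL q (XL q) YL).
Qed.

End leaves.

(** * Semi-invariant submanifolds *)

(** Tested on local sections and single vectors, as frames and leaves provide no others. *)
Definition autoparallel (R : realType) n (N : manifold R n)
    (nabla : N -> 'rV[R]_n -> (N -> 'rV[R]_n) -> 'rV[R]_n)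
    (D : N -> set 'rV[R]_n) : Prop :=
  forall (U : set N) Y p v, open U -> U p -> smooth_field U Y ->
    (forall q, U q -> D q (Y q)) -> D p v -> D p (nabla p v Y).

Section semi_invariant.
Context (R : realType) (m n : nat) (M : manifold R m) (N : manifold R n).
Variables (g : M -> 'rV[R]_m -> 'rV[R]_m -> R) (F : M -> 'rV[R]_m -> 'rV[R]_m).
Variables (mu : R) (nablaM : M -> 'rV[R]_m -> (M -> 'rV[R]_m) -> 'rV[R]_m).
Variables (iota : N -> M) (D : N -> set 'rV[R]_n).
Variable nablaN : N -> 'rV[R]_n -> (N -> 'rV[R]_n) -> 'rV[R]_n.
Variable nablaMN : N -> 'rV[R]_n -> (N -> 'rV[R]_m) -> 'rV[R]_m.
Hypothesis mu0 : mu != 0.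
Hypothesis gF : gFmu_manifold g F mu.
Hypothesis F_inj : forall p, injective (F p).
Hypothesis lcM : levi_civita g nablaM.
Hypothesis F_parallel : parallel_tensor nablaM F.
Hypothesis iotaI : immersed_submanifold iota.
Hypothesis siD : semi_invariant iota g F D.
Hypothesis lcN : levi_civita (induced_metric iota g) nablaN.
Hypothesis nablaMNP : pullback_connection iota nablaM nablaMN.

Let gN := induced_metric iota g.
Let Dperp := anti_invariant iota g D.
Let h := second_fundamental_form iota nablaN nablaMN.
Let iS : smooth_map iota := submanifold_smooth iotaI.
Let gM : riemannian_metric g := let: And3 a _ _ := gF in a.
Let FT : tensor11 F := let: And3 _ a _ := gF in a.
Let skew p u v : g p (F p u) v + mu * g p u (F p v) = 0 := (let: And3 _ _ a := gF in a) p u v.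
Let gNM : riemannian_metric gN := induced_metric_riemannian iotaI gM.
Let cN : affine_connection nablaN := levi_civita_connection lcN.
Let tD : tangent_distribution D := semi_invariant_distribution siD.
Let idS := smooth_map_id N.

Lemma gauss_vec U Y p v w : open U -> U p -> smooth_field U Y ->
  g (iota p) (nablaMN p v (fun q => tmap iota q (Y q))) (tmap iota p w) =
  gN p (nablaN p v Y) w.
Proof.
move=> oU Up sY; have [X [sX Xp]] := coord_fields_value p v.
pose c := chart_at p; have oW : open (U `&` chart_dom c).
  by apply: openI => //; apply: chart_dom_open.
have Wp : (U `&` chart_dom c) p by split; [|exact: chart_at_dom].
have sXW : smooth_field (U `&` chart_dom c) X.
  by apply: (smooth_alongS idS oW (@chart_dom_open _ _ _ c)) sX => q [].
have sYW : smooth_field (U `&` chart_dom c) Y.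
  by apply: (smooth_alongS idS oW oU) sY => q [].
have := second_fundamental_form_normal iotaI gM lcM nablaMNP lcN w oW Wp sXW sYW.
rewrite /second_fundamental_form Xp => H.
apply/eqP; rewrite -subr_eq0; apply/eqP; apply: etrans H.
exact: (esym (metricB gM _ _ _ _)).
Qed.

(** F maps D into D only after both are embedded in TM, so F Y has to be lifted back to N. *)
Lemma F_field U Y : open U -> smooth_field U Y -> (forall q, U q -> D q (Y q)) ->
  exists Y2, [/\ smooth_field U Y2, forall q, U q -> D q (Y2 q) &
    forall q, U q -> tmap iota q (Y2 q) = F (iota q) (tmap iota q (Y q))].
Proof.
move=> oU sY DY.
have /choice[Y2 HY] : forall q, exists w, U q ->
    D q w /\ tmap iota q w = F (iota q) (tmap iota q (Y q)).
  move=> q; have [Uq|] := pselect (U q); last by exists 0.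
  have [|w Dw wE] := semi_invariant_D siD (p := q) (t := F (iota q) (tmap iota q (Y q))).
    by exists (tmap iota q (Y q)) => //; exists (Y q) => //; exact: DY.
  by exists w.
exists Y2; split=> [|q /HY[]//|q /HY[]//].
apply: (immersion_field_smooth iS (submanifold_immersion iotaI) oU).
apply: (smooth_along_ext iS oU (fun q Uq => esym (HY q Uq).2)).
exact: (tensor_along_smooth iS FT oU (tmap_smooth iS oU sY)).
Qed.

Lemma normal_sym p u w : Defs.normal_space iota g p u -> g (iota p) (tmap iota p w) u = 0.
Proof. by move=> nu; rewrite (Defs.metric_sym gM); apply: nu; exists w. Qed.

Lemma F_Dperp_normal p z : Dperp p z -> Defs.normal_space iota g p (F (iota p) (tmap iota p z)).
Proof.
move=> Dz; apply: (semi_invariant_Dperp siD).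
by exists (tmap iota p z) => //; exists z.
Qed.

(* Moving F across the metric trades the component of nabla_v Y along F(D^perp)
   for the component of nabla_v (FY) along D^perp. *)
Lemma F_transfer U Y Y2 p v z : open U -> U p ->
  smooth_field U Y -> smooth_field U Y2 ->
  (forall q, U q -> tmap iota q (Y2 q) = F (iota q) (tmap iota q (Y q))) ->
  gN p (nablaN p v Y2) z =
  - mu * g (iota p) (nablaMN p v (fun q => tmap iota q (Y q))) (F (iota p) (tmap iota p z)).
Proof.
move=> oU Up sY sY2 Y2E.
have sFY : smooth_along iota U (fun q => F (iota q) (tmap iota q (Y q))).
  exact: (tensor_along_smooth iS FT oU (tmap_smooth iS oU sY)).
apply: etrans (esym (gauss_vec v z oU Up sY2)) _.
have -> : nablaMN p v (fun q => tmap iota q (Y2 q)) =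
    F (iota p) (nablaMN p v (fun q => tmap iota q (Y q))).
  apply: etrans _ (pullback_parallel iS nablaMNP FT F_parallel v oU Up (tmap_smooth iS oU sY)).
  exact: (connection_local nablaMNP.1 v oU Up (tmap_smooth iS oU sY2) sFY Y2E).
by apply/eqP; rewrite mulNr -addr_eq0; apply/eqP; exact: skew.
Qed.

Lemma sff_smooth X Y : smooth_field setT X -> smooth_field setT Y ->
  smooth_along iota setT (h X Y).
Proof.
move=> sX sY; apply: (smooth_alongB iS openT).
  exact: (connection_smooth nablaMNP.1 openT sX (tmap_smooth iS openT sY)).
exact: (tmap_smooth iS openT (connection_smooth cN openT sX sY)).
Qed.

Lemma sff_FDperp X Y p z : Dperp p z -> smooth_field setT Y ->
  g (iota p) (h X Y p) (F (iota p) (tmap iota p z)) =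
  g (iota p) (nablaMN p (X p) (fun q => tmap iota q (Y q))) (F (iota p) (tmap iota p z)).
Proof.
move=> Dz sY; apply: etrans (metricB gM _ _ _ _) _.
by rewrite (normal_sym _ (F_Dperp_normal Dz)) subr0.
Qed.

Lemma sff_in_Dtilde X Y :
  (forall X Y p, section_of D X -> section_of D Y -> D p (nablaN p (X p) Y)) ->
  section_of D X -> section_of D Y -> section_along iota (Dtilde iota g F D) (h X Y).
Proof.
move=> H [sX DX] [sY DY]; split; first exact: (sff_smooth sX sY).
move=> p; split.
  move=> _ [w _ <-].
  exact: (second_fundamental_form_normal iotaI gM lcM nablaMNP lcN w openT I sX sY).
move=> _ [_ [z Dz <-] <-]; rewrite sff_FDperp //.
have [Y2 [sY2 DY2 Y2E]] := F_field openT sY (fun q _ => DY q).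
have E := F_transfer (X p) z openT (I : setT p) sY sY2 Y2E.
have : gN p (nablaN p (X p) Y2) z = 0.
  rewrite (Defs.metric_sym gNM); apply: Dz; apply: H; first by split.
  by split=> // q; exact: DY2.
by rewrite E => /eqP; rewrite mulf_eq0 oppr_eq0 (negbTE mu0) /= => /eqP.
Qed.

(** Instead of inverting F on sections, a frame E of D is replaced by its image E2 under F, again a
    frame since F is injective. [F_transfer] shows that the derivatives of E2 have no component
    along D^perp, and every section of D is a combination of E2 with smooth coefficients. *)
Lemma sff_autoparallel :
  (forall X Y, section_of D X -> section_of D Y ->
     section_along iota (Dtilde iota g F D) (h X Y)) ->
  autoparallel nablaN D.
Proof.
move=> H U Y p v oU Up sY DY Dv.
have [k fr] := distribution_frame tD; have [U0 [E [U0p frE0]]] := fr p.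
pose W := U `&` U0; have oW : open W by apply: openI => //; exact: (frame_open frE0).
have Wp : W p by [].
have frE : local_frame D W E by apply: local_frameS frE0 => // q [].
have [phi [sphi phip phiD]] := bump_section tD frE Wp.
have /choice[E2 HE2] : forall i, exists Y2, [/\ smooth_field W Y2,
    forall q, W q -> D q (Y2 q) &
    forall q, W q -> tmap iota q (Y2 q) = F (iota q) (tmap iota q (E i q))].
  by move=> i; apply: F_field oW (frame_smooth frE i) _ => q; exact: frame_mem frE.
have sE2 i : smooth_field W (E2 i) by have [] := HE2 i.
have frE2 : local_frame D W E2.
  apply: (frame_change frE sE2) => [q Wq i|q Wq z z0].
    by have [_ /(_ q Wq)] := HE2 i.
  apply: (frame_free frE Wq); apply: (submanifold_immersion iotaI (p := q)).
  apply: (F_inj (p := iota q)).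
  rewrite (linfun0 (tmap_linear iS q)) (linfun0 (FT.1 (iota q))).
  rewrite (linfun_lincomb (tmap_linear iS q)) (linfun_lincomb (FT.1 (iota q))).
  have T0 := etrans (congr1 (tmap iota q) z0) (linfun0 (tmap_linear iS q)).
  apply: etrans T0; apply/esym; apply: etrans (linfun_lincomb (tmap_linear iS q) _ _ _ _) _.
  by apply: eq_bigr => i _; have [_ _ ->] := HE2 i.
have sphiW : smooth_fun W phi by apply: smooth_funS sphi.
have perpE2 i z : Dperp p z -> gN p (E2 i p) z = 0.
  by move=> Dz; rewrite (Defs.metric_sym gNM); apply: Dz; exact: frame_mem frE2 Wp.
have orthE2 i z : Dperp p z -> gN p (nablaN p v (E2 i)) z = 0.
  move=> Dz.
  have [a aE] := frame_span frE Wp Dv.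
  (* A local section of D through v, with constant coefficients in the frame E. *)
  pose X0 q := \sum_l a 0 l *: E l q.
  have sX0 : smooth_field W X0.
    apply: (smooth_along_sum idS); first exact: oW.
    move=> l _; apply: (smooth_alongZ idS); first exact: oW.
      exact: (smooth_fun_cst W (a 0 l)).
    exact: (frame_smooth frE l).
  have secX := phiD X0 sX0 (fun q Wq => frame_in frE Wq a).
  have secE := phiD (E i) (frame_smooth frE i) (fun q Wq => frame_mem i frE Wq).
  have [_ /(_ p)[_ hD]] := H _ _ secX secE.
  have := hD _ (ex_intro2 _ _ _ (ex_intro2 _ _ z Dz erefl) erefl).
  rewrite (sff_FDperp _ Dz secE.1) => h0.
  have sphiE := smooth_alongZ idS oW sphiW (frame_smooth frE i).
  have sphiE2 := smooth_alongZ idS oW sphiW (sE2 i).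
  have := F_transfer (phi p *: X0 p) z oW Wp sphiE sphiE2.
  rewrite h0 mulr0 => /(_ _)/wrap[q Wq|].
    rewrite (linfunZ (tmap_linear iS q)) (linfunZ (tmap_linear iS q)).
    by rewrite (linfunZ (FT.1 (iota q))); have [_ _ ->] := HE2 i.
  have -> : X0 p = v by exact: esym aE.
  have -> : nablaN p (phi p *: v) (fun q => phi q *: E2 i q) =
      phi p *: nablaN p v (fun q => phi q *: E2 i q).
    exact: (linfunZ (L := fun v => nablaN p v (fun q => phi q *: E2 i q))
      (fun a u v => connection_linear cN a u v oW Wp sphiE2)).
  (* The term with the derivative of phi is a multiple of E2 i, orthogonal to z; the other carries
     the factor phi(p)^2, one phi(p) from each scaled field, and can be divided by it. *)
  rewrite (connection_leibniz cN v oW Wp sphiW (sE2 i)).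
  rewrite (metricZ gNM) (metricD gNM) !(metricZ gNM) perpE2 // mulr0 add0r => /eqP.
  by rewrite !mulf_eq0 (negbTE phip) /= => /eqP.
have /choice[y Hy] : forall q, exists z : 'rV[R]_k, W q -> Y q = \sum_i z 0 i *: E2 i q.
  move=> q; have [Wq|] := pselect (W q); last by exists 0.
  have [z zE] := frame_span frE2 Wq (DY q Wq.1); by exists z.
have sYW : smooth_field W Y by apply: (smooth_alongS idS oW oU) sY => q [].
have sy := along_coefficients idS oW sE2 sYW Hy (fun q Wq => frame_free frE2 Wq).
apply: (double_orthogonal gNM frE Wp) => z Dz.
have sYE : smooth_field W (fun q => \sum_i y q 0 i *: E2 i q).
  apply: (smooth_along_sum idS); first exact: oW.
  by move=> i _; apply: (smooth_alongZ idS); [exact: oW|exact: sy|exact: sE2].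
rewrite (connection_local cN v oW Wp sYW sYE Hy).
rewrite (connection_lincomb idS (connection_add cN) (connection_leibniz cN)
  _ v oW Wp sy sE2).
have -> : \sum_i (@tderive R n N R^o (fun q => y q 0 i) p v *: E2 i p +
     y p 0 i *: nablaN p v (E2 i)) =
   \sum_i @tderive R n N R^o (fun q => y q 0 i) p v *: E2 i p +
   \sum_i y p 0 i *: nablaN p v (E2 i) by rewrite big_split.
rewrite (metricD gNM) !(metric_lincomb gNM) !big1 ?addr0 // => i _.
  by rewrite orthE2 // mulr0.
by rewrite perpE2 // mulr0.
Qed.

End semi_invariant.

(** * The Levi-Civita connection of a leaf *)

Section autoparallel_leaves.
Context (R : realType) (n k : nat) (N : manifold R n) (L : manifold R k) (j : L -> N).
Variables (g : N -> 'rV[R]_n -> 'rV[R]_n -> R) (D : N -> set 'rV[R]_n).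
Variable nabla : N -> 'rV[R]_n -> (N -> 'rV[R]_n) -> 'rV[R]_n.
Hypothesis jD : integral_manifold D j.
Hypothesis gM : riemannian_metric g.
Hypothesis lc : levi_civita g nabla.
Hypothesis tD : tangent_distribution D.
Hypothesis apD : autoparallel nabla D.

Let jI : immersed_submanifold j := jD.1.
Let jS : smooth_map j := submanifold_smooth jI.
Let jinj p : injective (tmap j p) := submanifold_immersion jI (p := p).
Let jl p a u v : tmap j p (a *: u + v) = a *: tmap j p u + tmap j p v := tmap_linear jS p a u v.
Let cN : affine_connection nabla := levi_civita_connection lc.

Variable nablaj : L -> 'rV[R]_k -> (L -> 'rV[R]_n) -> 'rV[R]_n.
Hypothesis njP : pullback_connection j nabla nablaj.

(** V is expanded in a frame of D pulled back to the leaf: derivatives of coefficients multiply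
    frame vectors, and derivatives of the frame are those on N along a vector of D. *)
Lemma pullback_autoparallel U V q v : open U -> U q -> smooth_along j U V ->
  (forall q, U q -> D (j q) (V q)) -> D (j q) (nablaj q v V).
Proof.
move=> oU Uq sV DV; have [d fr] := distribution_frame tD.
have [U0 [E [U0q frE]]] := fr (j q); have oU0 := frame_open frE.
pose W := U `&` j @^-1` U0.
have oP : open (j @^-1` U0) by exact: (smooth_map_preimage_open jS oU0).
have oW : open W by exact: openI.
have Wq : W q by [].
have WP : W `<=` j @^-1` U0 by move=> ? [].
have sE i : smooth_along j W (E i \o j).
  exact: (smooth_alongS jS oW oP WP (smooth_field_comp jS oU0 (frame_smooth frE i))).
have sVW : smooth_along j W V by apply: (smooth_alongS jS oW oU) sV => ? [].
have /choice[y Hy] : forall q, exists z : 'rV[R]_d, W q -> V q = \sum_i z 0 i *: (E i \o j) q.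
  move=> q'; have [[Uq' U0q']|] := pselect (W q'); last by exists 0.
  have [z zE] := frame_span frE U0q' (DV q' Uq'); by exists z.
have sy := along_coefficients jS oW sE sVW Hy (fun q' Wq' => frame_free frE Wq'.2).
have sVE : smooth_along j W (fun q => \sum_i y q 0 i *: (E i \o j) q).
  apply: (smooth_along_sum jS); first exact: oW.
  by move=> i _; apply: (smooth_alongZ jS); [exact: oW|exact: sy|exact: sE].
rewrite (connection_local njP.1 v oW Wq sVW sVE Hy).
rewrite (connection_lincomb jS (connection_add njP.1) (connection_leibniz njP.1)
  _ v oW Wq sy sE).
apply: (double_orthogonal gM frE U0q) => z Dz.
have DE u : D (j q) u -> g (j q) u z = 0.
  by move=> Du; rewrite (Defs.metric_sym gM); exact: Dz.
have -> : \sum_i (@tderive R k L R^o (fun q => y q 0 i) q v *: (E i \o j) q +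
     y q 0 i *: nablaj q v (E i \o j)) =
   \sum_i @tderive R k L R^o (fun q => y q 0 i) q v *: (E i \o j) q +
   \sum_i y q 0 i *: nablaj q v (E i \o j) by rewrite big_split.
rewrite (metricD gM) !(metric_lincomb gM) !big1 ?addr0 // => i _.
  rewrite DE ?mulr0 // (njP.2 _ _ _ _ oU0 U0q (frame_smooth frE i)).
  apply: (apD oU0 U0q (frame_smooth frE i)); first by move=> p; exact: frame_mem frE.
  by rewrite -(jD.2 q); exists v.
by rewrite DE ?mulr0 //; exact: (frame_mem i frE U0q).
Qed.

Let inv q w := xget 0 [set u | tmap j q u = w].

Let invK q w : D (j q) w -> tmap j q (inv q w) = w.
Proof.
rewrite -(jD.2 q) => -[u _ uE]; rewrite /inv.
by have := @xgetPex _ 0 [set u | tmap j q u = w] (ex_intro _ u uE).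
Qed.

(** The derivative along j of a field tangent to the leaf stays in D, hence is tangent to the leaf;
    its preimage is the connection of the leaf. The second fundamental form then vanishes by
    construction, and the Levi-Civita axioms are inherited from N. *)
Let nablaL q v Y := inv q (nablaj q v (fun q => tmap j q (Y q))).

Let tangent_D q w : D (j q) (tmap j q w).
Proof. by rewrite -(jD.2 q); exists w. Qed.

Lemma tmap_nablaL U q v Y : open U -> U q -> smooth_field U Y ->
  tmap j q (nablaL q v Y) = nablaj q v (fun q => tmap j q (Y q)).
Proof.
move=> oU Uq sY; apply: invK; apply: (pullback_autoparallel _ oU Uq (tmap_smooth jS oU sY)).
by move=> q' _; exact: tangent_D.
Qed.

Let idS := smooth_map_id L.

Lemma nablaL_connection : affine_connection nablaL.
Proof.
split.
- move=> U V q a u v oU Uq sV; apply: (@jinj q); rewrite jl.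
  rewrite (tmap_nablaL (a *: u + v) oU Uq sV) (tmap_nablaL u oU Uq sV) (tmap_nablaL v oU Uq sV).
  exact: (connection_linear njP.1 a u v oU Uq (tmap_smooth jS oU sV)).
- move=> U V W q v oU Uq sV sW; apply: (@jinj q); rewrite (linfunD (jl q)).
  apply: etrans (tmap_nablaL v oU Uq (smooth_alongD idS oU sV sW)) _.
  apply: etrans _ (congr2 +%R (esym (tmap_nablaL v oU Uq sV)) (esym (tmap_nablaL v oU Uq sW))).
  apply: etrans _ (connection_add njP.1 v oU Uq (tmap_smooth jS oU sV) (tmap_smooth jS oU sW)).
  by congr nablaj; apply/funext => q'; rewrite (linfunD (jl q')).
- move=> U phi V q v oU Uq sphi sV; apply: (@jinj q); rewrite jl (linfunZ (jl q)).
  apply: etrans (tmap_nablaL v oU Uq (smooth_alongZ idS oU sphi sV)) _.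
  rewrite (tmap_nablaL v oU Uq sV).
  apply: etrans _ (connection_leibniz njP.1 v oU Uq sphi (tmap_smooth jS oU sV)).
  by congr nablaj; apply/funext => q'; rewrite (linfunZ (jl q')).
- move=> U V W q v oU Uq sV sW VW; apply: jinj.
  apply: etrans (tmap_nablaL v oU Uq sV) _; apply: etrans _ (esym (tmap_nablaL v oU Uq sW)).
  apply: (connection_local njP.1 v oU Uq (tmap_smooth jS oU sV) (tmap_smooth jS oU sW)).
  by move=> q' Uq'; rewrite VW.
- move=> U X V oU sX sV; apply: (immersion_field_smooth jS jinj oU).
  apply: (smooth_along_ext jS oU (fun q Uq => esym (tmap_nablaL _ oU Uq sV))).
  exact: (connection_smooth njP.1 oU sX (tmap_smooth jS oU sV)).
Qed.

Lemma nablaL_levi_civita : levi_civita (induced_metric j g) nablaL.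
Proof.
split; first exact: nablaL_connection.
- move=> U X Y q oU Uq sX sY; apply: (@jinj q); rewrite (linfunB (jl q)).
  apply: etrans (congr2 (fun a b => a - b) (tmap_nablaL (X q) oU Uq sY)
    (tmap_nablaL (Y q) oU Uq sX)) _.
  exact: (pullback_torsion jS cN njP (levi_civita_torsion lc) oU Uq sX sY).
- move=> U X Y q v oU Uq sX sY.
  apply: etrans _ (congr2 (fun a b => g (j q) a _ + g (j q) _ b)
    (esym (tmap_nablaL v oU Uq sX)) (esym (tmap_nablaL v oU Uq sY))).
  exact: (pullback_metric jS njP gM (levi_civita_metric lc) v oU Uq
    (tmap_smooth jS oU sX) (tmap_smooth jS oU sY)).
Qed.

Lemma autoparallel_leaf_totally_geodesic : totally_geodesic_immersion j g nabla.
Proof.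
exists nablaL, nablaj; split; [exact: nablaL_levi_civita|exact: njP|].
move=> X Y sX sY q; rewrite /second_fundamental_form.
by rewrite (tmap_nablaL _ openT (I : setT q) sY) subrr.
Qed.

End autoparallel_leaves.

(** * The theorem of Frobenius *)

Section euclidean_space.
Context (R : realType) (k : nat).
Local Notation V := 'rV[R]_k.

Lemma rV_second_countable : @second_countable V.
Proof.
pose f (a : 'rV[rat]_k * nat) : set V :=
  ball (map_mx ratr a.1 : V) (a.2.+1%:R^-1 : R).
exists (range f).
  exact: sub_countable (card_image_le _ _) (countableP _).
split=> [_ [a _ <-]|x A]; first exact: ball_open.
move=> /nbhs_ballP[e /= e0 eA].
have [N _ HN] : \forall N \near \oo, (N.+1%:R^-1 : R) < e / 2.
  exact: (near_infty_natSinv_lt (PosNum (divr_gt0 e0 (ltr0n R 2)))).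
have rN := HN N (leqnn N); set r : R := N.+1%:R^-1 in rN.
have r0 : 0 < r by rewrite invr_gt0 ltr0n.
have /choice[q Hq] : forall j : 'I_k, exists q : rat, `|x 0 j - ratr q| < r / 2.
  move=> j; have lt : x 0 j - r / 2 < x 0 j + r / 2.
    by clear - r0; lra.
  have [q] := rat_in_itvoo lt; rewrite in_itv /= => /andP[q1 q2]; exists q.
  by rewrite ltr_norml; clear - q1 q2; apply/andP; split; lra.
have xq : `|(map_mx ratr (\row_j q j) : V) - x| <= r / 2.
  apply: rV_norm_le => [|j]; first by rewrite divr_ge0 // ltW.
  by rewrite !mxE distrC ltW.
exists (f (\row_j q j, N)); first split; first by exists (\row_j q j, N).
  by rewrite /f /= -ball_normE /=; apply: le_lt_trans xq _; clear - r0; rewrite -/r; lra.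
move=> y; rewrite /f /= -ball_normE /= => yr; apply: eA.
rewrite -ball_normE /= -/r in yr *.
rewrite -(subrKA (map_mx ratr (\row_j q j) : V)); apply: le_lt_trans (ler_normD _ _) _.
apply: (@lt_trans _ _ (r / 2 + r)); last by clear - rN e0; lra.
by apply: ler_ltD => //; rewrite distrC.
Qed.

Lemma id_continuous (x : V) : {for x, continuous (@id V)}.
Proof. exact: cvg_id. Qed.

Definition id_chart : chart R V k :=
  @Chart R V k setT setT id id openT openT (fun _ _ => I) (fun _ _ => I)
    (fun _ _ => erefl) (fun _ _ => erefl)
    (fun x _ => id_continuous (x := x)) (fun x _ => id_continuous (x := x)).

Lemma id_chart_compatible (c c' : chart R V k) : [set id_chart] c -> [set id_chart] c' ->
  smooth_on (chart_cod c `&` chart_inv c @^-1` chart_dom c') (c' \o chart_inv c).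
Proof. by move=> -> -> K; exact: Ck_id. Qed.

Definition euclidean : manifold R k :=
  @Manifold R k V (@norm_hausdorff _ _) rV_second_countable [set id_chart]
    (fun=> id_chart) (fun _ => erefl) (fun _ => I) id_chart_compatible.

End euclidean_space.

Section box.
Context (R : realType) (k : nat) (e : R).
Hypothesis e0 : 0 < e.

(** Since pi / 2 < 2, the factor e / 2 puts all values in the cube of radius e. *)
Definition box_map (x : 'rV[R]_k) : 'rV[R]_k := \row_i (e / 2 * atan (x 0 i)).

Definition box_slope (x : 'rV[R]_k) i : R := e / 2 * (1 + x 0 i ^+ 2)^-1.

Lemma box_slope_neq0 x i : box_slope x i != 0.
Proof.
apply: mulf_neq0; first by apply: mulf_neq0; rewrite ?gt_eqF // invr_gt0 ltr0n.
by rewrite invr_eq0 gt_eqF // ltr_pwDl // sqr_ge0.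
Qed.

Lemma box_map_bound x : `|box_map x| < e.
Proof.
have /andP[_ pi4] := @pihalf_02 R.
apply: (@le_lt_trans _ _ (e / 2 * (pi / 2))); last first.
  by rewrite -[ltRHS](@divfK _ 2) ?ltr_pM2l ?divr_gt0 // pnatr_eq0.
have pi0 : 0 <= e / 2 * (pi / 2).
  by rewrite !mulr_ge0 ?invr_ge0 ?ler0n // ?ltW // pi_gt0.
apply: rV_norm_le => // i; rewrite mxE normrM ger0_norm; last by rewrite ltW ?divr_gt0.
rewrite ler_pM2l ?divr_gt0 // ler_norml ltW ?atan_gtNpi2 //=.
by rewrite ltW ?atan_ltpi2.
Qed.

Lemma box_map0 : box_map 0 = 0.
Proof. by apply/rowP => i; rewrite !mxE atan0 mulr0. Qed.

Lemma box_map_inj : injective box_map.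
Proof.
move=> x y /rowP H; apply/rowP => i; have := H i; rewrite !mxE.
have e20 : e / 2 != 0 by apply: mulf_neq0; rewrite ?gt_eqF // invr_gt0 ltr0n.
by move=> /(mulfI e20) /(can_inj (@atanK R)).
Qed.

Lemma is_derive_box_coord (x : 'rV[R]_k) i :
  differentiable (fun y => box_map y 0 i : R^o) x /\
  forall v, 'D_v (fun y => box_map y 0 i : R^o) x = box_slope x i * v 0 i.
Proof.
have E : (fun y => box_map y 0 i : R^o) =
    (fun t => e / 2 * atan t : R^o) \o (fun y : 'rV[R]_k => y 0 i : R^o).
  by apply/funext => y; rewrite /= mxE.
have dp : differentiable (fun y : 'rV[R]_k => y 0 i : R^o) x by exact: differentiable_coord.
have da : is_derive (x 0 i) (1 : R) (fun t => e / 2 * atan t : R^o) (box_slope x i).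
  apply: (@is_deriveZ _ _ _ (@atan R) (e / 2 : R)).
have df := derivable_differentiable1 da.
rewrite E; split; first exact: differentiable_comp.
move=> v; rewrite (derive_comp v dp df).
have -> : 'D_v (fun y : 'rV[R]_k => y 0 i : R^o) x = v 0 i.
  rewrite -(coord_derive v i (f := id)) //.
  by rewrite derive_id.
have dE : 'd (fun t => e / 2 * atan t : R^o) (x 0 i) 1 = box_slope x i.
  by rewrite -deriveE // derive_val.
rewrite deriveE //.
have -> : v 0 i = v 0 i *: (1 : R) by rewrite /GRing.scale /= mulr1.
by rewrite linearZ dE /GRing.scale /= mulr1 mulrC.
Qed.

Lemma Ck_box K : Ck K setT box_map.
Proof.
apply: (Ck_coord K (box_map) openT).2 => i.
case: K => [|K]; first by move=> x _; apply: differentiable_continuous; have [] := is_derive_box_coord x i.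
split=> [x _|v]; first by have [] := is_derive_box_coord x i.
have -> : (fun x => 'D_v (fun y => box_map y 0 i : R^o) x) =
    (fun x => box_slope x i * v 0 i).
  by apply/funext => x; have [_ ->] := is_derive_box_coord x i.
apply: CkM; [exact: openT| |exact: (@Ck_cst R k R^o K setT (v 0 i))].
apply: CkM; [exact: openT|exact: (@Ck_cst R k R^o K setT (e / 2))|].
apply: CkV; first exact: openT.
  by move=> x _; rewrite gt_eqF // ltr_pwDl // sqr_ge0.
apply: CkD; [exact: openT|exact: (@Ck_cst R k R^o K setT 1)|].
by apply: CkM; [exact: openT|exact: Ck_proj|exact: Ck_proj].
Qed.

Lemma box_map_derive x v : differentiable box_map x /\
  'D_v box_map x = \row_i (box_slope x i * v 0 i).
Proof.
have db : differentiable box_map x.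
  by apply/differentiable_rV => i; have [] := is_derive_box_coord x i.
split=> //; apply/rowP => i; rewrite coord_derive // mxE.
by have [_ ->] := is_derive_box_coord x i.
Qed.

End box.

Lemma ball_norm_open (R : realType) k (e : R) : open [set x : 'rV[R]_k | `|x| < e].
Proof.
have -> : [set x : 'rV[R]_k | `|x| < e] = ball (0 : 'rV[R]_k) e.
  by apply/seteqP; split=> x /=; rewrite -ball_normE /= sub0r normrN.
exact: ball_open.
Qed.

(** * Integral manifolds of straightened commuting fields *)

Section flow_box.
Context (R : realType) (n k : nat) (W : set 'rV[R]_n).
Variables (b : 'I_k -> 'rV[R]_n -> 'rV[R]_n) (P : 'M[R]_(n, k)) (x0 : 'rV[R]_n).
Hypothesis oW : open W.
Hypothesis Wx0 : W x0.
Hypothesis bS : forall i, smooth_on W (b i).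
Hypothesis comm : forall i j y, W y -> 'D_(b i y) (b j) y = 'D_(b j y) (b i) y.
Hypothesis bP : forall i y, W y -> b i y *m P = delta_mx 0 i.

(** Bootstrap: the derivative of u is a combination of the b_i composed with u, so u of class C^K is
    of class C^(K+1). *)
Lemma flow_Ck (u : 'rV[R]_k -> 'rV[R]_n) (e : R) K :
  (forall x, `|x| < e -> [/\ W (u x), differentiable u x &
     forall h, 'D_h u x = \sum_i h 0 i *: b i (u x)]) ->
  Ck K [set x | `|x| < e] u.
Proof.
move=> H; elim: K => [|K IH].
  by move=> x xe; apply: differentiable_continuous; have [] := H x xe.
split=> [x xe|h]; first by have [] := H x xe.
have oe := @ball_norm_open R k e.
apply: (@Ck_ext _ _ _ _ _ (fun x => \sum_i h 0 i *: b i (u x))) => //.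
  by move=> x xe; have [_ _ ->] := H x xe.
apply/Ck_coord => // j.
apply: (@Ck_ext _ _ _ _ _ (fun x => \sum_i h 0 i * (b i (u x)) 0 j : R^o)) => //.
  by move=> x xe; rewrite summxE; apply: eq_bigr => i _; rewrite mxE.
apply: Ck_sum => // i _; apply: CkM => //; first exact: (@Ck_cst R k R^o K _ (h 0 i)).
apply: (@Ck_comp0 _ _ _ _ _ W u (fun y => b i y 0 j : R^o)) => //.
  by move=> x xe; have [] := H x xe.
by have /Ck_coord := bS i K; apply.
Qed.

(* The linear map P straightens the fields b i, so that a common integral
   manifold through x0 is a graph over its image by P. *)
Lemma flow_projection (u : 'rV[R]_k -> 'rV[R]_n) (e : R) x : u 0 = x0 ->
  (forall x, `|x| < e -> [/\ W (u x), differentiable u x &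
     forall h, 'D_h u x = \sum_i h 0 i *: b i (u x)]) ->
  `|x| < e -> u x *m P = x0 *m P + x.
Proof.
move=> u0 H xe.
have [->|x0n] := eqVneq x 0; first by rewrite u0 addr0.
have x_gt0 : 0 < `|x| by rewrite normr_gt0.
(* As P sends b_i to the i-th unit vector, this curve has zero derivative; |x| < e makes its
   interval |t| < e / |x| reach past t = 1. *)
pose y (t : R) : 'rV[R]_k := u (0 + t *: x) *m P - t *: x.
have dy (t : R) : `|t| < e / `|x| -> is_derive t (1 : R) y 0.
  move=> te; have te' : `|0 + t *: x| < e by rewrite add0r normrZ -ltr_pdivlMr.
  have [Wt dut Dut] := H _ te'.
  have dl := is_derive_line dut.
  apply: is_derive_rV => a; rewrite mxE.
  have -> : (fun s => y s 0 a : R^o) =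
      \sum_l (P l a *: (fun s : R => u (0 + s *: x) 0 l : R^o)) - x 0 a *: (@id R : R -> R^o).
    apply/funext => s; rewrite /y mxE mxE [RHS]/= fct_sumE mxE.
    congr (_ - _); last by rewrite mxE mulrC.
    by apply: eq_bigr => l _; rewrite mulrC.
  have -> : (0 : R) = \sum_l P l a *: (('D_x u (0 + t *: x)) 0 l : R^o) - x 0 a *: (1 : R^o).
    rewrite Dut; apply/esym/eqP; rewrite subr_eq0; apply/eqP.
    transitivity (((\sum_i x 0 i *: b i (u (0 + t *: x))) *m P) 0 a).
      by rewrite [RHS]mxE; apply: eq_bigr => l _; rewrite mulrC.
    rewrite mulmx_suml (eq_bigr (fun i => x 0 i *: delta_mx 0 i)); last first.
      by move=> i _; rewrite -scalemxAl bP.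
    by rewrite -row_sum_delta [RHS]mulr1.
  apply: is_deriveB.
  apply: is_derive_sum => l; apply: is_deriveZ; exact: is_derive_coord.
have e1 : `|1 : R| < e / `|x| by rewrite normr1 ltr_pdivlMr // mul1r.
have e00 : `|0 : R| < e / `|x| by rewrite normr0 divr_gt0 // (le_lt_trans _ xe).
have y0 (t : R) : `|t| < e / `|x| -> `|0 : 'rV[R]_k| <= 0 by rewrite normr0.
have := mean_value_dist dy y0 e00 e1.
rewrite mul0r normr_le0 subr_eq0 /y !scale0r !scale1r !add0r subr0 u0 => /eqP <-.
by rewrite subrK.
Qed.

(** The factors s i are the slopes of the reparametrization; being nonzero, they do not affect the
    span of the derivatives. *)
Lemma flow_box : exists w : 'rV[R]_k -> 'rV[R]_n,
  [/\ smooth_on setT w, w 0 = x0, forall x, W (w x), injective w &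
    forall x, exists s : 'I_k -> R, (forall i, s i != 0) /\
      forall h, 'D_h w x = \sum_i (s i * h 0 i) *: b i (w x)].
Proof.
have [e [u [e0 u0 H]]] := commuting_fields_flow oW Wx0 (fun i => bS i 2) comm.
have He (x : 'rV[R]_k) : `|box_map e x| < e by exact: box_map_bound.
exists (u \o box_map e); split.
- move=> K; apply: (@Ck_comp _ _ _ _ _ _ [set x | `|x| < e]).
  + exact: openT.
  + exact: ball_norm_open.
  + by move=> x _; exact: He.
  + exact: Ck_box.
  + exact: flow_Ck.
- by rewrite /= box_map0.
- by move=> x; have [] := H _ (He x).
- move=> x y /= xy; apply: (@box_map_inj R k e e0).
  have := flow_projection u0 H (He x); rewrite xy (flow_projection u0 H (He y)).
  by move/addrI.
- move=> x; have [_ du Du] := H _ (He x).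
  exists (box_slope e x); split; first exact: box_slope_neq0.
  move=> h; have [db Db] := box_map_derive e x h.
  rewrite (derive_comp h db du) Du Db; apply: eq_bigr => i _.
  by rewrite mxE.
Qed.

End flow_box.

Section euclidean_immersion.
Context (R : realType) (n k : nat) (N : manifold R n) (c : chart R N n).
Hypothesis ac : atlas c.
Variable w : 'rV[R]_k -> 'rV[R]_n.
Hypothesis wS : smooth_on setT w.
Hypothesis wc : forall x, chart_cod c (w x).

Let j : euclidean R k -> N := chart_inv c \o w.

Let w_cts x : {for x, continuous w}.
Proof. exact: (wS 0). Qed.

Let jc x : chart_dom c (j x).
Proof. exact: chart_invS. Qed.

Lemma chart_immersion_smooth : smooth_map j.
Proof.
split.
  move=> x; apply: continuous_comp; first exact: w_cts.
  by apply: chart_inv_cts.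
move=> c0 c' -> ac' K.
have oc' := chart_image_open (c := c) (@chart_dom_open _ _ _ c').
apply: (@Ck_comp _ _ _ _ _ _ (chart_image c (chart_dom c')) w (c' \o chart_inv c)).
- apply: openI; first exact: openT.
  have -> : id @^-1` (j @^-1` chart_dom c') = w @^-1` (chart_image c (chart_dom c')).
    by apply/seteqP; split=> x; [move=> ?; split=> //; exact: wc|case].
  by apply: open_comp => // x _; exact: w_cts.
- exact: oc'.
- by move=> x [_ ?]; split=> //; exact: wc.
- by apply: Ck_sub (wS K) => ?.
- exact: transition_Ck.
Qed.

Lemma tangent_coord_chart_immersion x v : tangent_coord c (j x) (tmap j x v) = 'D_v w x.
Proof.
apply: etrans (tangent_coord_tmap chart_immersion_smooth v ac (jc x)) _.
have cjK : c \o j = w by apply/funext => y; exact: chart_invK.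
exact: (congr1 (fun f => 'D_v f x) cjK).
Qed.

End euclidean_immersion.

(** * Straightened frames and integrability *)

Section frobenius.
Context (R : realType) (n : nat) (N : manifold R n).
Variables (g : N -> 'rV[R]_n -> 'rV[R]_n -> R) (D : N -> set 'rV[R]_n).
Variable nabla : N -> 'rV[R]_n -> (N -> 'rV[R]_n) -> 'rV[R]_n.
Hypothesis lc : levi_civita g nabla.
Hypothesis tD : tangent_distribution D.
Hypothesis apD : autoparallel nabla D.

Let idS := smooth_map_id N.

Lemma autoparallel_bracket U X Y p : open U -> U p ->
  smooth_field U X -> smooth_field U Y ->
  (forall q, U q -> D q (X q)) -> (forall q, U q -> D q (Y q)) -> D p (lie_bracket X Y p).
Proof.
move=> oU Up sX sY DX DY.
rewrite -(levi_civita_torsion lc oU Up sX sY).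
have [k /(_ p)[V [E [Vp fr]]]] := distribution_frame tD.
have [a ->] := frame_span fr Vp (apD oU Up sY DY (DX p Up)).
have [b ->] := frame_span fr Vp (apD oU Up sX DX (DY p Up)).
have := frame_in fr Vp (a - b); rewrite -sumrB.
by under eq_bigr do rewrite !mxE scalerBl.
Qed.

Let crd c k (E : 'I_k -> N -> 'rV[R]_n) q : 'M[R]_(k, n) :=
  \matrix_(i, a) tangent_coord c q (E i q) 0 a.

Lemma tangent_coord_comb (c : chart R N n) k (E : 'I_k -> N -> 'rV[R]_n) q (z : 'rV[R]_k) :
  atlas c -> chart_dom c q ->
  tangent_coord c q (\sum_i z 0 i *: E i q) = z *m crd c E q.
Proof.
move=> ac cq; apply/rowP => a.
rewrite (linfun_lincomb (fun a u v => tangent_coord_linear a u v ac cq)).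
by rewrite summxE mxE; apply: eq_bigr => i _; rewrite !mxE.
Qed.

(** P is the transpose of the component matrix of a frame E at p, so the product G of the component
    matrix with P is a Gram matrix at p, hence invertible near p; the frame is B = G^(-1) E. *)
Lemma straight_frame p : exists k U (B : 'I_k -> N -> 'rV[R]_n) (P : 'M[R]_(n, k)),
  [/\ U p, local_frame D U B, U `<=` chart_dom (chart_at p) &
    forall i q, U q -> tangent_coord (chart_at p) q (B i q) *m P = delta_mx 0 i].
Proof.
pose c := chart_at p; have ac : atlas c := chart_at_atlas p.
have cp : chart_dom c p := chart_at_dom p.
have [k /(_ p)[U0 [E [U0p fr0]]]] := distribution_frame tD.
pose U := U0 `&` chart_dom c; have Up : U p by [].
have oU : open U by apply: openI; [exact: (frame_open fr0)|exact: chart_dom_open].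
have fr : local_frame D U E by apply: local_frameS fr0 => // ? [].
pose P := (crd c E p)^T.
have AP : crd c E p *m P \in unitmx.
  apply: gram_unit => y yA; apply: (frame_free fr Up).
  have tcl := fun a u v => @tangent_coord_linear R n N c p a u v ac cp.
  rewrite -(tangent_coordK (\sum_i _) ac cp) tangent_coord_comb // yA.
  by rewrite (linfun0 (fun a u v => tangent_vec_linear a u v ac cp)).
pose G q := crd c E q *m P.
have scrd i a : smooth_fun U (fun q => crd c E q i a).
  have := smooth_field_coord a oU (frame_smooth fr i) ac.
  rewrite -setIA setIid => H; apply: (smooth_fun_ext oU _ H).
  by move=> q _; rewrite mxE.
have sG i l : smooth_fun U (fun q => G q i l).
  apply: (@smooth_fun_ext _ _ _ _ (fun q => \sum_a crd c E q i a * P a l) _ oU).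
    by move=> q _; rewrite mxE.
  apply: smooth_fun_sum => // a _; apply: smooth_funM => //.
  exact: (smooth_fun_cst U (P a l)).
have sdet : smooth_fun U (fun q => \det (G q)).
  apply: (smooth_fun_ext oU _ (smooth_fun_det oU sG)) => q _.
  by congr (\det _); apply/matrixP => i l; rewrite mxE.
have [W [oW Wp WU Wdet]] : exists W, [/\ open W, W p, W `<=` U &
    forall q, W q -> \det (G q) != 0].
  have dc : {for c p, continuous ((fun q => \det (G q) : R^o) \o chart_inv c)}.
    apply: differentiable_continuous; apply/(mdiffP _ ac cp).
    exact: smooth_mdiff oU Up sdet.
  have d0 : \forall x \near (c p), (\det (G (chart_inv c x)) : R) != 0.
    have := dc [set t : R | t != 0]; apply; rewrite /= chart_funK //.
    by apply: open_nbhs_nbhs; split; [exact: open_neq|have := AP; rewrite unitmxE unitfE].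
  have cc : {for p, continuous c} by exact: chart_fun_cts.
  have := cc _ d0; rewrite nbhs_simpl /= => H.
  have : nbhs p (U `&` [set q | \det (G (chart_inv c (c q))) != 0]).
    by apply: filterI => //; apply: open_nbhs_nbhs.
  rewrite nbhsE => -[W [oW Wp] WH]; exists W.
  split; [exact: oW|exact: Wp|by move=> q /WH[]|].
  by move=> q Wq; have [Uq] := WH q Wq; rewrite /= (chart_funK Uq.2).
have GU q : W q -> G q \in unitmx by move=> Wq; rewrite unitmxE unitfE Wdet.
(* The rows of the inverse of G are the coefficients of the canonical basis in the rows of G, so
   they are smooth by Cramer's rule. *)
have sx i l : smooth_fun W (fun q => row i (invmx (G q)) 0 l).
  apply: (@smooth_coefficients R n N k k W (fun i q => row i (G q))
    (fun q => row i (invmx (G q))) (fun q => delta_mx 0 i)) => //.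
  - move=> a b; apply: (smooth_funS WU).
    by apply: (smooth_fun_ext oU _ (sG a b)) => q _; rewrite [RHS]mxE.
  - move=> a; exact: (smooth_fun_cst W (delta_mx 0 i 0 a)).
  - move=> q Wq; rewrite -row1 -(mulVmx (GU q Wq)) row_mul mulmx_sum_row.
    exact: eq_bigr.
  - move=> q Wq y; rewrite -mulmx_sum_row => /(congr1 (mulmx^~ (invmx (G q)))).
    rewrite mul0mx (mulmxK (GU q Wq)) => y0; exact: y0.
pose B i q := \sum_l (row i (invmx (G q))) 0 l *: E l q.
have frW : local_frame D W E by exact: local_frameS fr.
have BP i q : W q -> tangent_coord c q (B i q) *m P = delta_mx 0 i.
  move=> Wq; rewrite tangent_coord_comb //; last by exact: (WU q Wq).2.
  by rewrite -mulmxA -/(G q) -row_mul mulVmx ?GU // row1.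
exists k, W, B, P; split=> //; last by move=> q /WU[].
apply: (frame_change frW).
- move=> i; apply: (smooth_along_sum idS); first exact: oW.
  move=> l _; apply: (smooth_alongZ idS); [exact: oW|exact: sx|].
  exact: (frame_smooth frW).
- by move=> q Wq i; exact: (frame_in frW Wq).
- move=> q Wq z z0; have cq := (WU q Wq).2.
  have := congr1 (mulmx^~ P) (congr1 (tangent_coord c q) z0).
  rewrite /= (linfun0 (fun a u v => tangent_coord_linear a u v ac cq)) mul0mx.
  rewrite (linfun_lincomb (fun a u v => tangent_coord_linear a u v ac cq)) mulmx_suml.
  rewrite (eq_bigr (fun i => z 0 i *: delta_mx 0 i)); last first.
    by move=> i _; rewrite -scalemxAl BP.
  by rewrite -row_sum_delta.
Qed.

(** The bracket lies in D, with coefficients z in the frame B. The function psi, the a-th component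
    of P applied to the chart, has constant derivative along each field of B, so the bracket
    annihilates it; but the bracket applied to psi is z_a. *)
Lemma straight_frame_bracket p k U (B : 'I_k -> N -> 'rV[R]_n) (P : 'M[R]_(n, k)) i l q :
  local_frame D U B -> U `<=` chart_dom (chart_at p) ->
  (forall i q, U q -> tangent_coord (chart_at p) q (B i q) *m P = delta_mx 0 i) ->
  U q -> lie_bracket (B i) (B l) q = 0.
Proof.
move=> fr Uc BP Uq; pose c := chart_at p; have ac : atlas c := chart_at_atlas p.
have oU := frame_open fr.
have [z zE] := frame_span fr Uq (autoparallel_bracket oU Uq (frame_smooth fr i)
  (frame_smooth fr l) (fun q => frame_mem i fr) (fun q => frame_mem l fr)).
suff z0 : z = 0 by rewrite zE z0 big1 // => a _; rewrite mxE scale0r.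
apply/rowP => a; rewrite mxE.
pose psi q : R := \sum_b P b a * c q 0 b.
have scb b : smooth_fun U (fun q => c q 0 b) := smooth_funS Uc (smooth_fun_chart_coord b ac).
have sPb b : smooth_fun U (fun q => P b a * c q 0 b).
  by apply: smooth_funM; [exact: oU|exact: (smooth_fun_cst U (P b a))|exact: scb].
have spsi : smooth_fun U psi by apply: smooth_fun_sum => // b _; exact: sPb.
have dpsi q' v : U q' -> @tderive R n N R^o psi q' v = (tangent_coord c q' v *m P) 0 a.
  move=> Uq'; have mc := mdiff_chart ac (Uc _ Uq').
  rewrite /psi tderive_fsum; last by move=> b; exact: smooth_mdiff oU Uq' (sPb b).
  rewrite mxE; apply: eq_bigr => b _.
  have dcb := smooth_mdiff oU Uq' (scb b).
  have dP := smooth_mdiff oU Uq' (smooth_fun_cst U (P b a)).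
  rewrite (tderive_fM v dP dcb) (tderive_cst (P b a : R^o)) mulr0 addr0 mulrC.
  by rewrite -(tderive_coord v b mc).
have dB b q' : U q' -> @tderive R n N R^o psi q' (B b q') = (b == a)%:R.
  by move=> Uq'; rewrite dpsi // BP // mxE eqxx eq_sym.
have dBB b v : @tderive R n N R^o (fun q => @tderive R n N R^o psi q (B b q)) q v = 0.
  rewrite -(tderive_cst ((b == a)%:R : R^o) q v); apply: tderive_near.
  by apply: (open_near oU Uq) => q' Uq'; exact: dB.
have := lie_bracket_derive oU Uq spsi (frame_smooth fr i) (frame_smooth fr l).
rewrite !dBB subr0 zE dpsi // (linfun_lincomb (fun a u v => tangent_coord_linear a u v ac (Uc q Uq))).
rewrite mulmx_suml (eq_bigr (fun i => z 0 i *: delta_mx 0 i)); last first.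
  by move=> b _; rewrite -scalemxAl BP.
by rewrite -row_sum_delta.
Qed.

(** The bracket at q is defined through [chart_at q], not c; its action on the coordinate functions
    of c transfers its vanishing to that chart. *)
Lemma bracket0_commute (c : chart R N n) U X Y q : atlas c -> open U -> U `<=` chart_dom c -> U q ->
  smooth_field U X -> smooth_field U Y -> lie_bracket X Y q = 0 ->
  'D_(tangent_coord c q (X q))
     ((fun q => tangent_coord c q (Y q)) \o chart_inv c) (c q) =
  'D_(tangent_coord c q (Y q))
     ((fun q => tangent_coord c q (X q)) \o chart_inv c) (c q).
Proof.
move=> ac oU Uc Uq sX sY br0; have cq := Uc q Uq.
have scb b : smooth_fun U (fun q => c q 0 b) := smooth_funS Uc (smooth_fun_chart_coord b ac).
have sub : U `<=` U `&` chart_dom c by move=> q' Uq'; split=> //; exact: Uc.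
have scrd Z b : smooth_field U Z -> smooth_fun U (fun q => tangent_coord c q (Z q) 0 b).
  by move=> sZ; apply: (smooth_funS sub); exact: smooth_field_coord.
have dcrd Z : smooth_field U Z -> mdiff (fun q => tangent_coord c q (Z q)) q.
  by move=> sZ; apply/mdiff_rV => b; exact: smooth_mdiff oU Uq (scrd Z b sZ).
apply: etrans (esym (tderive_chart (X q) ac cq (dcrd Y sY))) _.
apply: etrans _ (tderive_chart (Y q) ac cq (dcrd X sX)).
apply/rowP => b; apply: etrans (tderive_coord (X q) b (dcrd Y sY)) _.
apply: etrans _ (esym (tderive_coord (Y q) b (dcrd X sX))).
have := lie_bracket_derive oU Uq (scb b) sX sY.
have E Z v : @tderive R n N R^o (fun q => @tderive R n N R^o (fun q => c q 0 b) q (Z q)) q v =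
    @tderive R n N R^o (fun q => tangent_coord c q (Z q) 0 b) q v.
  apply: tderive_near; apply: (open_near oU Uq) => q' Uq'.
  by rewrite -(tderive_coord _ b (mdiff_chart ac (Uc q' Uq'))).
rewrite !E br0 => /eqP.
have -> : @tderive R n N R^o (fun q => c q 0 b) q 0 = 0.
  exact: (linfun0 (fun a u v => tderive_linear a u v (smooth_mdiff oU Uq (scb b)))).
by rewrite subr_eq0 => /eqP.
Qed.

(** The straightened frame is read in the chart at p, where [flow_box] applies, and the resulting
    map is carried back to N. Its tangent maps send the canonical basis to nonzero multiples of the
    frame, hence are injective with range D. *)
Lemma autoparallel_integrable : integrable_distribution D.
Proof.
move=> p; pose c := chart_at p; have ac : atlas c := chart_at_atlas p.
have cp : chart_dom c p := chart_at_dom p.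
have [k [U [B [P [Up fr Uc BP]]]]] := straight_frame p.
have oU := frame_open fr.
pose W := chart_image c U; have oW : open W := chart_image_open (c := c) oU.
pose b i : 'rV[R]_n -> 'rV[R]_n := (fun q => tangent_coord c q (B i q)) \o chart_inv c.
have Wp : W (c p) by apply: chart_image_fun.
have bS i : smooth_on W (b i).
  move=> K; apply: (Ck_coord K (b i) oW).2 => a.
  have := smooth_fun_Ck K ac (smooth_field_coord a oU (frame_smooth fr i) ac).
  by apply: Ck_sub => y [cy Uy]; split=> //; split=> //; exact: Uc.
have comm i l y : W y -> 'D_(b i y) (b l) y = 'D_(b l y) (b i) y.
  move=> [cy Uy]; have := bracket0_commute ac oU Uc Uy (frame_smooth fr i)
    (frame_smooth fr l) (straight_frame_bracket i l fr Uc BP Uy).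
  by rewrite /b /= chart_invK.
have bP i y : W y -> b i y *m P = delta_mx 0 i by move=> [_ Uy]; exact: BP.
have [w [wS w0 Ww winj wD]] := flow_box oW Wp bS comm bP.
have wc x : chart_cod c (w x) := (Ww x).1.
pose j : euclidean R k -> N := chart_inv c \o w.
have jS : smooth_map j := chart_immersion_smooth ac wS wc.
have tj x : exists s : 'I_k -> R, (forall i, s i != 0) /\
    forall v, tmap j x v = \sum_i (s i * v 0 i) *: B i (j x).
  have [s [s0 sE]] := wD x; exists s; split=> // v.
  have cj : chart_dom c (j x) by exact: chart_invS.
  rewrite -(tangent_coordK (tmap j x v) ac cj) (tangent_coord_chart_immersion ac wS wc) sE.
  rewrite (linfun_lincomb (fun a u v => tangent_vec_linear a u v ac cj)).
  by apply: eq_bigr => i _; rewrite /b /= tangent_coordK.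
exists k, (euclidean R k), j; split; last first.
  by exists 0 => //; rewrite /j /= w0 chart_funK.
split; first split.
- exact: jS.
- move=> x y jxy; apply: winj; have := congr1 c jxy.
  by rewrite /j /= (chart_invK (wc x)) (chart_invK (wc y)).
- move=> x u v; have [s [s0 sE]] := tj x; rewrite !sE => uv.
  have Ux : U (j x) := (Ww x).2.
  have : \row_i (s i * u 0 i - s i * v 0 i) = 0.
    apply: (frame_free fr Ux); under eq_bigr do rewrite mxE scalerBl.
    by rewrite sumrB uv subrr.
  move=> /rowP H; apply/rowP => i; have := H i; rewrite !mxE -mulrBr => /eqP.
  by rewrite mulf_eq0 (negbTE (s0 i)) subr_eq0 => /eqP.
- move=> x; have [s [s0 sE]] := tj x; have Ux : U (j x) := (Ww x).2.
  apply/seteqP; split=> [_ [v _ <-]|u].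
    rewrite sE; have := frame_in fr Ux (\row_i (s i * v 0 i)).
    by under eq_bigr do rewrite mxE.
  move=> /(frame_span fr Ux)[z ->]; exists (\row_i ((s i)^-1 * z 0 i)) => //.
  by rewrite sE; apply: eq_bigr => i _; rewrite mxE mulVKf.
Qed.

End frobenius.

Theorem theorem4p10 (R : realType) (m n : nat)
    (M : manifold R m) (N : manifold R n)
    (g : M -> 'rV[R]_m -> 'rV[R]_m -> R)
    (F : M -> 'rV[R]_m -> 'rV[R]_m) (mu : R)
    (nablaM : M -> 'rV[R]_m -> (M -> 'rV[R]_m) -> 'rV[R]_m)
    (iota : N -> M) (D : N -> set 'rV[R]_n)
    (nablaN : N -> 'rV[R]_n -> (N -> 'rV[R]_n) -> 'rV[R]_n)
    (nablaMN : N -> 'rV[R]_n -> (N -> 'rV[R]_m) -> 'rV[R]_m)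
    (mu_sign : mu = 1 \/ mu = - 1)
    (M_gFmu : gFmu_manifold g F mu)
    (F_nondegenerate : nondegenerate_tensor F)
    (nablaM_levi_civita : levi_civita g nablaM)
    (F_parallel : parallel_tensor nablaM F)
    (N_submanifold : immersed_submanifold iota)
    (N_semi_invariant : semi_invariant iota g F D)
    (nablaN_levi_civita : levi_civita (induced_metric iota g) nablaN)
    (nablaMN_induced : pullback_connection iota nablaM nablaMN) :
  (integrable_distribution D /\
   totally_geodesic_foliation (induced_metric iota g) nablaN D) <->
  (forall X Y : N -> 'rV[R]_n, section_of D X -> section_of D Y ->
     section_along iota (Dtilde iota g F D)
       (second_fundamental_form iota nablaN nablaMN X Y)).
Proof.
have mu0 : mu != 0 by case: mu_sign => ->; rewrite ?oppr_eq0 oner_eq0.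
have F_inj p : injective (F p) by exact: bij_inj (F_nondegenerate p).
have tD := semi_invariant_distribution N_semi_invariant.
have [gM _ _] := M_gFmu.
have gNM := induced_metric_riemannian N_submanifold gM.
have cN := levi_civita_connection nablaN_levi_civita.
split=> [[int tg] X Y secX secY|H].
  apply: (sff_in_Dtilde mu0 M_gFmu nablaM_levi_civita F_parallel N_submanifold
    N_semi_invariant nablaN_levi_civita nablaMN_induced _ secX secY).
  move=> {secX secY} {}X {}Y p secX secY.
  (* Integrability places p on some integral manifold, to which total geodesy applies. *)
  have [k [L [j [jD [q _ <-]]]]] := int p.
  exact (totally_geodesic_leaf_autoparallel jD q (tg k L j jD) secX secY).
have apD := sff_autoparallel M_gFmu F_inj nablaM_levi_civita F_parallel N_submanifold
  N_semi_invariant nablaN_levi_civita nablaMN_induced H.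
split; first exact: autoparallel_integrable nablaN_levi_civita tD apD.
move=> k L j jD.
(* Total geodesy of a leaf asserts that two connections exist: the one along j is constructed here,
   and that of the leaf is derived from it. *)
have [nablaj njP] := pullback_connection_exists (submanifold_smooth jD.1) cN.
exact (autoparallel_leaf_totally_geodesic jD gNM nablaN_levi_civita tD apD njP).
Qed.
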